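(* Over the base ring $\mathbb{Z}$, one has the following extension groups in the functor category $\mathrm{Fun}$, for natural numbers $m,n$: (a) $\operatorname{Ext}^1(S^m,\Gamma^n)=0$ for all $m,n$. (b) $\operatorname{Ext}^1(S^m,\Lambda^n)=\mathbb{Z}/2$ when $m=n\geq 2$, and $0$ otherwise. (c) $\operatorname{Ext}^1(S^m,S^n)=0$ when $m\geq n$. (d) $\operatorname{Ext}^1(\Lambda^m,\Gamma^n)=\mathbb{Z}/2$ when $m=n\geq 2$, and $0$ otherwise. (e) $\operatorname{Ext}^1(\Lambda^m,\Lambda^n)=0$ for all $m,n$. (f) $\operatorname{Ext}^1(\Lambda^m,S^n)=0$ when $m\geq n$. (g) $\operatorname{Ext}^1(\Gamma^m,\Gamma^n)=0$ when $m=n$. (h) $\operatorname{Ext}^1(\Gamma^m,\Lambda^n)=0$ when $m\leq n$.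
   Context: $\mathrm{Fun}$ is the abelian category of all functors from finitely generated free abelian groups to abelian groups, and $\operatorname{Ext}^1$ is computed in $\mathrm{Fun}$. $S^n$, $\Lambda^n$, $\Gamma^n$ denote the $n$'th symmetric, exterior and divided power functors. *)

(* Defs.v *)
From HB Require Import structures.
From mathcomp Require Export all_boot all_order all_fingroup all_algebra.
From mathcomp Require Export boolp.
From mathcomp Require Import generic_quotient ring_quotient.
From mathcomp Require Import freeg.

Set Implicit Arguments.
Unset Strict Implicit.
Unset Printing Implicit Defensive.

Import GRing.Theory.

Local Open Scope ring_scope.
Local Open Scope quotient_scope.

Section QuotBy.
Variables (V : zmodType) (R : V -> Prop).

Inductive span : V -> Prop :=
| span0 : span 0
| span_sub x y : span x -> span y -> span (x - y)
| span_gen x : R x -> span x.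

Definition spanb : {pred V} := fun x => `[< span x >].

Lemma spanb_closed : zmod_closed spanb.
Proof.
split; first by apply/asboolP; exact: span0.
by move=> x y /asboolP xS /asboolP yS; apply/asboolP; exact: span_sub.
Qed.

HB.instance Definition _ := GRing.isZmodClosed.Build V spanb spanb_closed.

Definition quot_by : zmodType := Quotient.quot spanb.

Definition quot_pi : {additive V -> quot_by} := \pi_(Quotient.quot spanb).

Lemma quot_piE x y : (quot_pi x = quot_pi y) <-> span (x - y).
Proof.
split.
  by move=> /eqP; rewrite -Quotient.idealrBE => /asboolP.
by move=> h; apply/eqP; rewrite -Quotient.idealrBE; apply/asboolP.
Qed.

Lemma quot_pi_surj (q : quot_by) : exists x, q = quot_pi x.
Proof. by exists (repr q); rewrite /quot_pi /= reprK. Qed.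

End QuotBy.

Arguments quot_pi : simpl never.

Section QuotMap.
Variables (V W : zmodType) (R : V -> Prop) (S : W -> Prop).
Variables (f : {additive V -> W}) (fRS : forall x, R x -> span S (f x)).

Lemma span_map x : span R x -> span S (f x).
Proof.
elim=> [|a b _ ha _ hb|a /fRS //]; first by rewrite raddf0; exact: span0.
by rewrite raddfB; exact: span_sub.
Qed.

Definition quot_map_fun (q : quot_by R) : quot_by S :=
  quot_pi S (f (repr (q : Quotient.quot (spanb R)))).

Lemma quot_map_funE x : quot_map_fun (quot_pi R x) = quot_pi S (f x).
Proof.
apply/quot_piE; rewrite -raddfB; apply: span_map.
by apply/quot_piE; rewrite /quot_pi /= reprK.
Qed.

Lemma quot_map_additive : zmod_morphism quot_map_fun.
Proof.
move=> p q; have [x ->] := quot_pi_surj p; have [y ->] := quot_pi_surj q.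
by rewrite -raddfB !quot_map_funE !raddfB.
Qed.

HB.instance Definition _ :=
  GRing.isZmodMorphism.Build _ _ quot_map_fun quot_map_additive.

Definition quot_map : {additive quot_by R -> quot_by S} := quot_map_fun.

Lemma quot_mapE x : quot_map (quot_pi R x) = quot_pi S (f x).
Proof. exact: quot_map_funE. Qed.

End QuotMap.

Arguments quot_map : simpl never.

Section FreegMap.
Variables (K L : choiceType) (h : K -> L).

Definition freeg_map_fun : {freeg K} -> {freeg L} :=
  fglift (fun k => << h k >> : {freeg L}).

HB.instance Definition _ :=
  GRing.isZmodMorphism.Build {freeg K} {freeg L} freeg_map_fun
    (lift_is_additive (fun k => << h k >> : {freeg L})).

Definition freeg_map : {additive {freeg K} -> {freeg L}} := freeg_map_fun.

Lemma freeg_mapU k : freeg_map << k >> = << h k >>.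
Proof. by rewrite /freeg_map /= /freeg_map_fun liftU scale1r. Qed.

End FreegMap.

Arguments freeg_map : simpl never.

Lemma freeg_add_ext (K : choiceType) (V : zmodType)
    (f g : {additive {freeg K} -> V}) :
  (forall k, f << k >> = g << k >>) -> f =1 g.
Proof.
move=> fg D; rewrite -[D]freeg_sumE !raddf_sum; apply: eq_bigr => k _.
by rewrite -[coeff k D]intz -freegU_mulz !raddfMz fg.
Qed.

Record fgfree := FgFree {
  fg_sort :> zmodType;
  fg_basis : exists (n : nat) (e : 'I_n -> fg_sort),
    bijective (fun c : {ffun 'I_n -> int} => \sum_(i < n) e i *~ c i)
}.

(* fmap f need not be additive in f.  No law is needed for pointwise equal f and
   g: by funext and proof irrelevance they are equal. *)
Record functor := Functor {
  fobj :> fgfree -> zmodType;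
  fmap : forall A B : fgfree, {additive A -> B} -> {additive fobj A -> fobj B};
  fmap_id : forall A : fgfree, fmap (idfun : {additive A -> A}) =1 id;
  fmap_comp : forall (A B C : fgfree)
    (f : {additive A -> B}) (g : {additive B -> C}),
    fmap (g \o f : {additive A -> C}) =1 fmap g \o fmap f
}.
Arguments fmap F [A B] f : rename.

Record nat_trans (F G : functor) := NatTrans {
  nt :> forall A : fgfree, {additive F A -> G A};
  ntE : forall (A B : fgfree) (f : {additive A -> B}),
    nt B \o fmap F f =1 fmap G f \o nt A
}.

(* 0 -> G -> E -> F -> 0; exactness in the functor category is objectwise. *)
Record extension (F G : functor) := Extension {
  ext_mid :> functor;
  ext_inj : nat_trans G ext_mid;
  ext_prj : nat_trans ext_mid F;
  ext_injP : forall A, injective (ext_inj A);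
  ext_prjP : forall (A : fgfree) (y : F A), exists x, ext_prj A x = y;
  ext_exact : forall (A : fgfree) (x : ext_mid A),
    ext_prj A x = 0 <-> exists g, x = ext_inj A g
}.

(* Yoneda equivalence; such an h is automatically an isomorphism. *)
Definition ext_equiv (F G : functor) (E E' : extension F G) : Prop :=
  exists h : nat_trans E E',
    (forall (A : fgfree) (g : G A), h A (ext_inj E A g) = ext_inj E' A g) /\
    (forall (A : fgfree) (x : E A), ext_prj E' A (h A x) = ext_prj E A x).

(* E1 x_F E2 modulo the copy { (g, -g) | g in G } of G. *)
Section BaerSum.
Variables (F G : functor) (E1 E2 : extension F G).

Section Objects.
Variable A : fgfree.

Definition pb_pred : {pred E1 A * E2 A} :=
  fun x => ext_prj E1 A x.1 == ext_prj E2 A x.2.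

Lemma pb_pred_closed : zmod_closed pb_pred.
Proof.
split; first by rewrite unfold_in /pb_pred !raddf0.
move=> x y; rewrite !unfold_in /pb_pred => /eqP hx /eqP hy.
by rewrite !raddfB hx hy.
Qed.

HB.instance Definition _ :=
  GRing.isZmodClosed.Build (E1 A * E2 A)%type pb_pred pb_pred_closed.

Record pullback := Pullback {
  pb_val :> E1 A * E2 A;
  pb_valP : pb_val \in pb_pred
}.

HB.instance Definition _ := [isSub for pb_val].
HB.instance Definition _ := [Choice of pullback by <:].
HB.instance Definition _ := [SubChoice_isSubZmodule of pullback by <:].

Definition antidiag (z : pullback) : Prop :=
  exists g : G A, pb_val z = (ext_inj E1 A g, - ext_inj E2 A g).

Definition baer_obj : zmodType := quot_by antidiag.

Lemma span_antidiag z : span antidiag z -> antidiag z.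
Proof.
elim=> //.
  by exists 0; rewrite !raddf0.
move=> x y _ [g hg] _ [h hh]; exists (g - h).
have -> : pb_val (x - y) = pb_val x - pb_val y by [].
rewrite hg hh !raddfB; congr (_, _).
Qed.

End Objects.

Arguments pb_pred A : clear implicits.

Section Maps.
Variables (A B : fgfree) (f : {additive A -> B}).

Lemma pb_map_subproof (x : pullback A) :
  (fmap E1 f (pb_val x).1, fmap E2 f (pb_val x).2) \in pb_pred B.
Proof.
rewrite unfold_in /pb_pred /=.
have := ntE (ext_prj E1) f (pb_val x).1; rewrite /= => ->.
have := ntE (ext_prj E2) f (pb_val x).2; rewrite /= => ->.
by rewrite (eqP (pb_valP x)).
Qed.

Definition pb_map_fun (x : pullback A) : pullback B :=
  Pullback (pb_map_subproof x).

Lemma pb_map_additive : zmod_morphism pb_map_fun.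
Proof. by move=> x y; apply: val_inj; rewrite /= !raddfB. Qed.

HB.instance Definition _ :=
  GRing.isZmodMorphism.Build _ _ pb_map_fun pb_map_additive.

Definition pb_map : {additive pullback A -> pullback B} := pb_map_fun.

Lemma pb_map_antidiag x : antidiag x -> span (@antidiag B) (pb_map x).
Proof.
case=> g hg; apply: span_gen; exists (fmap G f g).
rewrite /= hg /= raddfN.
have := ntE (ext_inj E1) f g; rewrite /= => ->.
by have := ntE (ext_inj E2) f g; rewrite /= => ->.
Qed.

Definition baer_map : {additive baer_obj A -> baer_obj B} :=
  quot_map pb_map_antidiag.

Lemma baer_mapE x :
  baer_map (quot_pi (@antidiag A) x) = quot_pi (@antidiag B) (pb_map x).
Proof. exact: quot_mapE. Qed.

End Maps.

Arguments baer_map : simpl never.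

Lemma baer_map_id (A : fgfree) : baer_map (idfun : {additive A -> A}) =1 id.
Proof.
move=> q; have [x ->] := quot_pi_surj q; rewrite baer_mapE; congr (quot_pi _ _).
apply: val_inj; rewrite /= !fmap_id.
by case: (pb_val x).
Qed.

Lemma baer_map_comp (A B C : fgfree)
    (f : {additive A -> B}) (g : {additive B -> C}) :
  baer_map (g \o f : {additive A -> C}) =1 baer_map g \o baer_map f.
Proof.
move=> q; have [x ->] := quot_pi_surj q; rewrite -[RHS]/(baer_map g (baer_map f _)) !baer_mapE.
by congr (quot_pi _ _); apply: val_inj; rewrite /= !fmap_comp.
Qed.

Definition baer_mid : functor := Functor baer_map_id baer_map_comp.

Section Inj.
Variable A : fgfree.

Lemma baer_inj_subproof (g : G A) : (ext_inj E1 A g, 0) \in pb_pred A.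
Proof.
rewrite unfold_in /pb_pred /= raddf0; apply/eqP.
by apply/ext_exact; exists g.
Qed.

Definition pb_inj (g : G A) : pullback A := Pullback (baer_inj_subproof g).

Definition baer_inj_fun (g : G A) : baer_mid A :=
  quot_pi (@antidiag A) (pb_inj g).

Lemma baer_inj_additive : zmod_morphism baer_inj_fun.
Proof.
move=> x y; rewrite /baer_inj_fun -raddfB; congr (quot_pi _ _).
by apply: val_inj; rewrite /= raddfB; congr (_, _); rewrite /= subr0.
Qed.

HB.instance Definition _ :=
  GRing.isZmodMorphism.Build _ _ baer_inj_fun baer_inj_additive.

Lemma pb_prj_additive :
  zmod_morphism (fun x : pullback A => ext_prj E1 A (pb_val x).1).
Proof. by move=> x y; rewrite /= raddfB. Qed.

Definition baer_prj_fun (q : baer_mid A) : F A :=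
  ext_prj E1 A (pb_val (repr (q : Quotient.quot (spanb (@antidiag A))))).1.

Lemma baer_prj_funE x :
  baer_prj_fun (quot_pi (@antidiag A) x) = ext_prj E1 A (pb_val x).1.
Proof.
rewrite /baer_prj_fun; set y := repr _.
have /quot_piE/span_antidiag [g hg] :
    quot_pi (@antidiag A) y = quot_pi (@antidiag A) x.
  by rewrite /quot_pi /= /y reprK.
apply/eqP; rewrite -subr_eq0 -raddfB; apply/eqP.
have -> : (pb_val y).1 - (pb_val x).1 = (pb_val (y - x)).1 by [].
by rewrite hg /=; apply/ext_exact; exists g.
Qed.

Lemma baer_prj_additive : zmod_morphism baer_prj_fun.
Proof.
move=> p q; have [x ->] := quot_pi_surj p; have [y ->] := quot_pi_surj q.
by rewrite -raddfB !baer_prj_funE pb_prj_additive.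
Qed.

HB.instance Definition _ :=
  GRing.isZmodMorphism.Build _ _ baer_prj_fun baer_prj_additive.

End Inj.

Definition baer_inj : nat_trans G baer_mid.
Proof.
exists (fun A => @baer_inj_fun A : {additive G A -> baer_mid A}).
move=> A B f g; rewrite /= /baer_inj_fun baer_mapE; congr (quot_pi _ _).
apply: val_inj; rewrite /= raddf0.
by have := ntE (ext_inj E1) f g; rewrite /= => ->.
Defined.

Definition baer_prj : nat_trans baer_mid F.
Proof.
exists (fun A => @baer_prj_fun A : {additive baer_mid A -> F A}).
move=> A B f q; have [x ->] := quot_pi_surj q.
rewrite /= baer_mapE !baer_prj_funE /=.
by have := ntE (ext_prj E1) f (pb_val x).1.
Defined.

Definition baer_sum : extension F G.
Proof.
apply: (@Extension F G baer_mid baer_inj baer_prj).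
- move=> A g g' /= /quot_piE/span_antidiag [k].
  have -> : pb_val (pb_inj g - pb_inj g') = pb_val (pb_inj g) - pb_val (pb_inj g')
    by [].
  case=> /= hg hk; apply: (@ext_injP _ _ E1 A).
  have k0 : k = 0.
    apply: (@ext_injP _ _ E2 A); rewrite raddf0; apply/eqP.
    by rewrite -oppr_eq0 -hk subr0.
  by apply/eqP; rewrite -subr_eq0 hg k0 raddf0.
- move=> A y; have [x1 h1] := ext_prjP E1 y; have [x2 h2] := ext_prjP E2 y.
  have hx : (x1, x2) \in pb_pred A by rewrite unfold_in /pb_pred /= h1 h2.
  by exists (quot_pi (@antidiag A) (Pullback hx)); rewrite /= baer_prj_funE.
- move=> A q; have [x ->] := quot_pi_surj q; rewrite /= baer_prj_funE; split.
    move=> x1; have x2 := x1; move/ext_exact: x1 => [g1 hg1].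
    rewrite (eqP (pb_valP x)) in x2; move/ext_exact: x2 => [g2 hg2].
    exists (g1 + g2); apply/quot_piE/span_gen; exists (- g2).
    have -> : pb_val (x - pb_inj (g1 + g2)) = pb_val x - pb_val (pb_inj (g1 + g2))
      by [].
    case: (pb_val x) hg1 hg2 => a b /= -> ->.
    congr (_, _); rewrite /= ?subr0 ?raddfN ?opprK //.
    by rewrite raddfD opprD addrA subrr add0r.
  case=> g /quot_piE/span_antidiag [k].
  have -> : pb_val (x - pb_inj g) = pb_val x - pb_val (pb_inj g) by [].
  case: (pb_val x) => a b [] /= h _; apply/ext_exact; exists (k + g).
  by rewrite raddfD -h subrK.
Defined.

End BaerSum.

(* Ext^1(F, G) is isomorphic to A: there is an additive bijection onto A from
   the classes of extensions with the Baer sum.  It is phrased through a map phi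
   on extensions because the classes live in a larger universe than the
   carriers of zmodType. *)
Definition Ext1_is (F G : functor) (A : zmodType) : Prop :=
  exists phi : extension F G -> A,
    [/\ forall E E', phi E = phi E' <-> ext_equiv E E',
        forall a, exists E, phi E = a
      & forall E E', phi (baer_sum E E') = phi E + phi E'].

Section Presented.
Variables (K : fgfree -> choiceType).
Variable h : forall A B : fgfree, {additive A -> B} -> K A -> K B.
Variable R : forall A, {freeg (K A)} -> Prop.
Hypothesis h_id : forall A : fgfree, h (idfun : {additive A -> A}) =1 id.
Hypothesis h_comp : forall (A B C : fgfree)
  (f : {additive A -> B}) (g : {additive B -> C}),
  h (g \o f : {additive A -> C}) =1 h g \o h f.
Hypothesis h_rel : forall (A B : fgfree) (f : {additive A -> B}) r,
  R r -> span (@R B) (freeg_map (h f) r).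

Definition presented_map (A B : fgfree) (f : {additive A -> B}) :
  {additive quot_by (@R A) -> quot_by (@R B)} := quot_map (@h_rel A B f).

Lemma presented_id (A : fgfree) :
  presented_map (idfun : {additive A -> A}) =1 id.
Proof.
move=> q; have [x ->] := quot_pi_surj q; rewrite quot_mapE; congr (quot_pi _ _).
apply: (freeg_add_ext (g := idfun)) => k.
by rewrite freeg_mapU h_id.
Qed.

Lemma presented_comp (A B C : fgfree)
    (f : {additive A -> B}) (g : {additive B -> C}) :
  presented_map (g \o f : {additive A -> C})
    =1 presented_map g \o presented_map f.
Proof.
move=> q; have [x ->] := quot_pi_surj q.
rewrite -[RHS]/(presented_map g (presented_map f _)).
rewrite [presented_map f _]quot_mapE !quot_mapE.
congr (quot_pi _ _).
apply: (freeg_add_ext (g := freeg_map (h g) \o freeg_map (h f))) => k.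
by rewrite /= !freeg_mapU h_comp.
Qed.

Definition presented : functor := Functor presented_id presented_comp.

End Presented.

Section PowerRelations.
Variables (n : nat) (A : zmodType).
Implicit Types (t : {ffun 'I_n -> A}) (x y : A).

Definition upd t (i : 'I_n) x : {ffun 'I_n -> A} :=
  [ffun j => if j == i then x else t j].

Inductive multilinear_rel : {freeg {ffun 'I_n -> A}} -> Prop :=
| Multilinear t i x y : multilinear_rel
    (<< upd t i (x + y) >> - << upd t i x >> - << upd t i y >>).

Inductive sym_rel : {freeg {ffun 'I_n -> A}} -> Prop :=
| SymMultilinear r : multilinear_rel r -> sym_rel r
| SymPerm t (s : 'S_n) : sym_rel (<< [ffun i => t (s i)] >> - << t >>).

Inductive alt_rel : {freeg {ffun 'I_n -> A}} -> Prop :=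
| ExtMultilinear r : multilinear_rel r -> alt_rel r
| ExtAlternating t i j : i != j -> t i = t j -> alt_rel << t >>.

(* A word [:: (k1, x1); (k2, x2); ...] stands for the product
   gamma_{k1}(x1) gamma_{k2}(x2) ... in the divided power algebra of A.  The
   relations other than DivWeight are Roby's and preserve the weight k1 + k2 +
   ...; DivWeight kills all the graded components but the n'th. *)
Definition weight (w : seq (nat * A)) : nat := sumn [seq p.1 | p <- w].

Inductive div_rel : {freeg (seq (nat * A))} -> Prop :=
| DivWeight w : weight w != n -> div_rel << w >>
| DivPerm w w' : perm_eq w w' -> div_rel (<< w >> - << w' >>)
| DivZero x w : div_rel (<< (0%N, x) :: w >> - << w >>)
| DivScale k (c : int) x w : div_rel
    (<< (k, x *~ c) :: w >> - << (k, x) :: w >> *~ (c ^+ k))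
| DivMul i j x w : div_rel
    (<< [:: (i, x), (j, x) & w] >> - << ((i + j)%N, x) :: w >> *+ 'C(i + j, i))
| DivAdd k x y w : div_rel
    (<< (k, x + y) :: w >>
     - \sum_(i < k.+1) << [:: (i : nat, x), ((k - i)%N, y) & w] >>).

End PowerRelations.

Section Powers.
Variable n : nat.

Definition tuple_map (A B : fgfree) (f : {additive A -> B})
  (t : {ffun 'I_n -> A}) : {ffun 'I_n -> B} := [ffun i => f (t i)].

Lemma tuple_map_id (A : fgfree) : tuple_map (idfun : {additive A -> A}) =1 id.
Proof. by move=> t; apply/ffunP => i; rewrite ffunE. Qed.

Lemma tuple_map_comp (A B C : fgfree)
    (f : {additive A -> B}) (g : {additive B -> C}) :
  tuple_map (g \o f : {additive A -> C}) =1 tuple_map g \o tuple_map f.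
Proof. by move=> t; apply/ffunP => i; rewrite /= !ffunE. Qed.

Lemma tuple_map_upd (A B : fgfree) (f : {additive A -> B}) t i x :
  tuple_map f (upd t i x) = upd (tuple_map f t) i (f x).
Proof. by apply/ffunP => j; rewrite !ffunE; case: eqP. Qed.

Lemma multilinear_map (A B : fgfree) (f : {additive A -> B}) r :
  multilinear_rel r -> multilinear_rel (freeg_map (tuple_map f) r).
Proof.
case=> t i x y; rewrite !raddfB !freeg_mapU !tuple_map_upd raddfD.
exact: Multilinear.
Qed.

Lemma sym_map (A B : fgfree) (f : {additive A -> B}) r :
  sym_rel r -> span (@sym_rel n B) (freeg_map (tuple_map f) r).
Proof.
case=> [{}r hr|t s]; apply: span_gen.
  by apply: SymMultilinear; exact: multilinear_map.
rewrite raddfB !freeg_mapU.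
have -> : tuple_map f [ffun i => t (s i)] = [ffun i => tuple_map f t (s i)].
  by apply/ffunP => i; rewrite !ffunE.
exact: SymPerm.
Qed.

Lemma alt_map (A B : fgfree) (f : {additive A -> B}) r :
  alt_rel r -> span (@alt_rel n B) (freeg_map (tuple_map f) r).
Proof.
case=> [{}r hr|t i j ij tij]; apply: span_gen.
  by apply: ExtMultilinear; exact: multilinear_map.
by rewrite freeg_mapU; apply: (ExtAlternating ij); rewrite !ffunE tij.
Qed.

Definition word_map (A B : fgfree) (f : {additive A -> B})
  (w : seq (nat * A)) : seq (nat * B) := [seq (p.1, f p.2) | p <- w].

Lemma word_map_id (A : fgfree) : word_map (idfun : {additive A -> A}) =1 id.
Proof. by elim=> //= [[k x] w /= ->]. Qed.

Lemma word_map_comp (A B C : fgfree)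
    (f : {additive A -> B}) (g : {additive B -> C}) :
  word_map (g \o f : {additive A -> C}) =1 word_map g \o word_map f.
Proof. by elim=> //= [[k x] w /= ->]. Qed.

Lemma div_map (A B : fgfree) (f : {additive A -> B}) r :
  div_rel n r -> span (@div_rel n B) (freeg_map (word_map f) r).
Proof.
case=> [w hw|w w' hw|x w|k c x w|i j x w|k x y w]; apply: span_gen.
- rewrite freeg_mapU; apply: DivWeight.
  by rewrite /weight /word_map -map_comp.
- by rewrite raddfB !freeg_mapU; apply: DivPerm; exact: perm_map.
- by rewrite raddfB !freeg_mapU; exact: DivZero.
- by rewrite raddfB raddfMz !freeg_mapU /= raddfMz; exact: DivScale.
- by rewrite raddfB raddfMn !freeg_mapU; exact: DivMul.
- rewrite raddfB raddf_sum !freeg_mapU /= raddfD.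
  under eq_bigr do rewrite freeg_mapU /=.
  exact: DivAdd.
Qed.

Definition SymPow : functor := presented tuple_map_id tuple_map_comp sym_map.

Definition ExtPow : functor := presented tuple_map_id tuple_map_comp alt_map.

Definition DivPow : functor := presented word_map_id word_map_comp div_map.

End Powers.

(* Main.v *)
(* Let G be S^n, Lambda^n or Gamma^n, and Z^k the standard objects.  The
   cross-effect operator prod_i (1 - pi_i), where pi_i kills the i'th coordinate,
   vanishes on G(Z^k) for k > n, and maps G(Z^n) onto the line spanned by the
   generic element x_1 ... x_n.

   Let E be an extension of F by G with F = S^m or Lambda^m and n <= m.  The
   generic element of F lifts to an e in E(Z^m) killed by all the pi_i, and e is
   automatically additive in each of its m arguments.  The symmetric group acts
   on e through the character of F up to a 1-cocycle with values in Z (which is 0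
   when n < m).  If the cocycle vanishes, then e defines a section F -> E.  When
   m = n and the characters of F and G agree the cocycle is a homomorphism to Z,
   hence 0; otherwise only its parity matters, and it is the invariant in Z/2.
   An extension with odd cocycle is the pullback of 0 -> G -2-> G -> G/2 -> 0
   along a map F -> G/2; for F = Lambda^n, G = S^n there is none, because
   x_1^2 x_3 ... x_n is not divisible by 2 in S^n.

   The cases with m < n or F = Gamma^m are dual: the coefficient functional of
   x_1 ... x_n on G(Z^n), G = Gamma^n or Lambda^n, extends to a functional on
   E(Z^n) which is multiadditive and symmetric or alternating.  As Gamma^n(A) and
   Lambda^n(A) are the symmetric and alternating forms on the dual of A, it
   defines a retraction E -> G. *)
From HB Require Import structures.
Require Import Defs.
From mathcomp Require Import freeg zify ring.

Set Implicit Arguments.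
Unset Strict Implicit.
Unset Printing Implicit Defensive.

Import Order.TTheory GRing.Theory Num.Theory.

Local Open Scope ring_scope.

(** * Additive maps and presented functors *)

(** Every group is reached by splitting extensions one at a time: two extensions are equivalent as
    soon as their Baer difference splits, so a group vanishes once all its extensions split, and the
    parity is injective once parity zero splits. The two methods have different domains. S^m and
    Lambda^m have multilinear generators, so one well-behaved element of E yields a section. Gamma^n
    and Lambda^n have coordinates obtained by pulling back one functional, so one well-behaved
    functional on E yields a retraction; S^n lacks this, since the coefficient of x_1 x_2 in (x_1 +
    x_2)^2 is 2. Hence the two interfaces [is_power] and [is_copower]; (a), (b), (d) and (e) need
    both methods. Duality alone does not settle the extensions of Gamma^n by Lambda^n, where the
    characters differ. There the defect of the functional is twice one of its values, and a multiple
    of the coefficient functional of Gamma^n removes it. *)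

Section AdditiveMaps.

Lemma subrACA (V : zmodType) (x y z t : V) :
  (x - y) - (z - t) = (x - z) - (y - t).
Proof.
rewrite !opprB -!addrA; congr (_ + _).
by rewrite addrCA [RHS]addrCA [X in _ + X = _]addrC.
Qed.

Lemma additive_ext (U V : zmodType) (f g : {additive U -> V}) : f =1 g -> f = g.
Proof.
case: f => f cf; case: g => g cg /= /funext efg; subst g.
by congr (_ _); case: cf => -[a]; case: cg => -[b]; rewrite (Prop_irrelevance a b).
Qed.

Fact mk_additive_key (U V : zmodType) (f : U -> V) (fB : zmod_morphism f) :
  { g : {additive U -> V} | g =1 f }.
Proof.
pose g : {additive U -> V} := HB.pack f (GRing.isZmodMorphism.Build U V f fB).
by exists g.
Qed.

(* Opaque, so that simplification does not unfold the maps built with it. *)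
Definition mk_additive (U V : zmodType) (f : U -> V) (fB : zmod_morphism f) :
  {additive U -> V} := sval (mk_additive_key fB).

Lemma mk_additiveE (U V : zmodType) (f : U -> V) (fB : zmod_morphism f) x :
  mk_additive fB x = f x.
Proof. exact: svalP (mk_additive_key fB) x. Qed.

Lemma fmap_eq (F : functor) (A B : fgfree) (f g : {additive A -> B}) :
  f =1 g -> forall x, fmap F f x = fmap F g x.
Proof. by move=> /additive_ext ->. Qed.

Lemma fmap_compE (F : functor) (A B C : fgfree) (g : {additive B -> C})
    (f : {additive A -> B}) (h : {additive A -> C}) :
  (forall x, g (f x) = h x) -> forall x, fmap F g (fmap F f x) = fmap F h x.
Proof.
move=> gf x.
rewrite -[LHS]/((fmap F g \o fmap F f) x) -(fmap_comp f g).
exact: fmap_eq.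
Qed.

Lemma fmap_idE (F : functor) (A : fgfree) (f : {additive A -> A}) :
  f =1 id -> forall x, fmap F f x = x.
Proof.
by move=> fid x; rewrite (fmap_eq (g := idfun : {additive A -> A})) ?fmap_id.
Qed.

Lemma nt_nat (F G : functor) (h : nat_trans F G) (A B : fgfree)
    (f : {additive A -> B}) x :
  h B (fmap F f x) = fmap G f (h A x).
Proof. exact: (ntE h f x). Qed.

End AdditiveMaps.

Section Presented.

(** Integer multiples [*~] replace the scaling used by [fglift], so that the target may be any
    [zmodType]. *)
Definition freeg_lift_fun (K : choiceType) (V : zmodType) (h : K -> V)
    (D : {freeg K}) : V := \sum_(k <- dom D) h k *~ coeff k D.

(** Enlarging the list of summation lets [D], [E] and [D - E] be summed over one common list, which
    gives additivity. *)
Lemma freeg_lift_sum (K : choiceType) (V : zmodType) (h : K -> V)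
    (D : {freeg K}) (s : seq K) :
  uniq s -> {subset dom D <= s} ->
  freeg_lift_fun h D = \sum_(k <- s) h k *~ coeff k D.
Proof.
move=> us sub; rewrite (bigID (mem (dom D))) /= [X in _ + X]big1 ?addr0.
  rewrite -big_filter; apply: perm_big; apply: uniq_perm.
  - exact: uniq_dom.
  - exact: filter_uniq.
  - by move=> k; rewrite mem_filter /=; case E: (k \in dom D) => //=; rewrite sub.
by move=> k kD; rewrite coeff_outdom ?mulr0z.
Qed.

Lemma freeg_lift_is_additive (K : choiceType) (V : zmodType) (h : K -> V) :
  zmod_morphism (freeg_lift_fun h).
Proof.
move=> D E; pose s := undup (dom D ++ dom E).
have sD : {subset dom D <= s} by move=> k; rewrite mem_undup mem_cat => ->.
have sE : {subset dom E <= s}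
  by move=> k; rewrite mem_undup mem_cat orbC => ->.
have sB : {subset dom (D - E) <= s}.
  by move=> k /domB; rewrite mem_undup.
have us : uniq s := undup_uniq _.
rewrite (freeg_lift_sum h us sB) (freeg_lift_sum h us sD) (freeg_lift_sum h us sE).
by rewrite -sumrB; apply: eq_bigr => k _; rewrite coeffB mulrzBr.
Qed.

Definition freeg_lift (K : choiceType) (V : zmodType) (h : K -> V) :
    {additive {freeg K} -> V} := mk_additive (freeg_lift_is_additive h).

Lemma freeg_liftU (K : choiceType) (V : zmodType) (h : K -> V) k :
  freeg_lift h << k >> = h k.
Proof.
by rewrite /freeg_lift mk_additiveE /freeg_lift_fun domU1 big_seq1 coeffU eqxx mulr1.
Qed.

Lemma freeg_ind (K : choiceType) (P : {freeg K} -> Prop) :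
  P 0 -> (forall x y, P x -> P y -> P (x - y)) -> (forall k, P << k >>) ->
  forall x, P x.
Proof.
move=> P0 PB PU x.
have PN y : P y -> P (- y) by move=> Py; rewrite -[- y]add0r; exact: PB.
have PD y z : P y -> P z -> P (y + z).
  by move=> Py Pz; rewrite -[z]opprK; apply: PB => //; exact: PN.
rewrite -[x]freeg_sumE; apply: big_ind => // k _.
rewrite -[coeff k x]intz -freegU_mulz; case: (coeff k x) => n.
  by rewrite -pmulrn; elim: n => [|n IH]; rewrite ?mulr0n // mulrS; apply: PD.
rewrite NegzE mulrNz; apply: PN; rewrite -pmulrn.
by elim: n.+1 => [|{}n IH]; rewrite ?mulr0n // mulrS; apply: PD.
Qed.

Lemma quot_ind (K : choiceType) (R : {freeg K} -> Prop)
    (P : quot_by R -> Prop) :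
  P 0 -> (forall x y, P x -> P y -> P (x - y)) ->
  (forall k, P (quot_pi R << k >>)) -> forall x, P x.
Proof.
move=> P0 PB PU q; have [x ->] := quot_pi_surj q.
elim/freeg_ind: x => [|x y Px Py|//]; first by rewrite raddf0.
by rewrite raddfB; apply: PB.
Qed.

Lemma quot_pi_rel (V : zmodType) (R : V -> Prop) x : R x -> quot_pi R x = 0.
Proof.
move=> Rx; rewrite -(raddf0 (quot_pi R)); apply/quot_piE.
by rewrite subr0; exact: span_gen.
Qed.

Section Lift.
Variables (K : choiceType) (R : {freeg K} -> Prop) (V : zmodType) (h : K -> V).
Hypothesis hR : forall r, R r -> freeg_lift h r = 0.

Let hS r : span R r -> freeg_lift h r = 0.
Proof.
elim=> [|x y _ hx _ hy|x /hR //]; first by rewrite raddf0.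
by rewrite raddfB hx hy subr0.
Qed.

Definition quot_lift_fun (q : quot_by R) : V :=
  freeg_lift h (sval (cid (quot_pi_surj q))).

Let quot_lift_funE x : quot_lift_fun (quot_pi R x) = freeg_lift h x.
Proof.
rewrite /quot_lift_fun; case: cid => y /= /esym /quot_piE /hS.
by rewrite raddfB => /eqP; rewrite subr_eq0 => /eqP.
Qed.

Let quot_lift_is_additive : zmod_morphism quot_lift_fun.
Proof.
move=> p q; have [x ->] := quot_pi_surj p; have [y ->] := quot_pi_surj q.
by rewrite -raddfB !quot_lift_funE raddfB.
Qed.

Definition quot_lift : {additive quot_by R -> V} :=
  mk_additive quot_lift_is_additive.

Lemma quot_liftU k : quot_lift (quot_pi R << k >>) = h k.
Proof.
by rewrite mk_additiveE quot_lift_funE freeg_liftU.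
Qed.

End Lift.

End Presented.

(** * Classes of generators in the three power functors *)

Section Powers.
Variable n : nat.

Definition scls (A : fgfree) (t : {ffun 'I_n -> A}) : SymPow n A :=
  quot_pi (@sym_rel n A) << t >>.
Definition ecls (A : fgfree) (t : {ffun 'I_n -> A}) : ExtPow n A :=
  quot_pi (@alt_rel n A) << t >>.
Definition dcls (A : fgfree) (w : seq (nat * A)) : DivPow n A :=
  quot_pi (@div_rel n A) << w >>.

Lemma scls_map (A B : fgfree) (f : {additive A -> B}) t :
  fmap (SymPow n) f (scls t) = scls (tuple_map f t).
Proof. exact: etrans (quot_mapE _ _) (congr1 _ (freeg_mapU _ _)). Qed.
Lemma ecls_map (A B : fgfree) (f : {additive A -> B}) t :
  fmap (ExtPow n) f (ecls t) = ecls (tuple_map f t).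
Proof. exact: etrans (quot_mapE _ _) (congr1 _ (freeg_mapU _ _)). Qed.
Lemma dcls_map (A B : fgfree) (f : {additive A -> B}) w :
  fmap (DivPow n) f (dcls w) = dcls (word_map f w).
Proof. exact: etrans (quot_mapE _ _) (congr1 _ (freeg_mapU _ _)). Qed.

Lemma sclsD (A : fgfree) (t : {ffun 'I_n -> A}) i x y :
  scls (upd t i (x + y)) = scls (upd t i x) + scls (upd t i y).
Proof.
have := quot_pi_rel (SymMultilinear (Multilinear t i x y)).
rewrite 2!raddfB => /eqP; rewrite subr_eq0 => /eqP h.
by apply/eqP; rewrite [X in _ == X]addrC -subr_eq; apply/eqP.
Qed.
Lemma eclsD (A : fgfree) (t : {ffun 'I_n -> A}) i x y :
  ecls (upd t i (x + y)) = ecls (upd t i x) + ecls (upd t i y).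
Proof.
have := quot_pi_rel (ExtMultilinear (Multilinear t i x y)).
rewrite 2!raddfB => /eqP; rewrite subr_eq0 => /eqP h.
by apply/eqP; rewrite [X in _ == X]addrC -subr_eq; apply/eqP.
Qed.
Lemma scls_perm (A : fgfree) (t : {ffun 'I_n -> A}) (s : 'S_n) :
  scls [ffun i => t (s i)] = scls t.
Proof.
have := quot_pi_rel (SymPerm t s).
by rewrite !raddfB => /eqP; rewrite subr_eq0 => /eqP.
Qed.
Lemma ecls_alt (A : fgfree) (t : {ffun 'I_n -> A}) i j : i != j -> t i = t j -> ecls t = 0.
Proof. by move=> ij tij; apply: quot_pi_rel; apply: (ExtAlternating ij). Qed.

Lemma dcls_weight (A : fgfree) (w : seq (nat * A)) : weight w != n -> dcls w = 0.
Proof. by move=> h; apply/quot_pi_rel/DivWeight. Qed.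
Lemma dcls_perm (A : fgfree) (w w' : seq (nat * A)) : perm_eq w w' -> dcls w = dcls w'.
Proof.
move=> ww'; have := quot_pi_rel (DivPerm n ww').
by rewrite raddfB => /eqP; rewrite subr_eq0 => /eqP.
Qed.
Lemma dcls_zero (A : fgfree) x (w : seq (nat * A)) : dcls ((0%N, x) :: w) = dcls w.
Proof.
have := quot_pi_rel (DivZero n x w).
by rewrite raddfB => /eqP; rewrite subr_eq0 => /eqP.
Qed.
Lemma dcls_scale (A : fgfree) k (c : int) x (w : seq (nat * A)) :
  dcls ((k, x *~ c) :: w) = dcls ((k, x) :: w) *~ (c ^+ k).
Proof.
have := quot_pi_rel (DivScale n k c x w).
by rewrite raddfB raddfMz => /eqP; rewrite subr_eq0 => /eqP.
Qed.
Lemma dcls_mul (A : fgfree) i j x (w : seq (nat * A)) :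
  dcls [:: (i, x), (j, x) & w] = dcls (((i + j)%N, x) :: w) *+ 'C(i + j, i).
Proof.
have := quot_pi_rel (DivMul n i j x w).
by rewrite raddfB raddfMn => /eqP; rewrite subr_eq0 => /eqP.
Qed.
Lemma dcls_add (A : fgfree) k x y (w : seq (nat * A)) :
  dcls ((k, x + y) :: w) =
  \sum_(i < k.+1) dcls [:: (i : nat, x), ((k - i)%N, y) & w].
Proof.
have := quot_pi_rel (DivAdd n k x y w).
by rewrite raddfB raddf_sum => /eqP; rewrite subr_eq0 => /eqP.
Qed.

End Powers.

(** * Cross-effects on the objects Z^k *)

Section StandardObjects.
Variable k : nat.

Definition delta (i : 'I_k) : {ffun 'I_k -> int} := [ffun j => (j == i)%:R].

Lemma delta_sum (v : {ffun 'I_k -> int}) : \sum_i delta i *~ v i = v.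
Proof.
apply/ffunP => j; rewrite sum_ffunE (bigD1 j) //= big1 ?addr0.
  by rewrite ffunMzE ffunE eqxx -mulrzl mulr1 intz.
by move=> i ij; rewrite ffunMzE ffunE eq_sym (negbTE ij) mul0rz.
Qed.

Lemma Zn_basis : exists (n : nat) (e : 'I_n -> {ffun 'I_k -> int}),
  bijective (fun c : {ffun 'I_n -> int} => \sum_(i < n) e i *~ c i).
Proof. by exists k, delta; exists id => v; rewrite delta_sum. Qed.

Definition Zn : fgfree := FgFree Zn_basis.

Lemma lin_is_additive (A : zmodType) (a : 'I_k -> A) :
  zmod_morphism (fun v : {ffun 'I_k -> int} => \sum_i a i *~ v i).
Proof.
move=> v w; rewrite -sumrB; apply: eq_bigr => i _.
by rewrite !ffunE mulrzBr.
Qed.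

Definition lin (A : zmodType) (a : 'I_k -> A) : {additive Zn -> A} :=
  mk_additive (lin_is_additive a).

Lemma linE (A : zmodType) (a : 'I_k -> A) (v : Zn) :
  lin a v = \sum_i a i *~ (v : {ffun _ -> _}) i.
Proof. exact: mk_additiveE. Qed.

Lemma lin_delta (A : zmodType) (a : 'I_k -> A) i : lin a (delta i) = a i.
Proof.
rewrite linE (bigD1 i) //= big1 ?addr0; first by rewrite ffunE eqxx mulr1z.
by move=> j ji; rewrite ffunE (negbTE ji) mulr0z.
Qed.

Lemma additive_lin (A : zmodType) (f : {additive Zn -> A}) :
  forall v, f v = lin (fun i => f (delta i)) v.
Proof.
move=> v; rewrite linE -{1}(delta_sum v) raddf_sum.
by apply: eq_bigr => i _; rewrite raddfMz.
Qed.

Lemma eq_lin (A : zmodType) (a b : 'I_k -> A) : a =1 b -> lin a =1 lin b.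
Proof. by move=> ab v; rewrite !linE; apply: eq_bigr => i _; rewrite ab. Qed.

Lemma eq_additive (A : zmodType) (f g : {additive Zn -> A}) :
  (forall i, f (delta i) = g (delta i)) -> f =1 g.
Proof. by move=> fg v; rewrite additive_lin [RHS]additive_lin; exact: eq_lin. Qed.

Lemma proj_is_additive (i : 'I_k) :
  zmod_morphism (fun v : {ffun 'I_k -> int} =>
    [ffun l => if l == i then 0 else v l] : {ffun 'I_k -> int}).
Proof.
by move=> v w; apply/ffunP => l; rewrite !ffunE; case: ifP => _ //; rewrite subr0.
Qed.

Definition proj (i : 'I_k) : {additive Zn -> Zn} := mk_additive (proj_is_additive i).

Lemma projE i (v : Zn) l :
  (proj i v : {ffun _ -> _}) l = if l == i then 0 else (v : {ffun _ -> _}) l.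
Proof. by rewrite /proj mk_additiveE ffunE. Qed.

Lemma proj_delta i j : proj i (delta j) = if j == i then 0 else delta j.
Proof.
apply/ffunP => l; rewrite projE ffunE; case: (eqVneq j i) => [->|ji].
  by rewrite ffunE; case: eqP.
case: (eqVneq l i) => [->|li]; rewrite ffunE //.
by rewrite eq_sym (negbTE ji).
Qed.

Lemma projC i j v : proj i (proj j v) = proj j (proj i v).
Proof. by apply/ffunP => l; rewrite !projE; case: (l == i); case: (l == j). Qed.

Lemma proj_idem i v : proj i (proj i v) = proj i v.
Proof. by apply/ffunP => l; rewrite !projE; case: (l == i). Qed.

Lemma lin_proj (A : zmodType) (a : 'I_k -> A) i v :
  lin a (proj i v) = lin (fun l => if l == i then 0 else a l) v.
Proof.
rewrite !linE; apply: eq_bigr => l _; rewrite projE.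
by case: ifP => _; rewrite ?mulr0z ?mul0rz.
Qed.

End StandardObjects.

Arguments delta {k} i.
Arguments proj {k} i.

Lemma pull_is_additive k n (j : 'I_n -> 'I_k) :
  zmod_morphism (fun v : {ffun 'I_k -> int} => [ffun l => v (j l)] : {ffun 'I_n -> int}).
Proof. by move=> v w; apply/ffunP => l; rewrite !ffunE. Qed.

(** The transpose of [push j]. Elements are transported along [push] and functionals along [pull];
    for a permutation the transpose is the inverse. *)
Definition pull k n (j : 'I_n -> 'I_k) : {additive Zn k -> Zn n} :=
  mk_additive (pull_is_additive j).

Lemma pullE k n (j : 'I_n -> 'I_k) (v : Zn k) l :
  (pull j v : {ffun _ -> _}) l = (v : {ffun _ -> _}) (j l).
Proof. by rewrite /pull mk_additiveE ffunE. Qed.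

Definition push k n (j : 'I_n -> 'I_k) : {additive Zn n -> Zn k} :=
  lin (fun l => delta (j l) : Zn k).

Lemma push_delta k n (j : 'I_n -> 'I_k) i : push j (delta i) = delta (j i).
Proof. exact: lin_delta. Qed.

Lemma push_pull n (s : 'S_n) : push s =1 pull (s^-1)%g.
Proof.
apply: eq_additive => i; rewrite push_delta; apply/ffunP => l.
by rewrite pullE !ffunE; congr (_ %:R); rewrite (canF_eq (permKV s)).
Qed.

Lemma fgfree_iso (A : fgfree) : exists k (u : {additive Zn k -> A})
  (v : {additive A -> Zn k}), cancel u v /\ cancel v u.
Proof.
have [k [e [g uK gK]]] := fg_basis A.
have guB : zmod_morphism (g : A -> Zn k).
  move=> x y; rewrite -[RHS]uK; congr g.
  by rewrite -{1}[x]gK -{1}[y]gK; exact: (esym (lin_is_additive _ _ _)).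
exists k, (lin e), (mk_additive guB).
by split=> x; rewrite mk_additiveE linE; [exact: uK | exact: gK].
Qed.

Section CrossEffect.
Variables (G : functor) (k : nat).
Implicit Types x y : G (Zn k).

Definition crossed x := forall i, fmap G (proj i) x = 0.

(** Composing along a list permits induction; since the factors commute, the one for a given i can
    act first or last, which gives [cr_proj0] and [cr_crossed]. *)
Fixpoint crs (s : seq 'I_k) x : G (Zn k) :=
  if s is i :: s' then crs s' x - fmap G (proj i) (crs s' x) else x.

Definition cr x := crs (enum 'I_k) x.

Lemma crs_is_additive s : zmod_morphism (crs s).
Proof.
elim: s => // i s IH x y /=.
by rewrite IH raddfB subrACA.
Qed.

Lemma cr_is_additive : zmod_morphism cr.
Proof. exact: crs_is_additive. Qed.

HB.instance Definition _ := GRing.isZmodMorphism.Build _ _ cr cr_is_additive.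

Lemma crB x y : cr (x - y) = cr x - cr y. Proof. exact: raddfB. Qed.
Lemma cr0 : cr 0 = 0. Proof. exact: raddf0. Qed.
Lemma crMz x c : cr (x *~ c) = cr x *~ c. Proof. exact: raddfMz. Qed.

Lemma fprojC i j x :
  fmap G (proj i) (fmap G (proj j) x) = fmap G (proj j) (fmap G (proj i) x).
Proof.
rewrite (fmap_compE (h := proj i \o proj j)) //.
by rewrite (fmap_compE (h := proj i \o proj j)) // => v; rewrite projC.
Qed.

Lemma fproj_idem i x : fmap G (proj i) (fmap G (proj i) x) = fmap G (proj i) x.
Proof. by rewrite (fmap_compE (h := proj i)) // => v; rewrite proj_idem. Qed.

Lemma crs_proj s i x : fmap G (proj i) (crs s x) = crs s (fmap G (proj i) x).
Proof. by elim: s => //= j s IH; rewrite raddfB fprojC IH. Qed.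

Lemma cr_proj0 i x : cr (fmap G (proj i) x) = 0.
Proof.
rewrite /cr; have: i \in enum 'I_k by rewrite mem_enum.
elim: (enum 'I_k) => //= j s IH; rewrite inE => /orP[/eqP <-|/IH ->].
  by rewrite -crs_proj fproj_idem subrr.
by rewrite raddf0 subr0.
Qed.

Lemma cr_fixed i x : fmap G (proj i) x = x -> cr x = 0.
Proof. by move=> <-; exact: cr_proj0. Qed.

Lemma cr_id x : crossed x -> cr x = x.
Proof.
move=> cx; rewrite /cr; elim: (enum 'I_k) => //= i s ->.
by rewrite cx subr0.
Qed.

Lemma cr_crossed x : crossed (cr x).
Proof.
move=> i; rewrite /cr; have: i \in enum 'I_k by rewrite mem_enum.
elim: (enum 'I_k) => //= j s IH; rewrite inE raddfB => /orP[/eqP <-|/IH i0].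
  by rewrite fproj_idem subrr.
by rewrite fprojC i0 raddf0 subr0.
Qed.

End CrossEffect.

Lemma nt_cr (F G : functor) (h : nat_trans F G) k (x : F (Zn k)) :
  h _ (cr x) = cr (h _ x).
Proof.
rewrite /cr; elim: (enum 'I_k) => //= i s IH.
by rewrite raddfB nt_nat IH.
Qed.

(** One Boolean covers both characters through which permutations act on a generic element: trivial
    for S^n and Gamma^n, sign for Lambda^n. *)
Definition chi (b : bool) n (s : 'S_n) : int := (-1) ^+ (b && odd_perm s).

Lemma chi_mul b n (s t : 'S_n) : chi b (s * t)%g = chi b s * chi b t.
Proof.
rewrite /chi odd_permM; case: b; rewrite ?mulr1 //=.
by rewrite signr_addb.
Qed.

Lemma chiV b n (s : 'S_n) : chi b (s^-1)%g = chi b s.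
Proof. by rewrite /chi odd_permV. Qed.

Lemma chi_sqr b n (s : 'S_n) : chi b s * chi b s = 1.
Proof. by rewrite /chi -signr_addb addbb. Qed.

(** [pw_coef] makes the line of [g0] infinite cyclic. [pw_free] is a dual basis: it makes the values
    torsion free, and it lets the projection of an extension of G be split additively on a single
    object. *)
Record is_power (b : bool) (n : nat) (G : functor) (g0 : G (Zn n)) : Prop := {
  pw_proj : crossed g0;
  pw_perm : forall s : 'S_n, fmap G (push s) g0 = g0 *~ chi b s;
  pw_high : forall k, (n < k)%N -> forall x : G (Zn k), cr x = 0;
  pw_top : forall x : G (Zn n), exists c : int, cr x = g0 *~ c;
  pw_coef : exists kappa : {additive G (Zn n) -> int}, kappa g0 = 1;
  pw_free : forall k, exists (I : finType) (m : I -> G (Zn k))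
    (lam : I -> {additive G (Zn k) -> int}), forall x, x = \sum_i m i *~ lam i x
}.

Section Power.
Variables (b : bool) (n : nat) (G : functor) (g0 : G (Zn n)).
Hypothesis pG : is_power b g0.

Lemma pw_crossed_high k (x : G (Zn k)) : (n < k)%N -> crossed x -> x = 0.
Proof. by move=> nk /cr_id <-; exact: (pw_high pG). Qed.

Lemma pw_crossed_top (x : G (Zn n)) : crossed x -> exists c : int, x = g0 *~ c.
Proof. by move=> cx; have [c] := pw_top pG x; rewrite cr_id //; exists c. Qed.

Lemma pw_torsion0 (c : int) : g0 *~ c = 0 -> c = 0.
Proof.
have [kap k1] := pw_coef pG => /(congr1 kap).
by rewrite raddfMz raddf0 k1 intz.
Qed.

Lemma pw_torsion_free (A : fgfree) (x : G A) (c : int) :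
  c != 0 -> x *~ c = 0 -> x = 0.
Proof.
move=> c0; have [k [u [v [uv vu]]]] := fgfree_iso A.
have [I [m [lam e]]] := pw_free pG k => xc.
have : fmap G v x = 0.
  rewrite (e (fmap G v x)) big1 // => i _.
  have /eqP : lam i (fmap G v x) *~ c = 0 by rewrite -!raddfMz xc !raddf0.
  by rewrite mulrz_eq0 (negbTE c0) => /eqP ->; rewrite mulr0z.
move=> /(congr1 (fmap G u)); rewrite (fmap_compE (h := idfun)) ?raddf0 => [|y].
  by rewrite fmap_id.
exact: vu.
Qed.

End Power.

(** * Split extensions and Baer differences *)

Section Splitting.
Variables F G : functor.
Implicit Types E : extension F G.

Definition splits E :=
  exists s : nat_trans F E, forall (A : fgfree) (y : F A), ext_prj E A (s A y) = y.

Lemma ext_inj_exists E (A : fgfree) (x : E A) :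
  ext_prj E A x = 0 -> exists g, x = ext_inj E A g.
Proof. by move/ext_exact. Qed.

Lemma ext_prj_inj E (A : fgfree) (g : G A) : ext_prj E A (ext_inj E A g) = 0.
Proof. by apply/ext_exact; exists g. Qed.

Lemma ext_inj_eq0 E (A : fgfree) (g : G A) : ext_inj E A g = 0 -> g = 0.
Proof. by rewrite -(raddf0 (ext_inj E A)) => /ext_injP. Qed.

(** Correct a chosen preimage by subtracting its retraction. Two preimages differ by an element of
    G, which [r] fixes, so the corrected value does not depend on the choice; this makes it additive
    and natural although the choice is neither. *)
Lemma retraction_splits E (r : nat_trans E G) :
  (forall (A : fgfree) (g : G A), r A (ext_inj E A g) = g) -> splits E.
Proof.
move=> ri.
pose c (A : fgfree) (y : F A) := sval (cid (ext_prjP E y)).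
have cP (A : fgfree) (y : F A) : ext_prj E A (c A y) = y.
  by rewrite /c; case: cid.
pose sf (A : fgfree) (y : F A) : E A := c A y - ext_inj E A (r A (c A y)).
have sP (A : fgfree) (x : E A) y : ext_prj E A x = y ->
    sf A y = x - ext_inj E A (r A x).
  move=> xy; rewrite /sf.
  have [g /eqP] : exists g, c A y - x = ext_inj E A g.
    by apply: ext_inj_exists; rewrite raddfB cP xy subrr.
  rewrite subr_eq => /eqP ->.
  by rewrite raddfD ri raddfD opprD addrACA subrr add0r.
have sB (A : fgfree) : zmod_morphism (sf A).
  move=> x y; rewrite (sP A (c A x - c A y)); last by rewrite raddfB !cP.
  rewrite (sP A _ _ (cP A x)) (sP A _ _ (cP A y)).
  by rewrite raddfB [ext_inj E A (_ - _)]raddfB subrACA.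
have sN (A B : fgfree) (f : {additive A -> B}) :
    mk_additive (sB B) \o fmap F f =1 fmap E f \o mk_additive (sB A).
  move=> y /=; rewrite !mk_additiveE (sP B (fmap E f (c A y))); last by rewrite nt_nat cP.
  by rewrite (sP A _ _ (cP A y)) !raddfB !nt_nat.
exists (NatTrans sN) => A y /=.
by rewrite mk_additiveE raddfB cP ext_prj_inj subr0.
Qed.

Section DirectSum.

Definition sum_map_fun (A B : fgfree) (f : {additive A -> B})
  (x : (G A * F A)%type) : (G B * F B)%type := (fmap G f x.1, fmap F f x.2).

Lemma sum_map_additive (A B : fgfree) (f : {additive A -> B}) :
  zmod_morphism (@sum_map_fun A B f).
Proof. by case=> a b [c d]; rewrite /sum_map_fun /= !raddfB. Qed.

Definition sum_map (A B : fgfree) (f : {additive A -> B}) :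
  {additive (G A * F A)%type -> (G B * F B)%type} :=
  mk_additive (@sum_map_additive A B f).

Lemma sum_map_id (A : fgfree) : sum_map (idfun : {additive A -> A}) =1 id.
Proof. by case=> a b; rewrite /sum_map mk_additiveE /sum_map_fun !fmap_id. Qed.

Lemma sum_map_comp (A B C : fgfree)
    (f : {additive A -> B}) (g : {additive B -> C}) :
  sum_map (g \o f : {additive A -> C}) =1 sum_map g \o sum_map f.
Proof. by case=> a b; rewrite /= /sum_map !mk_additiveE /sum_map_fun !fmap_comp. Qed.

Definition sum_functor : functor := Functor sum_map_id sum_map_comp.

Lemma sum_inj_additive (A : fgfree) :
  zmod_morphism (fun g : G A => (g, 0) : sum_functor A).
Proof. by move=> x y; congr (_, _); rewrite /= subr0. Qed.

Lemma sum_inj_natural (A B : fgfree) (f : {additive A -> B}) :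
  mk_additive (@sum_inj_additive B) \o fmap G f =1
  fmap sum_functor f \o mk_additive (@sum_inj_additive A).
Proof. by move=> g; rewrite /= /sum_map !mk_additiveE /sum_map_fun raddf0. Qed.

Lemma sum_prj_additive (A : fgfree) :
  zmod_morphism (fun x : sum_functor A => x.2).
Proof. by []. Qed.

Lemma sum_prj_natural (A B : fgfree) (f : {additive A -> B}) :
  mk_additive (@sum_prj_additive B) \o fmap sum_functor f =1
  fmap F f \o mk_additive (@sum_prj_additive A).
Proof. by case=> a b; rewrite /= /sum_map !mk_additiveE. Qed.

(** Needed because [Ext1_is] asks that every class be attained, also in the trivial group. *)
Definition sum_ext : extension F G.
Proof.
apply: (@Extension F G sum_functor (NatTrans sum_inj_natural) (NatTrans sum_prj_natural)).
- by move=> A x y; rewrite /= !mk_additiveE => -[].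
- by move=> A y; exists (0, y); rewrite /= mk_additiveE.
- move=> A [x y]; rewrite /= mk_additiveE /=.
  by split=> [->|[g]]; [exists x|]; rewrite mk_additiveE // => -[].
Qed.

End DirectSum.

Section Negation.
Variable E : extension F G.

Lemma neg_inj_additive (A : fgfree) : zmod_morphism (fun g : G A => - ext_inj E A g).
Proof. by move=> x y; rewrite raddfB opprD. Qed.

Lemma neg_inj_natural (A B : fgfree) (f : {additive A -> B}) :
  mk_additive (@neg_inj_additive B) \o fmap G f =1
  fmap E f \o mk_additive (@neg_inj_additive A).
Proof. by move=> g; rewrite /= !mk_additiveE raddfN nt_nat. Qed.

(** The inverse for the Baer sum. Putting the sign on the inclusion leaves the middle functor and
    the projection unchanged, which [splits_equiv] and [defect_neg] use by computation. *)
Definition neg_ext : extension F G.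
Proof.
apply: (@Extension F G E (NatTrans neg_inj_natural) (ext_prj E)).
- by move=> A x y; rewrite /= !mk_additiveE => /oppr_inj /ext_injP.
- exact: ext_prjP.
- move=> A x; split=> [/ext_exact [g ->]|[g ->] /=].
    by exists (- g); rewrite /= mk_additiveE raddfN opprK.
  by rewrite mk_additiveE raddfN ext_prj_inj oppr0.
Defined.

End Negation.

Section BaerDifference.
Variables E E' : extension F G.

Let D := baer_sum E (neg_ext E').

(** In the difference the antidiagonal becomes the diagonal copy of G. Hence the value of the
    section at the image of x has exactly one representative (x, x') with first component x, and x'
    is the image of x under the equivalence. Uniqueness makes it additive and natural. *)
Lemma splits_equiv : splits D -> ext_equiv E E'.
Proof.
case=> s sP.
pose rel (A : fgfree) (x : E A) (x' : E' A) := exists hp :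
  (x, x') \in @pb_pred _ _ E (neg_ext E') A,
  quot_pi (@antidiag _ _ E (neg_ext E') A) (@Pullback _ _ E (neg_ext E') A (x, x') hp) = s A (ext_prj E A x).
have relP A x x' : rel A x x' -> ext_prj E' A x' = ext_prj E A x.
  by case=> hp _; move: hp; rewrite unfold_in => /eqP.
have rel_uniq A x x' x'' : rel A x x' -> rel A x x'' -> x' = x''.
  case=> h1 e1 [h2 e2]; have /quot_piE/span_antidiag [g] := etrans e1 (esym e2).
  have -> : forall u v : pullback E (neg_ext E') A,
      pb_val (u - v) = pb_val u - pb_val v by [].
  case=> /= /esym; rewrite subrr mk_additiveE => /ext_inj_eq0 ->.
  by rewrite raddf0 !oppr0 => /eqP; rewrite subr_eq0 => /eqP.
have rel_ex A x : exists x', rel A x x'.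
  have [u uE] := quot_pi_surj (s A (ext_prj E A x)).
  have pu : ext_prj E A (pb_val u).1 = ext_prj E A x.
    by rewrite -[RHS]sP uE [RHS]/= baer_prj_funE.
  have [g] : exists g, x - (pb_val u).1 = ext_inj E A g.
    by apply: ext_inj_exists; rewrite raddfB pu subrr.
  move=> /eqP; rewrite subr_eq => /eqP xE.
  pose x' : E' A := (pb_val u).2 + ext_inj E' A g.
  have hp : (x, x') \in @pb_pred _ _ E (neg_ext E') A.
    rewrite unfold_in /= xE /x' !raddfD !ext_prj_inj add0r addr0.
    exact: (pb_valP u).
  exists x', hp; rewrite uE; apply/quot_piE/span_gen; exists g.
  have -> : forall u v : pullback E (neg_ext E') A,
      pb_val (u - v) = pb_val u - pb_val v by [].
  case: (pb_val u) xE @x' hp => a b /= -> _.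
  by congr (_, _); rewrite /= ?mk_additiveE ?addrK // opprK addrC addKr.
pose h A x := sval (cid (rel_ex A x)).
have hP A x : rel A x (h A x) by rewrite /h; case: cid.
have hE A x x' : rel A x x' -> h A x = x' by move=> r; exact: rel_uniq (hP A x) r.
have hB A : zmod_morphism (h A).
  move=> x y; apply: hE; case: (hP A x) => p1 e1; case: (hP A y) => p2 e2.
  have hp : (x - y, h A x - h A y) \in @pb_pred _ _ E (neg_ext E') A.
    by have := p1; have := p2; rewrite !unfold_in /= => /eqP e /eqP e'; rewrite !raddfB e e'.
  exists hp; rewrite !raddfB -e1 -e2 -raddfB; congr (quot_pi _ _).
  exact: val_inj.
have hN (A B : fgfree) (f : {additive A -> B}) :
    mk_additive (hB B) \o fmap E f =1 fmap E' f \o mk_additive (hB A).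
  move=> x; rewrite /= !mk_additiveE; apply: hE; case: (hP A x) => p1 e1.
  have hp : (fmap E f x, fmap E' f (h A x)) \in @pb_pred _ _ E (neg_ext E') B.
    by have := p1; rewrite !unfold_in /= => /eqP e; rewrite !nt_nat e.
  exists hp; rewrite !nt_nat -e1 /= [RHS]baer_mapE; congr (quot_pi _ _).
  exact: val_inj.
exists (NatTrans hN); split=> A x; rewrite /= mk_additiveE; last exact: relP (hP A x).
apply: hE; have hp : (ext_inj E A x, ext_inj E' A x) \in @pb_pred _ _ E (neg_ext E') A.
  by rewrite unfold_in /= !ext_prj_inj.
exists hp; rewrite ext_prj_inj raddf0; apply: quot_pi_rel; exists x => /=.
by rewrite mk_additiveE opprK.
Qed.

End BaerDifference.

Lemma split_Ext1_trivial : (forall E, splits E) -> Ext1_is F G 'I_1.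
Proof.
move=> spl; exists (fun=> 0); split=> [E E'|a|E E'].
- by split=> // _; apply: splits_equiv; exact: spl.
- by exists sum_ext; rewrite [a]ord1.
- by rewrite addr0.
Qed.

End Splitting.

(** * Lifting the generic element *)

Lemma push_mul n (s t : 'S_n) v : push t (push s v) = push (s * t)%g v.
Proof.
apply: (eq_additive (f := push t \o push s : {additive _ -> _})) => i.
by rewrite /= !push_delta permM.
Qed.

Lemma push1 n v : push (1%g : 'S_n) v = v.
Proof.
by apply: (eq_additive (g := idfun)) => i; rewrite push_delta perm1.
Qed.

Lemma proj_push n (s : 'S_n) i v :
  proj i (push s v) = push s (proj ((s^-1)%g i) v).
Proof.
apply/ffunP => l; rewrite projE !push_pull !pullE projE.
by rewrite (inj_eq perm_inj).
Qed.

Section Values.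
Variables (m : nat) (H : functor) (e : H (Zn m)).

(** By Yoneda, an element of H(Z^m) is a natural operation in m arguments; this is its value at
    t. *)
Definition ev (A : fgfree) (t : {ffun 'I_m -> A}) : H A := fmap H (lin t) e.

Lemma ev_map (A B : fgfree) (f : {additive A -> B}) (t : {ffun 'I_m -> A}) :
  fmap H f (ev t) = ev (tuple_map f t).
Proof.
apply: fmap_compE => v; rewrite !linE raddf_sum; apply: eq_bigr => i _.
by rewrite raddfMz ffunE.
Qed.

Hypothesis ce : crossed e.

Lemma ev_eq0 (A : fgfree) (t : {ffun 'I_m -> A}) i : t i = 0 -> ev t = 0.
Proof.
move=> ti; rewrite -(raddf0 (fmap H (lin t))) -(ce i); symmetry.
apply: fmap_compE => v; rewrite lin_proj; apply: eq_lin => l.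
by case: eqP => // ->.
Qed.

Lemma ev_perm (A : fgfree) (t : {ffun 'I_m -> A}) (s : 'S_m) :
  ev [ffun i => t (s i)] = fmap H (lin t) (fmap H (push s) e).
Proof.
symmetry; apply: fmap_compE => v.
apply: (eq_additive (f := lin t \o push s : {additive _ -> _})) => i.
by rewrite /= push_delta !lin_delta ffunE.
Qed.

Hypothesis Hhigh : forall x : H (Zn m.+1), crossed x -> x = 0.

(* The additivity defect is the value of a universal element over Z^(m+1)
   which vanishes as soon as one coordinate is killed. *)
Lemma ev_add (A : fgfree) (t : {ffun 'I_m -> A}) i x y :
  ev (upd t i (x + y)) = ev (upd t i x) + ev (upd t i y).
Proof.
(* Slot l gets the coordinate [lift ord0 l], and the extra coordinate 0 holds the second summand of
   slot i. Killing either summand makes one term zero and cancels the other two; killing another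
   coordinate makes all three zero. *)
pose d : {ffun 'I_m -> Zn m.+1} := [ffun l => delta (fintype.lift ord0 l)].
pose dx : Zn m.+1 := delta (fintype.lift ord0 i).
pose dy : Zn m.+1 := delta ord0.
pose u := ev (upd d i (dx + dy)) - ev (upd d i dx) - ev (upd d i dy).
have updE (B C : fgfree) (f : {additive B -> C}) (s : {ffun 'I_m -> B}) z :
    tuple_map f (upd s i z) = upd (tuple_map f s) i (f z).
  exact: tuple_map_upd.
have u0 : u = 0.
  apply: Hhigh => j; rewrite /u 2!raddfB !ev_map !updE.
  case: (unliftP ord0 j) => [l|] ->.
    case: (eqVneq l i) => [->|li].
      have -> : proj (fintype.lift ord0 i) (dx + dy) = dy.
        by rewrite raddfD /= !proj_delta eqxx (negbTE (neq_lift _ _)) add0r.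
      have -> : proj (fintype.lift ord0 i) dx = 0 by rewrite proj_delta eqxx.
      rewrite proj_delta (negbTE (neq_lift _ _)).
      by rewrite [X in _ - X - _](@ev_eq0 _ _ i) ?ffunE ?eqxx // subr0 subrr.
    have z w : ev (upd (tuple_map (proj (fintype.lift ord0 l)) d) i w) = 0.
      apply: (@ev_eq0 _ _ l); rewrite !ffunE (negbTE li) proj_delta.
      by rewrite (inj_eq lift_inj) eqxx.
    by rewrite !z !subr0.
  have -> : proj ord0 (dx + dy) = dx.
    by rewrite raddfD /= !proj_delta eqxx eq_sym (negbTE (neq_lift _ _)) addr0.
  have -> : proj ord0 dx = dx.
    by rewrite proj_delta eq_sym (negbTE (neq_lift _ _)).
  have -> : proj ord0 dy = 0 by rewrite proj_delta eqxx.
  by rewrite [X in _ - _ - X](@ev_eq0 _ _ i) ?ffunE ?eqxx // subr0 subrr.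
pose s (j : 'I_m.+1) := if unlift ord0 j is Some l
  then (if l == i then x else t l) else y.
have := congr1 (fmap H (lin s)) u0.
rewrite /u raddf0 2!raddfB !ev_map !updE raddfD /= !lin_delta.
have -> : s (fintype.lift ord0 i) = x by rewrite /s liftK eqxx.
have -> : s ord0 = y by rewrite /s unlift_none.
have E z : upd (tuple_map (lin s) d) i z = upd t i z.
  apply/ffunP => l; rewrite !ffunE; case: eqP => // li.
  by rewrite lin_delta /s liftK (introF eqP li).
rewrite !E => /eqP; rewrite subr_eq0 => /eqP h.
by apply/eqP; rewrite [X in _ == X]addrC -subr_eq; apply/eqP.
Qed.

End Values.

Section Lifts.
Variables (bF bG : bool) (m : nat) (F : functor) (f0 : F (Zn m)).
Hypothesis pF : is_power bF f0.

Section AnyTarget.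
Variables (G : functor) (E : extension F G).

(** Take the cross-effect of any preimage: the projection commutes with [cr], and [cr] fixes the
    crossed element [f0]. *)
Lemma crossed_lift : exists e : E (Zn m), crossed e /\ ext_prj E _ e = f0.
Proof.
have [x xE] := ext_prjP E f0; exists (cr x); split; first exact: cr_crossed.
by rewrite nt_cr xE cr_id //; exact: (pw_proj pF).
Qed.

Lemma crossed_inj k (g : G (Zn k)) : crossed (ext_inj E _ g) -> crossed g.
Proof.
by move=> c i; apply: (@ext_injP _ _ E); rewrite nt_nat c raddf0.
Qed.

Lemma crossed_push (H : functor) (x : H (Zn m)) (s : 'S_m) (c : int) :
  crossed x -> crossed (fmap H (push s) x *~ c - x).
Proof.
move=> cx i; rewrite raddfB raddfMz cx subr0.
rewrite (fmap_compE (h := push s \o proj ((s^-1)%g i))).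
  by rewrite (fmap_comp (proj _) (push s)) /= cx raddf0 mul0rz.
by move=> v; rewrite proj_push.
Qed.

Lemma crossed_kernel k (x : E (Zn k)) : crossed x -> ext_prj E _ x = 0 ->
  exists2 g, crossed g & x = ext_inj E _ g.
Proof.
move=> cx /ext_inj_exists [g gE]; exists g => //.
by apply: crossed_inj; rewrite -gE.
Qed.

(** The failure of equivariance projects to zero, so it is a crossed element of G: zero when G has
    smaller degree, a multiple of its generic element in equal degree. *)
Lemma lift_push_defect (e : E (Zn m)) (s : 'S_m) :
  crossed e -> ext_prj E _ e = f0 ->
  exists2 g, crossed g &
    fmap E (push s) e *~ chi bF s - e = ext_inj E _ g.
Proof.
move=> ce eE; apply: crossed_kernel; first exact: crossed_push.
rewrite raddfB raddfMz nt_nat eE (pw_perm pF) -mulrzA chi_sqr mulr1z.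
exact: subrr.
Qed.

End AnyTarget.

(** The middle functor inherits the degree bound from its two ends; this is the hypothesis that
    [ev_add] asks for. *)
Lemma lift_high n (G : functor) (g0 : G (Zn n)) (E : extension F G) :
  is_power bG g0 -> (n <= m)%N -> forall x : E (Zn m.+1), crossed x -> x = 0.
Proof.
move=> pG nm x cx; have [|g cg ->] := crossed_kernel cx.
  apply: (pw_crossed_high pF) => // i.
  by rewrite -nt_nat cx raddf0.
by rewrite (pw_crossed_high pG _ cg) ?raddf0 // ltnS.
Qed.

Lemma lift_push_lt n (G : functor) (g0 : G (Zn n)) (E : extension F G) (e : E (Zn m))
    (s : 'S_m) :
  is_power bG g0 -> (n < m)%N -> crossed e -> ext_prj E _ e = f0 ->
  fmap E (push s) e = e *~ chi bF s.
Proof.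
move=> pG nm ce /(lift_push_defect s ce) [g cg].
rewrite (pw_crossed_high pG nm cg) raddf0 => /eqP; rewrite subr_eq0 => /eqP eE'.
by rewrite -[in RHS]eE' -mulrzA chi_sqr mulr1z.
Qed.

(* [chi s] times the action of [s] is unipotent of finite order on the lift. *)
Lemma lift_push_eq (G : functor) (g0 : G (Zn m)) (E : extension F G) (e : E (Zn m))
    (s : 'S_m) :
  is_power bG g0 -> crossed e -> ext_prj E _ e = f0 -> chi bF s = chi bG s ->
  fmap E (push s) e = e *~ chi bF s.
Proof.
move=> pG ce /(lift_push_defect s ce) [g cg] /eqP + chiE.
have [k ->] := pw_crossed_top pG cg; rewrite subr_eq addrC => /eqP dE.
pose u x := fmap E (push s) x *~ chi bF s.
have uD x y : u (x + y) = u x + u y by rewrite /u raddfD mulrzDl.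
have uM x c : u (x *~ c) = u x *~ c by rewrite /u raddfMz mulrzAC.
have ug : u (ext_inj E _ g0) = ext_inj E _ g0.
  by rewrite /u -nt_nat (pw_perm pG) raddfMz -mulrzA chiE chi_sqr mulr1z.
have it N : iter N u e = e + ext_inj E _ g0 *~ (k *+ N).
  elim: N => [|N IH] /=; first by rewrite mulr0n mulr0z addr0.
  rewrite IH uD uM ug [u e]dE.
  by rewrite raddfMz -addrA -mulrzDr mulrS.
have it' N x : iter N u x = fmap E (push (s ^+ N)%g) x *~ (chi bF s ^+ N).
  elim: N => [|N IH] /=; first by rewrite fmap_idE ?mulr1z // => v; rewrite push1.
  rewrite IH /u raddfMz (fmap_compE (h := push (s ^+ N.+1)%g)) ?exprSr ?mulrzA //.
  by move=> v; rewrite push_mul expgSr.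
(* After twice the order of s, both the permutation and the power of its character are trivial, so
   the accumulated multiple of k must be zero. *)
have := it (#[s]%g * 2)%N; rewrite it' expgM expg_order expg1n.
rewrite fmap_idE ?exprM => [|v]; last by rewrite push1.
rewrite -exprM mulnC exprM expr2 chi_sqr expr1n mulr1z -{1}[e]addr0 => /addrI/esym.
rewrite -raddfMz => /ext_inj_eq0 /(pw_torsion0 pG) /eqP.
rewrite mulrn_eq0 => /orP[/eqP sN|/eqP k0]; first by have := order_gt0 s; lia.
move: dE; rewrite k0 mulr0z raddf0 addr0 => eE'.
by rewrite -[in RHS]eE' -mulrzA chi_sqr mulr1z.
Qed.

End Lifts.

(** * Sections built from generators *)

Section Sections.

Lemma presented_splits (K : fgfree -> choiceType)
  (h : forall A B : fgfree, {additive A -> B} -> K A -> K B)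
  (R : forall A, {freeg (K A)} -> Prop) h_id h_comp h_rel (G : functor)
  (E : extension (@presented K h R h_id h_comp h_rel) G)
  (sig : forall A : fgfree, K A -> E A) :
  (forall (A B : fgfree) (f : {additive A -> B}) k,
     fmap E f (sig A k) = sig B (h A B f k)) ->
  (forall A r, R A r -> freeg_lift (sig A) r = 0) ->
  (forall A k, ext_prj E A (sig A k) = quot_pi (@R A) << k >>) ->
  splits E.
Proof.
move=> sN sR sP.
have nat (A B : fgfree) (f : {additive A -> B}) :
    quot_lift (sR B) \o fmap (presented h_id h_comp h_rel) f =1
    fmap E f \o quot_lift (sR A).
  elim/quot_ind => [|x y Px Py|k].
  - by rewrite !raddf0.
  - exact: etrans (raddfB (quot_lift (sR B) \o fmap (presented h_id h_comp h_rel) f) x y)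
      (etrans (congr2 (fun u v => u - v) Px Py)
        (esym (raddfB (fmap E f \o quot_lift (sR A)) x y))).
  - rewrite /= (quot_mapE (h_rel A B f) << k >>) freeg_mapU !quot_liftU.
    by rewrite sN.
exists (NatTrans nat) => A /=; elim/quot_ind => [|x y Px Py|k].
- by rewrite !raddf0.
- by rewrite !raddfB Px Py.
- by rewrite quot_liftU sP.
Qed.

Definition deltas n : {ffun 'I_n -> Zn n} := [ffun i => delta i].

Lemma tuple_map_deltas n (A : fgfree) (t : {ffun 'I_n -> A}) :
  tuple_map (lin t) (deltas n) = t.
Proof. by apply/ffunP => i; rewrite !ffunE lin_delta. Qed.

Variables (m : nat) (G : functor).

Lemma sym_splits (E : extension (SymPow m) G) (e : E (Zn m)) :
  crossed e -> (forall x : E (Zn m.+1), crossed x -> x = 0) ->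
  ext_prj E _ e = scls (deltas m) ->
  (forall s : 'S_m, fmap E (push s) e = e) -> splits E.
Proof.
move=> ce hi eE es; apply: (presented_splits (sig := @ev m E e)).
- by move=> A B f t; rewrite ev_map.
- move=> A r; case=> [_ [t i x y]|t s].
    rewrite 2!raddfB !freeg_liftU (ev_add ce hi).
    by rewrite -addrA -opprD subrr.
  by rewrite raddfB !freeg_liftU ev_perm es subrr.
- by move=> A t; rewrite nt_nat eE scls_map tuple_map_deltas.
Qed.

(** When two arguments agree, antisymmetry only shows that twice the value is zero. But this value
    projects to zero in Lambda^m, so it lies in G, which has no 2-torsion. *)
Lemma alt_splits (E : extension (ExtPow m) G) (e : E (Zn m)) :
  crossed e -> (forall x : E (Zn m.+1), crossed x -> x = 0) ->
  (forall (A : fgfree) (g : G A), g *~ 2 = 0 -> g = 0) ->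
  ext_prj E _ e = ecls (deltas m) ->
  (forall s : 'S_m, fmap E (push s) e = e *~ chi true s) -> splits E.
Proof.
move=> ce hi tf eE es; apply: (presented_splits (sig := @ev m E e)).
- by move=> A B f t; rewrite ev_map.
- move=> A r; case=> [_ [t i x y]|t i j ij tij].
    rewrite 2!raddfB !freeg_liftU (ev_add ce hi).
    by rewrite -addrA -opprD subrr.
  rewrite freeg_liftU.
  have [|g gE] := @ext_inj_exists _ _ E A (ev e t).
    by rewrite nt_nat eE ecls_map tuple_map_deltas (ecls_alt ij).
  have tE : t = [ffun l => t (tperm i j l)].
    by apply/ffunP => l; rewrite ffunE; case: tpermP => [->|->|].
  have : ev e t = - ev e t.
    rewrite {1}tE ev_perm es /chi odd_tperm ij.
    by rewrite expr1 mulrN1z raddfN.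
  move=> /eqP; rewrite -addr_eq0 gE -raddfD => /eqP /ext_inj_eq0 gg.
  by rewrite (tf _ g) ?raddf0.
- by move=> A t; rewrite nt_nat eE ecls_map tuple_map_deltas.
Qed.

End Sections.

(** * Symmetric powers *)

Section Orbits.
Variables n k : nat.
Implicit Types j c : {ffun 'I_n -> 'I_k}.

(** Orbits of index maps are the monomials of degree n in k variables. As [choose] depends on the
    orbit and not on the member supplied, [orep] is constant on orbits. *)
Definition same_orbit j c := [exists s : 'S_n, c == [ffun l => j (s l)]].

Definition orep j := choose (same_orbit j) j.

Lemma same_orbit_refl j : same_orbit j j.
Proof.
apply/existsP; exists 1%g; apply/eqP/ffunP => l.
by rewrite ffunE perm1.
Qed.

Lemma orepP j : exists s : 'S_n, orep j = [ffun l => j (s l)].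
Proof.
have /existsP [s /eqP e] : same_orbit j (orep j).
  by apply: (@chooseP _ (same_orbit j)); exact: same_orbit_refl.
by exists s.
Qed.

Lemma orep_perm j (s : 'S_n) : orep [ffun l => j (s l)] = orep j.
Proof.
have E : same_orbit [ffun l => j (s l)] =1 same_orbit j.
  move=> c; apply/existsP/existsP => -[t /eqP ->].
    by exists (t * s)%g; apply/eqP/ffunP => l; rewrite !ffunE permM.
  by exists (t * s^-1)%g; apply/eqP/ffunP => l; rewrite !ffunE permM permKV.
rewrite /orep (eq_choose E); apply: choose_id; last exact: same_orbit_refl.
by apply/existsP; exists s; rewrite eqxx.
Qed.

Lemma orep_idem j : orep (orep j) = orep j.
Proof. by have [s e] := orepP j; rewrite {1}e orep_perm. Qed.

End Orbits.

(** * Multiadditive maps and quotients of the n'th tensor power *)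

Lemma multiadd_zero n (A W : zmodType) (f : {ffun 'I_n -> A} -> W) :
  (forall t i x y, f (upd t i (x + y)) = f (upd t i x) + f (upd t i y)) ->
  forall (t : {ffun _ -> A}) i, t i = 0 -> f t = 0.
Proof.
move=> fD t i ti; have -> : t = upd t i 0.
  by apply/ffunP => l; rewrite ffunE; case: eqP => [->|].
have := fD t i 0 0; rewrite addr0 => /eqP.
by rewrite -{1}[f _]addr0 (inj_eq (addrI _)) eq_sym => /eqP.
Qed.

Section Multiadditive.
Variables (n k : nat) (W : zmodType) (P : W -> Prop).
Hypotheses (P0 : P 0) (PB : forall x y, P x -> P y -> P (x - y)).

Lemma closedN x : P x -> P (- x).
Proof. by move=> Px; rewrite -[- x]add0r; exact: PB. Qed.

Lemma closedD x y : P x -> P y -> P (x + y).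
Proof. by move=> Px /closedN Py; rewrite -[y]opprK; exact: PB. Qed.

Lemma closedMz x (c : int) : P x -> P (x *~ c).
Proof.
move=> Px; have Pn p : P (x *+ p).
  by elim: p => [|p IH]; rewrite ?mulr0n // mulrS; exact: closedD.
by case: c => p; [exact: Pn | rewrite NegzE mulrNz; exact/closedN/Pn].
Qed.

Lemma closed_sum (I : Type) (r : seq I) (Q : pred I) (F : I -> W) :
  (forall i, Q i -> P (F i)) -> P (\sum_(i <- r | Q i) F i).
Proof. by move=> h; apply: big_ind => //; exact: closedD. Qed.

Definition bas (j : {ffun 'I_n -> 'I_k}) : {ffun 'I_n -> Zn k} :=
  [ffun l => delta (j l)].

Variable f : {ffun 'I_n -> Zn k} -> W.
Hypothesis fD : forall t i x y,
  f (upd t i (x + y)) = f (upd t i x) + f (upd t i y).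

(** Expand one slot at a time; the induction runs over a list of slots outside which all entries are
    already basis vectors. *)
Lemma multiadd_ind : (forall j, P (f (bas j))) -> forall t, P (f t).
Proof.
move=> Pb t.
have slot u (a : 'I_n) (x : Zn k) :
    (forall i, P (f (upd u a (delta i)))) -> P (f (upd u a x)).
  move=> h; pose g (y : Zn k) := f (upd u a y).
  have gB : zmod_morphism g.
    move=> y z; apply/eqP; rewrite eq_sym subr_eq; apply/eqP.
    by rewrite /g -fD subrK.
  rewrite -[f _]/(g x) -(mk_additiveE gB) (additive_lin (mk_additive gB)) linE.
  by apply: closed_sum => i _; apply: closedMz; rewrite mk_additiveE; exact: h.
have: forall l, l \notin enum 'I_n -> exists i, t l = delta i.
  by move=> l; rewrite mem_enum.
elim: (enum 'I_n) t => [|a s IH] t ht.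
  have h l : exists i, t l = delta i by exact: ht.
  have -> : t = bas [ffun l => sval (cid (h l))].
    by apply/ffunP => l; rewrite !ffunE; case: cid.
  exact: Pb.
have -> : t = upd t a (t a) by apply/ffunP => l; rewrite ffunE; case: eqP => [->|].
apply: slot => i; apply: IH => l ls; rewrite ffunE; case: eqP => [_|/eqP la].
  by exists i.
by apply: ht; rewrite inE (negbTE la).
Qed.

End Multiadditive.

Lemma multiadd_eq n k (W : zmodType) (f g : {ffun 'I_n -> Zn k} -> W) :
  (forall t i x y, f (upd t i (x + y)) = f (upd t i x) + f (upd t i y)) ->
  (forall t i x y, g (upd t i (x + y)) = g (upd t i x) + g (upd t i y)) ->
  (forall j, f (bas j) = g (bas j)) -> f =1 g.
Proof.
move=> fD gD fg t; apply/eqP; rewrite -subr_eq0; apply/eqP.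
apply: (@multiadd_ind n k W (fun x => x = 0) _ _ (fun t => f t - g t)) => //.
- by move=> x y -> ->; rewrite subr0.
- by move=> u i x y; rewrite fD gD opprD addrACA.
- by move=> j; rewrite fg subrr.
Qed.

Section TensorLike.
Variables (b : bool) (n : nat) (G : functor).
Variable cls : forall A : fgfree, {ffun 'I_n -> A} -> G A.
Hypothesis cls_map : forall (A B : fgfree) (f : {additive A -> B}) t,
  fmap G f (cls t) = cls (tuple_map f t).
Hypothesis clsD : forall (A : fgfree) (t : {ffun 'I_n -> A}) i x y,
  cls (upd t i (x + y)) = cls (upd t i x) + cls (upd t i y).
Hypothesis cls_perm : forall (A : fgfree) (t : {ffun 'I_n -> A}) (s : 'S_n),
  cls [ffun i => t (s i)] = cls t *~ chi b s.
Hypothesis cls_ind : forall (A : fgfree) (P : G A -> Prop), P 0 ->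
  (forall x y, P x -> P y -> P (x - y)) -> (forall t, P (cls t)) -> forall x, P x.

Lemma cls_eq0 (A : fgfree) (t : {ffun 'I_n -> A}) i : t i = 0 -> cls t = 0.
Proof. exact: (multiadd_zero (@clsD A)). Qed.

Lemma cls_bas_ind k (P : G (Zn k) -> Prop) : P 0 ->
  (forall x y, P x -> P y -> P (x - y)) -> (forall j, P (cls (bas j))) ->
  forall x, P x.
Proof.
move=> P0 PB Pj; apply: cls_ind => // t.
by apply: (multiadd_ind P0 PB (f := @cls (Zn k))) => //; exact: clsD.
Qed.

Lemma cls_deltas_crossed : crossed (cls (deltas n)).
Proof.
move=> i; rewrite cls_map; apply: (@cls_eq0 _ _ i).
by rewrite !ffunE proj_delta eqxx.
Qed.

Lemma cls_deltas_perm (s : 'S_n) :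
  fmap G (push s) (cls (deltas n)) = cls (deltas n) *~ chi b s.
Proof.
rewrite cls_map -cls_perm; congr cls; apply/ffunP => l.
by rewrite !ffunE push_delta.
Qed.

(** A monomial that omits a variable is unchanged when that variable is killed, so it has no
    cross-effect. [cls_high] and [cls_top] follow by the pigeonhole principle. *)
Lemma cls_bas_missing k (j : {ffun 'I_n -> 'I_k}) i :
  (forall l, j l != i) -> cr (cls (bas j)) = 0.
Proof.
move=> ji; apply: (@cr_fixed _ _ i); rewrite cls_map; congr cls.
by apply/ffunP => l; rewrite !ffunE proj_delta (negbTE (ji l)).
Qed.

Lemma cls_high k : (n < k)%N -> forall x : G (Zn k), cr x = 0.
Proof.
move=> nk; apply: cls_bas_ind => [|x y cx cy|j].
- exact: cr0.
- by rewrite crB cx cy subr0.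
have /subsetPn [i _ ij] : ~~ ([set: 'I_k] \subset [set j l | l : 'I_n]).
  apply: contraL nk => /subset_leq_card; rewrite cardsT card_ord -leqNgt => h.
  by apply: (leq_trans h); rewrite -[X in (_ <= X)%N]card_ord; exact: leq_imset_card.
apply: (@cls_bas_missing _ _ i) => l; apply: contra ij => /eqP <-.
exact: imset_f.
Qed.

Lemma cls_bas_inj (j : {ffun 'I_n -> 'I_n}) : injective j ->
  exists s : 'S_n, cls (bas j) = cls (deltas n) *~ chi b s.
Proof.
move=> ji; exists (perm ji); rewrite -cls_perm; congr cls.
by apply/ffunP => l; rewrite !ffunE permE.
Qed.

Lemma cls_top (x : G (Zn n)) : exists c : int, cr x = cls (deltas n) *~ c.
Proof.
move: x; apply: cls_bas_ind => [|x y [c cx] [d cy]|j].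
- by exists 0; rewrite cr0 mulr0z.
- by exists (c - d); rewrite crB cx cy mulrzBr.
have [/injectiveP ji|/injectiveP ji] := boolP (injectiveb j).
  have [s ->] := cls_bas_inj ji; exists (chi b s).
  by rewrite crMz cr_id //; exact: cls_deltas_crossed.
exists 0; rewrite mulr0z.
have /subsetPn [i _ ij] : ~~ ([set: 'I_n] \subset [set j l | l : 'I_n]).
  apply: contra_notN ji => /subset_leq_card; rewrite cardsT card_ord => h.
  have /imset_injP jinj : #|[set j l | l : 'I_n]| == #|'I_n|.
    by rewrite eqn_leq leq_imset_card card_ord.
  by move=> u v; apply: jinj.
apply: (@cls_bas_missing _ _ i) => l; apply: contra ij => /eqP <-.
exact: imset_f.
Qed.

Lemma cls_is_power :
  (exists kappa : {additive G (Zn n) -> int}, kappa (cls (deltas n)) = 1) ->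
  (forall k, exists (I : finType) (m : I -> G (Zn k))
    (lam : I -> {additive G (Zn k) -> int}), forall x, x = \sum_i m i *~ lam i x) ->
  is_power b (cls (deltas n)).
Proof.
move=> h1 h2; split=> //.
- exact: cls_deltas_crossed.
- exact: cls_deltas_perm.
- exact: cls_high.
- exact: cls_top.
Qed.

End TensorLike.

Section Symmetric.
Variable n : nat.

Lemma scls_perm' (A : fgfree) (t : {ffun 'I_n -> A}) (s : 'S_n) :
  scls [ffun i => t (s i)] = scls t *~ chi false s.
Proof. by rewrite scls_perm mulr1z. Qed.

Lemma scls_ind (A : fgfree) (P : SymPow n A -> Prop) : P 0 ->
  (forall x y, P x -> P y -> P (x - y)) -> (forall t, P (scls t)) -> forall x, P x.
Proof. by move=> P0 PB Pt; apply: quot_ind. Qed.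

Variable k : nat.
Implicit Types j c : {ffun 'I_n -> 'I_k}.

(** The coefficient of the monomial c in the product of the linear forms [t l]: j selects one term
    in each factor, and only selections in the orbit of c count. *)
Definition sym_coef c (t : {ffun 'I_n -> Zn k}) : int :=
  \sum_(j : {ffun 'I_n -> 'I_k} | orep j == c) \prod_l (t l : {ffun _ -> int}) (j l).

Lemma sym_coefD c t i x y :
  sym_coef c (upd t i (x + y)) = sym_coef c (upd t i x) + sym_coef c (upd t i y).
Proof.
rewrite /sym_coef -big_split; apply: eq_bigr => j _ /=.
rewrite (bigD1 i) //= [X in _ = X + _](bigD1 i) //= [X in _ = _ + X](bigD1 i) //=.
rewrite ![upd _ _ _ i]ffunE eqxx ffunE.
rewrite mulrDl; congr (_ * _ + _ * _); apply: eq_bigr => l li.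
  by rewrite !ffunE (negbTE li).
by rewrite !ffunE (negbTE li).
Qed.

Lemma sym_coef_perm c (t : {ffun 'I_n -> Zn k}) (s : 'S_n) :
  sym_coef c [ffun i => t (s i)] = sym_coef c t.
Proof.
pose h (j : {ffun 'I_n -> 'I_k}) : {ffun 'I_n -> 'I_k} := [ffun l => j (s l)].
have hi : injective h.
  move=> u v /ffunP e; apply/ffunP => l.
  by have := e (s^-1 l)%g; rewrite !ffunE permKV.
rewrite /sym_coef (reindex_inj hi) /=; apply: eq_big => [j|j _].
  by rewrite orep_perm.
rewrite [RHS](reindex_inj (@perm_inj _ s)) /=; apply: eq_bigr => l _.
by rewrite !ffunE.
Qed.

Lemma sym_coef_rel c r : @sym_rel n (Zn k) r -> freeg_lift (sym_coef c) r = 0.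
Proof.
case=> [_ [t i x y]|t s].
  by rewrite 2!raddfB !freeg_liftU sym_coefD -addrA -opprD subrr.
by rewrite raddfB !freeg_liftU sym_coef_perm subrr.
Qed.

Definition sym_lam c : {additive SymPow n (Zn k) -> int} :=
  quot_lift (@sym_coef_rel c).

Lemma sym_lam_bas c j : sym_lam c (scls (bas j)) = (orep j == c)%:R.
Proof.
rewrite [LHS]quot_liftU /sym_coef big_mkcond (bigD1 j) //= [X in _ + X]big1 ?addr0.
  case: eqP => // _; rewrite big1 // => l _.
  by rewrite !ffunE eqxx.
move=> i ij; case: eqP => // _.
have [l /eqP lij] : exists l, i l != j l.
  apply/existsP; rewrite -negb_forall; apply: contra ij => /forallP e.
  by apply/eqP/ffunP => l; apply/eqP.
by rewrite (bigD1 l) //= !ffunE (introF eqP lij) mul0r.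
Qed.

Lemma sym_free x : x = \sum_c scls (bas c) *~ sym_lam c x.
Proof.
move: x; apply: (cls_bas_ind (@sclsD n) (@scls_ind)) => [|x y {1}-> {1}->|j].
- by rewrite big1 // => c _; rewrite raddf0 mulr0z.
- by rewrite -sumrB; apply: eq_bigr => c _; rewrite raddfB mulrzBr.
rewrite (bigD1 (orep j)) //= sym_lam_bas eqxx [X in _ + X]big1 ?addr0 => [|c /negbTE cj].
  have [s ->] := orepP j; rewrite mulr1z -(scls_perm (bas j) s); apply: (congr1 (@scls n (Zn k))).
  by apply/ffunP => l; rewrite !ffunE.
by rewrite sym_lam_bas eq_sym cj mulr0z.
Qed.

End Symmetric.

Lemma SymPow_is_power n : is_power false (scls (deltas n)).
Proof.
apply: cls_is_power.
- exact: scls_map.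
- exact: sclsD.
- exact: scls_perm'.
- exact: scls_ind.
- exists (sym_lam (orep [ffun l => l])).
  have -> : deltas n = bas [ffun l => l] by apply/ffunP => l; rewrite !ffunE.
  by rewrite sym_lam_bas eqxx.
- move=> k; exists {ffun 'I_n -> 'I_k}, (fun c => scls (bas c)), (@sym_lam n k).
  exact: sym_free.
Qed.

(** * Exterior powers *)

(** A basis of each G(Z^k) whose coordinates are all pulled back from the single functional [kap].
    By [cp_rep], an index map is a permuted basis index, or it is fixed by a permutation of
    character -1 and then carries no information. *)
Record is_copower (b : bool) (n : nat) (G : functor) (g0 : G (Zn n))
    (kap : {additive G (Zn n) -> int})
    (C : forall k, pred {ffun 'I_n -> 'I_k})
    (m : forall k, {ffun 'I_n -> 'I_k} -> G (Zn k)) : Prop := {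
  cp_one : kap g0 = 1;
  cp_proj : forall i x, kap (fmap G (proj i) x) = 0;
  cp_basis : forall k (x : G (Zn k)),
    x = \sum_(c | C k c) m k c *~ kap (fmap G (pull c) x);
  cp_orth : forall k c c', C k c -> C k c' -> kap (fmap G (pull c) (m k c')) = (c == c')%:R;
  cp_rep : forall k (j : {ffun 'I_n -> 'I_k}),
    (exists (c : {ffun 'I_n -> 'I_k}) (s : 'S_n), C k c /\ j = [ffun l => c (s l)]) \/
    (exists s : 'S_n, j = [ffun l => j (s l)] /\ chi b s = -1)
}.

Section Exterior.
Variable n : nat.

Lemma ecls_ind (A : fgfree) (P : ExtPow n A -> Prop) : P 0 ->
  (forall x y, P x -> P y -> P (x - y)) -> (forall t, P (ecls t)) -> forall x, P x.
Proof. by move=> P0 PB Pt; apply: quot_ind. Qed.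

(** Polarization of the alternating relation with [t i + t j] in both slots. *)
Lemma ecls_tperm (A : fgfree) (t : {ffun 'I_n -> A}) i j : i != j ->
  ecls [ffun l => t (tperm i j l)] = - ecls t.
Proof.
move=> ij; apply/eqP; rewrite -addr_eq0 addrC; apply/eqP.
pose u x y := upd (upd t i x) j y.
have uC x y : u x y = upd (upd t j y) i x.
  apply/ffunP => l; rewrite !ffunE; case: (eqVneq l j) => // ->.
  by rewrite eq_sym (negbTE ij).
have uxx x : ecls (u x x) = 0.
  by apply: (ecls_alt ij); rewrite !ffunE !eqxx (negbTE ij).
have uD : forall x y z, ecls (u x (y + z)) = ecls (u x y) + ecls (u x z).
  by move=> x y z; rewrite /u eclsD.
have uD' : forall x y z, ecls (u (x + y) z) = ecls (u x z) + ecls (u y z).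
  by move=> x y z; rewrite !uC eclsD.
have := uxx (t i + t j); rewrite uD !uD' !uxx add0r addr0.
rewrite addrC; congr (ecls _ + ecls _ = _); apply/ffunP => l; rewrite !ffunE.
  case: (tpermP i j l) => [->|->|/eqP li /eqP lj]; rewrite ?eqxx ?(negbTE ij) //.
  by rewrite (negbTE li) (negbTE lj).
by case: (eqVneq l j) => [->|_] //; case: (eqVneq l i) => [->|].
Qed.

Lemma ecls_perm (A : fgfree) (t : {ffun 'I_n -> A}) (s : 'S_n) :
  ecls [ffun i => t (s i)] = ecls t *~ chi true s.
Proof.
have [ts -> tsP] := prod_tpermP s; elim: ts tsP => [|[i j] ts IH] /=.
  rewrite big_nil /chi odd_perm1 mulr1z => _; congr (ecls _).
  by apply/ffunP => l; rewrite ffunE perm1.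
case/andP=> ij /IH {}IH; rewrite big_cons chi_mul mulrzA mulrzAC -IH.
rewrite {1}/chi odd_tperm ij expr1 mulrN1z -(ecls_tperm _ ij); congr (ecls _).
by apply/ffunP => l; rewrite !ffunE permM.
Qed.

Definition ext_coef (t : {ffun 'I_n -> Zn n}) : int :=
  \det (\matrix_(i, l) (t i : {ffun _ -> int}) l).

Lemma ext_coefD t i x y :
  ext_coef (upd t i (x + y)) = ext_coef (upd t i x) + ext_coef (upd t i y).
Proof.
suff -> : ext_coef (upd t i (x + y)) =
    1 * ext_coef (upd t i x) + 1 * ext_coef (upd t i y) by rewrite !mul1r.
apply: (determinant_multilinear (i0 := i)).
- by apply/rowP => l; rewrite !mxE !ffunE eqxx !mul1r ffunE.
- by apply/matrixP => a l; rewrite !mxE !ffunE eq_sym (negbTE (neq_lift _ _)).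
- by apply/matrixP => a l; rewrite !mxE !ffunE eq_sym (negbTE (neq_lift _ _)).
Qed.

Lemma ext_coef_rel r : @alt_rel n (Zn n) r -> freeg_lift ext_coef r = 0.
Proof.
case=> [_ [t i x y]|t i j ij tij].
  by rewrite 2!raddfB !freeg_liftU ext_coefD -addrA -opprD subrr.
rewrite freeg_liftU; apply: (determinant_alternate ij) => l.
by rewrite !mxE tij.
Qed.

Definition ext_kap : {additive ExtPow n (Zn n) -> int} := quot_lift ext_coef_rel.

Lemma ext_kap_deltas : ext_kap (ecls (deltas n)) = 1.
Proof.
rewrite [LHS]quot_liftU -(det1 _ n); congr (\det _); apply/matrixP => i l.
by rewrite !mxE !ffunE eq_sym.
Qed.

Lemma ext_kap_proj i x : ext_kap (fmap (ExtPow n) (proj i) x) = 0.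
Proof.
elim/ecls_ind: x => [|x y hx hy|t]; first by rewrite !raddf0.
  by rewrite !raddfB hx hy subr0.
rewrite ecls_map [LHS]quot_liftU /ext_coef /determinant big1 // => s _.
by rewrite (bigD1 ((s^-1)%g i)) //= mxE ffunE projE permKV eqxx mul0r mulr0.
Qed.

Definition ext_idx k : pred {ffun 'I_n -> 'I_k} :=
  fun c => (orep c == c) && injectiveb c.

Lemma ext_orth k (c c' : {ffun 'I_n -> 'I_k}) : ext_idx c -> ext_idx c' ->
  ext_kap (fmap (ExtPow n) (pull c) (ecls (bas c'))) = (c == c')%:R.
Proof.
move=> /andP[/eqP rc /injectiveP ic] /andP[/eqP rc' /injectiveP ic'].
rewrite ecls_map; case: eqP => [<-|cc'].
  rewrite (_ : tuple_map _ _ = deltas n) ?ext_kap_deltas //.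
  apply/ffunP => i; apply/ffunP => l.
  by rewrite !ffunE pullE ffunE (inj_eq ic).
(* If the image of c contains that of c', the two injections lie in one orbit and have the same
   representative; otherwise [pull c] sends some vector of [bas c'] to 0. *)
have [/forallP h|] := boolP [forall i, [exists l, c l == c' i]].
  have {}h i : exists l, c l == c' i by apply/existsP; exact: h.
  pose f i := sval (cid (h i)).
  have fP i : c (f i) = c' i by apply/eqP; rewrite /f; case: cid.
  have fi : injective f by move=> a b /(congr1 c); rewrite !fP => /ic'.
  case: cc'; rewrite -rc -rc' -(orep_perm c (perm fi)); congr orep.
  by apply/ffunP => l; rewrite ffunE permE fP.
rewrite negb_forall => /existsP [i]; rewrite negb_exists => /forallP h.
rewrite (@cls_eq0 _ _ (@ecls n) (@eclsD n) _ _ i) ?raddf0 //.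
by apply/ffunP => l; rewrite ffunE pullE !ffunE (negbTE (h l)).
Qed.

Lemma ext_basis k (x : ExtPow n (Zn k)) :
  x = \sum_(c | ext_idx c) ecls (bas c) *~ ext_kap (fmap (ExtPow n) (pull c) x).
Proof.
move: x; apply: (cls_bas_ind (@eclsD n) (@ecls_ind)) => [|x y {1}-> {1}->|j].
- by rewrite big1 // => c _; rewrite !raddf0.
- by rewrite -sumrB; apply: eq_bigr => c _; rewrite !raddfB.
have [/injectiveP ij|/injectivePn [a [b ab jab]]] := boolP (injectiveb j); last first.
  have -> : ecls (bas j) = 0 by apply: (ecls_alt ab); rewrite !ffunE jab.
  by rewrite big1 // => c _; rewrite !raddf0.
have [s e] := orepP j; set c0 := orep j in e.
have jE : ecls (bas j) = ecls (bas c0) *~ chi true s.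
  have -> : bas c0 = [ffun l => bas j (s l)].
    by apply/ffunP => l; rewrite e !ffunE.
  by rewrite ecls_perm -mulrzA chi_sqr mulr1z.
have c0P : ext_idx c0.
  apply/andP; split; first by rewrite /c0 orep_idem.
  by apply/injectiveP => a b; rewrite e !ffunE => /ij /perm_inj.
have kE c : ext_idx c ->
    ext_kap (fmap (ExtPow n) (pull c) (ecls (bas j))) = (c == c0)%:R * chi true s.
  move=> cP; rewrite jE (raddfMz (fmap (ExtPow n) (pull c))) (raddfMz ext_kap).
  by rewrite ext_orth // mulrzz.
rewrite (bigD1 c0) //= [X in _ + X]big1 ?addr0 => [|c /andP[cP /negbTE cc0]].
  by rewrite kE // eqxx mul1r.
by rewrite kE // cc0 mul0r mulr0z.
Qed.

Lemma ExtPow_is_power : is_power true (ecls (deltas n)).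
Proof.
apply: cls_is_power.
- exact: ecls_map.
- exact: eclsD.
- exact: ecls_perm.
- exact: ecls_ind.
- by exists ext_kap; exact: ext_kap_deltas.
- move=> k; exists {ffun 'I_n -> 'I_k}, (fun c => if ext_idx c then ecls (bas c) else 0),
    (fun c : {ffun 'I_n -> 'I_k} => ext_kap \o fmap (ExtPow n) (pull c) : {additive _ -> _}) => x.
  rewrite {1}(ext_basis x) big_mkcond; apply: eq_bigr => c _ /=.
  by case: ifP => // _; rewrite mul0rz.
Qed.

Lemma ExtPow_is_copower :
  is_copower true (ecls (deltas n)) ext_kap ext_idx (fun k c => ecls (bas c)).
Proof.
split.
- exact: ext_kap_deltas.
- exact: ext_kap_proj.
- exact: ext_basis.
- exact: ext_orth.
move=> k j; have [ij|/injectivePn [a [b ab jab]]] := boolP (injectiveb j).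
  left; have [s e] := orepP j; exists (orep j), (s^-1)%g; split.
    rewrite /ext_idx orep_idem eqxx; apply/injectiveP => a b.
    by rewrite e !ffunE => /(injectiveP _ ij) /perm_inj.
  by apply/ffunP => l; rewrite e !ffunE permKV.
right; exists (tperm a b); split; last by rewrite /chi odd_tperm ab.
by apply/ffunP => l; rewrite ffunE; case: tpermP => [->|->|].
Qed.

End Exterior.

(** * Divided powers *)

Section DivGenerators.
Variables n k : nat.
Implicit Types (a : 'I_k -> nat) (w : seq (nat * Zn k)).

(** The divided power monomial with exponents a. Zero exponents are kept, so that all monomials have
    the same shape. *)
Definition bword a : seq (nat * Zn k) := [seq (a i, delta i : Zn k) | i <- enum 'I_k].

Lemma bword_rem a i :
  perm_eq (bword a) ((a i, delta i : Zn k) :: [seq (a l, delta l : Zn k) | l <- rem i (enum 'I_k)]).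
Proof. by rewrite -map_cons; apply: perm_map; apply: perm_to_rem; rewrite mem_enum. Qed.

Lemma weight_bword a : weight (bword a) = (\sum_i a i)%N.
Proof.
rewrite /weight /bword -map_comp sumnE big_map big_enum /=.
exact: eq_bigr.
Qed.

Lemma eq_bword a b : a =1 b -> bword a = bword b.
Proof. by move=> ab; apply: eq_map => i; rewrite ab. Qed.

Lemma dcls_null (A : fgfree) m (w : seq (nat * A)) : (0 < m)%N -> dcls n ((m, 0) :: w) = 0.
Proof.
by move=> m0; rewrite -(mul0rz A 0) dcls_scale expr0n (gtn_eqF m0) mulr0z.
Qed.

Lemma dcls_zeros (A : fgfree) (s w : seq (nat * A)) :
  all (fun p => p.1 == 0)%N s -> dcls n (s ++ w) = dcls n w.
Proof. by elim: s => //= -[p x] s IH /andP[/= /eqP -> /IH]; rewrite dcls_zero. Qed.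

Variable P : DivPow n (Zn k) -> Prop.
Hypotheses (P0 : P 0) (PB : forall x y, P x -> P y -> P (x - y)).
Hypothesis Pb : forall a, P (dcls n (bword a)).

(** Quantifying over a trailing monomial lets a letter on a basis vector be absorbed into it, at the
    cost of a binomial coefficient and a new exponent. The predicate [goodx] then passes from basis
    vectors to all vectors. *)
Let good w := forall a, P (dcls n (w ++ bword a)).
Let goodx (x : Zn k) := forall w m, good w -> good ((m, x) :: w).

Let goodx0 : goodx 0.
Proof.
move=> w [|m] gw a; first by rewrite dcls_zero; exact: gw.
by rewrite dcls_null.
Qed.

Let goodxD x y : goodx x -> goodx y -> goodx (x + y).
Proof.
move=> gx gy w m gw a; rewrite /= dcls_add.
by apply: closed_sum => // i _; exact: (gx ((_, y) :: w) i (gy w _ gw) a).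
Qed.

Let goodxM x c : goodx x -> goodx (x *~ c).
Proof.
move=> gx w m gw a; rewrite /= dcls_scale.
by apply: closedMz => //; exact: (gx w m gw a).
Qed.

Let goodx_delta i : goodx (delta i).
Proof.
move=> w m gw a; rewrite /=.
set R := [seq (a l, delta l : Zn k) | l <- rem i (enum 'I_k)].
have -> : dcls n ((m, delta i : Zn k) :: w ++ bword a) =
    dcls n [:: (m, delta i : Zn k), (a i, delta i : Zn k) & w ++ R].
  apply: dcls_perm; rewrite perm_cons perm_sym.
  rewrite -cat1s perm_catCA perm_cat2l cat1s perm_sym.
  exact: bword_rem.
rewrite dcls_mul pmulrn; apply: closedMz => //.
pose a' l := if l == i then (m + a i)%N else a l.
have -> : dcls n (((m + a i)%N, delta i : Zn k) :: w ++ R) = dcls n (w ++ bword a').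
  apply: dcls_perm; rewrite -cat1s perm_catCA perm_cat2l cat1s perm_sym.
  have -> : R = [seq (a' l, delta l : Zn k) | l <- rem i (enum 'I_k)].
    apply/eq_in_map => l; rewrite mem_rem_uniq ?enum_uniq // inE => /andP[li _].
    by rewrite /a' (negbTE li).
  by have := bword_rem a' i; rewrite {2}/a' eqxx.
exact: gw.
Qed.

Lemma dcls_bword_ind x : P x.
Proof.
have gx (y : Zn k) : goodx y.
  rewrite -[y](@delta_sum k); apply: (big_ind goodx) => // i _.
  exact: goodxM.
elim/quot_ind: x => // w; have: good w by elim: w => [|[m y] w IH]; [exact: Pb | exact: gx].
(* The monomial with all exponents zero is the unit, so appending it does not change the class of
   w. *)
move/(_ (fun=> 0%N)).
rewrite (_ : dcls n _ = dcls n (bword (fun=> 0%N) ++ w)); last first.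
  by apply: dcls_perm; rewrite perm_catC.
by rewrite dcls_zeros //; apply/allP => p /mapP [i _ ->].
Qed.

End DivGenerators.

(** * The coefficient of the squarefree monomial in a divided power word *)

Section DivCoef.
Variable n : nat.
Implicit Types (w : seq (nat * Zn n)) (S B : {set 'I_n}).

Notation ent v l := ((v : {ffun 'I_n -> int}) l).

(** S is the set of variables still to be used. The squarefree part of gamma_k(v) is the k'th
    elementary symmetric function of the v_l x_l, whence the sum over k-element subsets B. *)
Fixpoint dcoef w S : int :=
  if w is (k, v) :: w' then
    \sum_(B : {set 'I_n} | (B \subset S) && (#|B| == k))
      (\prod_(l in B) ent v l) * dcoef w' (S :\: B)
  else (S == set0)%:R.

Lemma dcoef_weight w S : weight w != #|S| -> dcoef w S = 0.
Proof.
elim: w S => [|[k v] w IH] S /=.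
  by rewrite -cards_eq0 eq_sym => /negbTE ->.
rewrite /weight /= -/(weight w) => h; rewrite big1 // => B /andP[BS /eqP Bk].
rewrite IH ?mulr0 //; apply: contra h => /eqP ->.
by rewrite -Bk -(cardsID B S) (setIidPr BS).
Qed.

Lemma dcoef_swap p q w S : dcoef [:: p, q & w] S = dcoef [:: q, p & w] S.
Proof.
case: p q => [k v] [k' v'] /=.
under eq_bigr do rewrite big_distrr /=.
rewrite (exchange_big_dep (fun B' : {set 'I_n} => (B' \subset S) && (#|B'| == k'))) /=.
  apply: eq_bigr => B' /andP[B'S B'k]; rewrite big_distrr /=.
  apply: eq_big => [B|B _].
    rewrite B'k andbT !subsetD B'S /= disjoint_sym.
    by case: (B \subset S); rewrite //= andbC.
  by rewrite mulrCA !setDDl setUC.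
by move=> B B' _; rewrite subsetD => /andP[/andP[-> _] ->].
Qed.

Lemma dcoef_cons p w w' : dcoef w =1 dcoef w' -> dcoef (p :: w) =1 dcoef (p :: w').
Proof. by case: p => k v e S /=; apply: eq_bigr => B _; rewrite e. Qed.

Lemma dcoef_perm w w' : perm_eq w w' -> dcoef w =1 dcoef w'.
Proof.
elim: w w' => [|p w IH] w'; first by rewrite perm_sym => /perm_nilP ->.
move=> h; have pw' : p \in w' by rewrite -(perm_mem h) inE eqxx.
case/splitPr: pw' h => w1 w2 h.
have {IH} e : dcoef w =1 dcoef (w1 ++ w2).
  by apply: IH; rewrite -(perm_cons p) (perm_trans h) // -cat1s perm_catCA.
move=> S; rewrite (dcoef_cons _ e); elim: w1 S {h e} => // q w1 IH S.
by rewrite !cat_cons -(dcoef_cons q IH) dcoef_swap.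
Qed.

Lemma dcoef_zero x w S : dcoef ((0%N, x) :: w) S = dcoef w S.
Proof.
rewrite /= (big_pred1 set0) ?big_set0 ?mul1r ?setD0 // => B /=.
rewrite cards_eq0; case: eqP => [->|]; rewrite ?sub0set ?andbF //.
Qed.

Lemma dcoef_scale k (c : int) (x : Zn n) w S :
  dcoef ((k, x *~ c) :: w) S = dcoef ((k, x) :: w) S *~ (c ^+ k).
Proof.
rewrite /= mulrzz big_distrl; apply: eq_bigr => B /andP[_ /eqP <-] /=.
rewrite mulrAC; congr (_ * _); rewrite -prodr_const -big_split.
by apply: eq_bigr => l _ /=; rewrite ffunMzE mulrzz.
Qed.

Lemma subset_setUD B S : B \subset S -> B :|: S :\: B = S.
Proof. by move=> BS; rewrite -{1}(setIidPr BS) setID. Qed.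

(** A pair of disjoint subsets amounts to their union U together with the first of them. *)
Lemma sum_nested_subsets i j S (F : {set 'I_n} -> {set 'I_n} -> int) :
  \sum_(B : {set 'I_n} | (B \subset S) && (#|B| == i))
    \sum_(B' : {set 'I_n} | (B' \subset S :\: B) && (#|B'| == j)) F B B' =
  \sum_(U : {set 'I_n} | (U \subset S) && (#|U| == (i + j)%N))
    \sum_(B : {set 'I_n} | (B \subset U) && (#|B| == i)) F B (U :\: B).
Proof.
rewrite [RHS](exchange_big_dep (fun B : {set 'I_n} => (B \subset S) && (#|B| == i))) /=.
  apply: eq_bigr => B /andP[BS /eqP Bi].
  rewrite (reindex_onto (fun U => U :\: B) (fun B' => B :|: B')) /=.
    apply: eq_bigl => U; rewrite Bi eqxx andbT.
    apply/andP/andP => [[/andP[UBS /eqP UBj] /eqP e]|[/andP[US /eqP Uij] BU]].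
      have BU : B \subset U by rewrite -e subsetUl.
      split=> //; rewrite -e subUset BS (subset_trans UBS (subsetDl _ _)) /=.
      by rewrite e -(cardsID B U) (setIidPr BU) Bi UBj.
    have e := subset_setUD BU; rewrite e eqxx; split=> //; apply/andP; split; first exact: setSD.
    by have := cardsID B U; rewrite (setIidPr BU) Bi Uij => /addnI ->.
  move=> B' /andP[+ _]; rewrite subsetD => /andP[_ d].
  by rewrite setDUl setDv set0U; apply/setDidPl.
move=> U B /andP[US _] /andP[BU ->].
by rewrite (subset_trans BU US).
Qed.

Lemma dcoef_mul i j (x : Zn n) w S :
  dcoef [:: (i, x), (j, x) & w] S = dcoef (((i + j)%N, x) :: w) S *+ 'C(i + j, i).
Proof.
rewrite /=; under eq_bigr do rewrite big_distrr /=.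
rewrite sum_nested_subsets -sumrMnl; apply: eq_bigr => U /andP[US /eqP Uij].
rewrite -[in 'C(_, _)]Uij -cards_draws -sumr_const big_mkcond [RHS]big_mkcond.
apply: eq_bigr => B _; rewrite inE; case: ifP => // /andP[BU _].
by rewrite [in RHS](big_setID B) /= (setIidPr BU) mulrA setDDl subset_setUD.
Qed.

Lemma prod_add_subsets (x y : 'I_n -> int) (U : {set 'I_n}) :
  \prod_(l in U) (x l + y l) =
  \sum_(B : {set 'I_n} | B \subset U)
    (\prod_(l in B) x l) * (\prod_(l in U :\: B) y l).
Proof.
(* With 0 and 1 as values off U, distributivity over all indices only keeps the subsets of U, and
   the indices outside U contribute 1. *)
pose x' l := if l \in U then x l else 0; pose y' l := if l \in U then y l else 1.
have -> : \prod_(l in U) (x l + y l) = \prod_l (x' l + y' l).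
  rewrite big_mkcond; apply: eq_bigr => l _; rewrite /x' /y'.
  by case: ifP => //; rewrite add0r.
rewrite bigA_distr /= [RHS]big_mkcond; apply: eq_bigr => B _.
case: ifP => [BU|/negbT /subsetPn [l lB lU]]; last first.
  by rewrite (bigD1 l) //= lB /x' (negbTE lU) mul0r.
rewrite [X in _ = X * _]big_mkcond [X in _ = _ * X]big_mkcond -big_split.
apply: eq_bigr => l _ /=; rewrite inE /x' /y'.
case: (boolP (l \in B)) => lB /=; first by rewrite (subsetP BU) ?mulr1.
by rewrite mul1r.
Qed.

Lemma dcoef_add k (x y : Zn n) w S :
  dcoef ((k, x + y) :: w) S =
  \sum_(i < k.+1) dcoef [:: (i : nat, x), ((k - i)%N, y) & w] S.
Proof.
have E (i : 'I_k.+1) : dcoef [:: (i : nat, x), ((k - i)%N, y) & w] S =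
    \sum_(U : {set 'I_n} | (U \subset S) && (#|U| == k))
      \sum_(B : {set 'I_n} | (B \subset U) && (#|B| == i))
        (\prod_(l in B) ent x l) *
        ((\prod_(l in U :\: B) ent y l) * dcoef w (S :\: B :\: (U :\: B))).
  rewrite /=; under eq_bigr do rewrite big_distrr /=.
  by rewrite sum_nested_subsets subnKC // -ltnS.
rewrite (eq_bigr _ (fun i _ => E i)) {E} /=.
rewrite [RHS]exchange_big /=; apply: eq_bigr => U /andP[US /eqP Uk].
under eq_bigr do rewrite ffunE; rewrite prod_add_subsets big_distrl /=.
rewrite [RHS](exchange_big_dep (fun B : {set 'I_n} => B \subset U)) /=; last first.
  by move=> i B _ /andP[].
apply: eq_bigr => B BU.
have Bk : (#|B| < k.+1)%N by rewrite ltnS -Uk subset_leq_card.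
rewrite (big_pred1 (Ordinal Bk)); last by move=> i; rewrite /= BU /= eq_sym.
rewrite mulrA setDDl; congr (_ * dcoef w (S :\: _)).
by rewrite subset_setUD.
Qed.

Lemma dcoef_rel r : @div_rel n (Zn n) r -> freeg_lift (dcoef^~ [set: 'I_n]) r = 0.
Proof.
case=> [w hw|w w' hw|x w|k c x w|i j x w|k x y w].
- by rewrite freeg_liftU dcoef_weight // cardsT card_ord.
- by rewrite raddfB !freeg_liftU (dcoef_perm hw) subrr.
- by rewrite raddfB !freeg_liftU dcoef_zero subrr.
- by rewrite raddfB raddfMz !freeg_liftU dcoef_scale subrr.
- by rewrite raddfB raddfMn !freeg_liftU dcoef_mul subrr.
- rewrite raddfB raddf_sum !freeg_liftU dcoef_add.
  by under [X in _ - X]eq_bigr do rewrite freeg_liftU; rewrite subrr.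
Qed.

Definition div_kap : {additive DivPow n (Zn n) -> int} := quot_lift dcoef_rel.

Lemma div_kapE w : div_kap (dcls n w) = dcoef w [set: 'I_n].
Proof. exact: quot_liftU. Qed.

Lemma dcoef_proj i w S : i \in S -> dcoef (word_map (proj i) w) S = 0.
Proof.
elim: w S => [|[k v] w IH] S iS /=.
  by case: eqP iS => // ->; rewrite inE.
rewrite big1 // => B _; case: (boolP (i \in B)) => iB.
  by rewrite (bigD1 i) //= projE eqxx !mul0r.
by rewrite IH ?mulr0 // inE iB.
Qed.

Lemma div_kap_proj i x : div_kap (fmap (DivPow n) (proj i) x) = 0.
Proof.
elim/quot_ind: x => [|x y hx hy|w]; first by rewrite !raddf0.
  by rewrite !raddfB hx hy subr0.
by rewrite -/(dcls n w) dcls_map div_kapE dcoef_proj ?inE.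
Qed.

(** [pull c (delta i)] is the indicator of the fibre of c over i. So the only subset that
    contributes at the letter i is this fibre within S, and it must have [a i] elements. *)
Lemma dcoef_bword k (c : {ffun 'I_n -> 'I_k}) (a : 'I_k -> nat) (s : seq 'I_k) S :
  uniq s ->
  dcoef [seq (a i, pull c (delta i)) | i <- s] S =
  ([forall l in S, c l \in s] &&
   all (fun i => #|[set l in S | c l == i]| == a i) s)%:R.
Proof.
elim: s S => [|i s IH] S /=.
  move=> _; rewrite andbT; congr (_%:R); congr nat_of_bool.
  apply/eqP/forall_inP => [-> l|h]; first by rewrite inE.
  by apply/setP => l; rewrite inE; apply/negP => /h.
move=> /andP[si us]; set Si := [set l in S | c l == i].
have SiS : Si \subset S by apply/subsetP => l; rewrite inE => /andP[].
have other B : B \subset S -> B != Si ->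
    (\prod_(l in B) ent (pull c (delta i)) l) *
    dcoef [seq (a i0, pull c (delta i0)) | i0 <- s] (S :\: B) = 0.
  move=> BS BSi; have [BSi'|/subsetPn [l lB]] := boolP (B \subset Si); last first.
    rewrite inE (subsetP BS) //= => cl.
    by rewrite (bigD1 l) //= pullE ffunE (negbTE cl) !mul0r.
  have /subsetPn [l lS lB] : ~~ (Si \subset B).
    by apply: contra BSi => h; rewrite eqEsubset BSi'.
  rewrite IH //; case: forall_inP => [h|]; last by rewrite mulr0.
  move: lS; rewrite inE => /andP[lS /eqP cl].
  by have := h l; rewrite !inE lB lS cl (negbTE si) => /(_ isT).
rewrite big_mkcond (bigD1 Si) //= [X in _ + X]big1 ?addr0; last first.
  by move=> B BSi; case: ifP => // /andP[BS _]; exact: other.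
rewrite SiS /= -/Si; case: (#|Si| == a i); last by rewrite andbF.
rewrite big1 ?mul1r; last by move=> l; rewrite inE pullE ffunE => /andP[_ ->].
rewrite IH //; congr (_%:R); congr (nat_of_bool (_ && _)).
  apply/forall_inP/forall_inP => h l.
    move=> lS; rewrite inE; case: eqP => //= cl; apply: h.
    by rewrite !inE lS andbT; apply/eqP.
  rewrite !inE negb_and => /andP[+ lS]; rewrite lS /= => cl.
  by have := h l lS; rewrite inE (negbTE cl).
apply: eq_in_all => l ls; congr (_ == _); apply: eq_card => u; rewrite !inE.
case: (c u =P l) => [->|_]; rewrite ?andbF ?andbT //.
suff -> : (l == i) = false by rewrite andbF.
by apply: contraNF si => /eqP <-.
Qed.

Definition content k (c : {ffun 'I_n -> 'I_k}) (i : 'I_k) : nat := #|[set l | c l == i]|.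

Lemma div_kap_bword k (c : {ffun 'I_n -> 'I_k}) (a : 'I_k -> nat) :
  div_kap (fmap (DivPow n) (pull c) (dcls n (bword a))) = [forall i, content c i == a i]%:R.
Proof.
rewrite dcls_map div_kapE /word_map /bword -map_comp dcoef_bword ?enum_uniq //.
congr (_%:R); congr nat_of_bool; apply/andP/forallP.
  case=> _ /allP h i; have := h i; rewrite mem_enum => /(_ isT).
  by rewrite /content; congr (_ == _); apply: eq_card => l; rewrite !inE.
move=> h; split; first by apply/forall_inP => l _; rewrite mem_enum.
apply/allP => i _; rewrite -(eqP (h i)) /content; apply/eqP.
by apply: eq_card => l; rewrite !inE.
Qed.

End DivCoef.

(** * Exponent vectors as invariants of orbits *)

Section Contents.
Variables n k : nat.
Implicit Types c : {ffun 'I_n -> 'I_k}.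

Lemma content_count c i : content c i = count_mem i [tuple c l | l < n].
Proof.
rewrite -sum1_count /content -sum1_card /= big_map big_enum_cond /=.
by apply: eq_bigl => l; rewrite inE.
Qed.

Lemma content_perm c (s : 'S_n) : content [ffun l => c (s l)] =1 content c.
Proof.
move=> i; rewrite /content -(card_imset _ (@perm_inj _ s)); apply: eq_card => l.
rewrite inE; apply/imsetP/idP => [[u + ->]|h]; first by rewrite inE ffunE.
by exists (s^-1 l)%g; rewrite ?permKV // inE ffunE permKV.
Qed.

Lemma content_orep c : content (orep c) =1 content c.
Proof. by have [s ->] := orepP c; exact: content_perm. Qed.

Lemma content_inj c c' : content c =1 content c' -> orep c = orep c'.
Proof.
move=> e; have /tuple_permP [s h] :
    perm_eq [tuple c l | l < n] [tuple c' l | l < n].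
  apply/allP => i _; apply/eqP; rewrite /= -[LHS]content_count -[RHS]content_count.
  exact: e.
rewrite -(orep_perm c' s); congr orep; apply/ffunP => l; rewrite ffunE.
have := congr1 (fun u => nth (c l) u l) h.
by rewrite -!tnth_nth !tnth_mktuple.
Qed.

Lemma content_onto (a : 'I_k -> nat) : (\sum_i a i)%N = n ->
  exists c, content c =1 a.
Proof.
move=> an; pose u := flatten [seq nseq (a i) i | i <- enum 'I_k].
have su : size u == n.
  rewrite size_flatten /shape -map_comp sumnE big_map big_enum /= -an.
  by apply/eqP; apply: eq_bigr => i _; rewrite /= size_nseq.
exists [ffun l => tnth (Tuple su) l] => i; rewrite content_count.
have -> : count_mem i [tuple [ffun l => tnth (Tuple su) l] l | l < n] = count_mem i u.
  congr (count_mem i _); rewrite -[RHS]/(val (Tuple su)); congr val.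
  by apply: eq_from_tnth => l; rewrite tnth_mktuple ffunE.
rewrite /u count_flatten -map_comp sumnE big_map big_enum (bigD1 i) //=.
rewrite count_nseq /= eqxx mul1n big1 ?addn0 // => l li.
by rewrite count_nseq /= (negbTE li).
Qed.

End Contents.

Section Divided.
Variable n : nat.

Definition div_idx k : pred {ffun 'I_n -> 'I_k} := fun c => orep c == c.

Definition div_mono k (c : {ffun 'I_n -> 'I_k}) : DivPow n (Zn k) :=
  dcls n (bword (content c)).

Lemma div_orth k (c c' : {ffun 'I_n -> 'I_k}) : div_idx c -> div_idx c' ->
  div_kap n (fmap (DivPow n) (pull c) (div_mono c')) = (c == c')%:R.
Proof.
move=> /eqP rc /eqP rc'; rewrite div_kap_bword; congr (_%:R); congr nat_of_bool.
apply/forallP/eqP => [h|-> //]; rewrite -rc -rc'; apply: content_inj => i.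
exact/eqP.
Qed.

Lemma div_basis k (x : DivPow n (Zn k)) :
  x = \sum_(c | div_idx c) div_mono c *~ div_kap n (fmap (DivPow n) (pull c) x).
Proof.
move: x; apply: dcls_bword_ind => [|x y {1}-> {1}->|a].
- by rewrite big1 // => c _; rewrite !raddf0.
- by rewrite -sumrB; apply: eq_bigr => c _; rewrite !raddfB.
have [an|an] := eqVneq (\sum_i a i)%N n; last first.
  rewrite dcls_weight ?weight_bword // big1 // => c _.
  by rewrite !raddf0.
have [c cE] := content_onto an; rewrite (bigD1 (orep c)) /=; last first.
  by rewrite /div_idx orep_idem.
rewrite div_kap_bword (introT forallP); last first.
  by move=> i; rewrite content_orep cE.
rewrite mulr1z [X in _ + X]big1 ?addr0 => [|c' /andP[/eqP rc' cc']].
  by rewrite /div_mono (eq_bword (b := a)) // => i; rewrite content_orep cE.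
rewrite div_kap_bword; case: forallP => // h; case/eqP: cc'.
by rewrite -rc'; apply: content_inj => i; rewrite (eqP (h i)) cE.
Qed.

Lemma dcls_null_in (A : fgfree) m (w : seq (nat * A)) :
  (0 < m)%N -> (m, 0) \in w -> dcls n w = 0.
Proof. by move=> m0 /perm_to_rem /(dcls_perm n) ->; exact: dcls_null. Qed.

Lemma bword_proj k (a : 'I_k -> nat) i :
  a i = 0%N -> fmap (DivPow n) (proj i) (dcls n (bword a)) = dcls n (bword a).
Proof.
move=> ai; pose R := [seq (a l, delta l : Zn k) | l <- rem i (enum 'I_k)].
have RE : word_map (proj i) R = R.
  rewrite /R /word_map -map_comp; apply/eq_in_map => l.
  rewrite mem_rem_uniq ?enum_uniq // inE => /andP[li _] /=.
  by rewrite proj_delta (negbTE li).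
rewrite dcls_map (_ : dcls n _ = dcls n ((a i, proj i (delta i)) :: word_map (proj i) R)).
  by rewrite RE (dcls_perm n (bword_rem a i)) ai !dcls_zero.
by apply: dcls_perm; exact: (perm_map _ (bword_rem a i)).
Qed.

Lemma bword_proj0 k (a : 'I_k -> nat) i :
  (0 < a i)%N -> fmap (DivPow n) (proj i) (dcls n (bword a)) = 0.
Proof.
move=> ai; rewrite dcls_map; apply: (dcls_null_in ai).
apply/mapP; exists (a i, delta i : Zn k); last by rewrite /= proj_delta eqxx.
by apply/mapP; exists i; rewrite ?mem_enum.
Qed.

Definition div_top : DivPow n (Zn n) := dcls n (bword (fun=> 1%N)).

Lemma div_top_crossed : crossed div_top.
Proof. by move=> i; exact: bword_proj0. Qed.

Lemma div_kap_top : div_kap n div_top = 1.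
Proof.
have {1}-> : div_top = fmap (DivPow n) (pull [ffun l : 'I_n => l]) div_top.
  rewrite fmap_idE // => v; apply/ffunP => l.
  by rewrite pullE ffunE.
rewrite div_kap_bword (introT forallP) // => i; rewrite /content -(cards1 i).
by apply/eqP/eq_card => l; rewrite !inE ffunE.
Qed.

Lemma div_top_perm (s : 'S_n) : fmap (DivPow n) (push s) div_top = div_top *~ chi false s.
Proof.
rewrite mulr1z dcls_map; apply: dcls_perm; rewrite /word_map /bword -map_comp.
rewrite (eq_map (_ : _ =1 (fun i => (1%N, delta i : Zn n)) \o s)); last first.
  by move=> i; rewrite /= push_delta.
rewrite map_comp; apply: perm_map; apply: uniq_perm.
- by rewrite map_inj_uniq ?enum_uniq //; exact: perm_inj.
- exact: enum_uniq.
move=> i; rewrite mem_enum; apply/mapP; exists (s^-1 i)%g; rewrite ?mem_enum //.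
by rewrite permKV.
Qed.

Lemma div_high k : (n < k)%N -> forall x : DivPow n (Zn k), cr x = 0.
Proof.
move=> nk; apply: dcls_bword_ind => [|x y hx hy|a].
- exact: cr0.
- by rewrite crB hx hy subr0.
have [/existsP [i /eqP ai]|h] := boolP [exists i, a i == 0%N].
  exact/cr_fixed/(bword_proj ai).
rewrite dcls_weight ?cr0 // weight_bword gtn_eqF // (leq_trans nk) //.
rewrite -[k in (k <= _)%N]card_ord -sum1_card; apply: leq_sum => i _.
by rewrite lt0n; apply: contra h => ai; apply/existsP; exists i.
Qed.

Lemma div_top_span (x : DivPow n (Zn n)) : exists c : int, cr x = div_top *~ c.
Proof.
move: x; apply: dcls_bword_ind => [|x y [c cx] [d cy]|a].
- by exists 0; rewrite cr0 mulr0z.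
- by exists (c - d); rewrite crB cx cy mulrzBr.
have [/existsP [i /eqP ai]|/existsPn h] := boolP [exists i, a i == 0%N].
  by exists 0; rewrite mulr0z; apply/cr_fixed/(bword_proj ai).
have [an|an] := eqVneq (\sum_i a i)%N n; last first.
  by exists 0; rewrite dcls_weight ?weight_bword // cr0 mulr0z.
(* There are n exponents, none of them zero, with sum n. *)
have a1 i : a i = 1%N.
  have h' l : (1 <= a l)%N by rewrite lt0n.
  have : (\sum_l (a l - 1))%N = 0%N.
    rewrite sumnB => [|l _ //].
    by rewrite an sum1_card card_ord subnn.
  move/eqP; rewrite sum_nat_eq0 => /forallP /(_ i) /=.
  by rewrite subn_eq0 => ai; apply/eqP; rewrite eqn_leq ai h'.
exists 1; rewrite mulr1z (eq_bword a1).
by rewrite cr_id //; exact: div_top_crossed.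
Qed.

Lemma DivPow_is_power : is_power false div_top.
Proof.
split.
- exact: div_top_crossed.
- exact: div_top_perm.
- exact: div_high.
- exact: div_top_span.
- by exists (div_kap n); exact: div_kap_top.
- move=> k; exists {ffun 'I_n -> 'I_k}, (fun c => if div_idx c then div_mono c else 0),
    (fun c : {ffun 'I_n -> 'I_k} =>
      div_kap n \o fmap (DivPow n) (pull c) : {additive _ -> _}) => x.
  rewrite {1}(div_basis x) big_mkcond; apply: eq_bigr => c _ /=.
  by case: ifP => // _; rewrite mul0rz.
Qed.

Lemma DivPow_is_copower : is_copower false div_top (div_kap n) div_idx div_mono.
Proof.
split.
- exact: div_kap_top.
- exact: div_kap_proj.
- exact: div_basis.
- exact: div_orth.
move=> k j; left; have [s e] := orepP j; exists (orep j), (s^-1)%g; split.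
  by rewrite /div_idx orep_idem.
by apply/ffunP => l; rewrite e !ffunE permKV.
Qed.

End Divided.

(** * Lifting the generic functional *)

Section Rows.
Variables k n : nat.

Definition dot (t v : {ffun 'I_k -> int}) : int := \sum_i t i * v i.

Lemma dot_deltal i v : dot (delta i) v = v i.
Proof.
rewrite /dot (bigD1 i) //= ffunE eqxx mul1r big1 ?addr0 // => j ji.
by rewrite ffunE (negbTE ji) mul0r.
Qed.

Lemma dot_addl t t' v : dot (t + t') v = dot t v + dot t' v.
Proof.
by rewrite /dot -big_split; apply: eq_bigr => i _; rewrite ffunE mulrDl.
Qed.

Lemma dot0l v : dot 0 v = 0.
Proof. by rewrite /dot big1 // => i _; rewrite ffunE mul0r. Qed.

Lemma dot_proj i (t v : Zn k) : dot t (proj i v) = dot (proj i t) v.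
Proof.
apply: eq_bigr => l _; rewrite !projE.
by case: ifP => _; rewrite ?mul0r ?mulr0.
Qed.

Lemma rows_is_additive (t : {ffun 'I_n -> Zn k}) :
  zmod_morphism (fun v : Zn k => [ffun l => dot (t l) v] : Zn n).
Proof.
move=> v w; apply/ffunP => l; rewrite !ffunE /dot -sumrB.
by apply: eq_bigr => i _; rewrite !ffunE mulrBr.
Qed.

(** The dual of [lin]: a map to Z^n is an n-tuple of functionals on Z^k, each encoded as a vector
    through [dot]. *)
Definition rows (t : {ffun 'I_n -> Zn k}) : {additive Zn k -> Zn n} :=
  mk_additive (rows_is_additive t).

Lemma rowsE (t : {ffun 'I_n -> Zn k}) v l : (rows t v : {ffun _ -> _}) l = dot (t l) v.
Proof. by rewrite /rows mk_additiveE ffunE. Qed.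

Lemma rows_bas (c : {ffun 'I_n -> 'I_k}) : rows (bas c) =1 pull c.
Proof. by move=> v; apply/ffunP => l; rewrite rowsE pullE ffunE dot_deltal. Qed.

Lemma additive_rows (f : {additive Zn k -> Zn n}) :
  f =1 rows [ffun l => [ffun i => (f (delta i) : {ffun _ -> _}) l]].
Proof.
apply: eq_additive => i; apply/ffunP => l; rewrite rowsE ffunE /dot.
rewrite (bigD1 i) //= !ffunE eqxx mulr1 big1 ?addr0 // => j ji.
by rewrite !ffunE (negbTE ji) mulr0.
Qed.

End Rows.

Section Covalues.
Variables (n : nat) (H : functor) (eps : {additive H (Zn n) -> int}).

(** The dual of [ev]: for fixed x, a functional on H(Z^n) becomes a form in n arguments on the dual
    of Z^k. *)
Definition rv k (t : {ffun 'I_n -> Zn k}) (x : H (Zn k)) : int :=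
  eps (fmap H (rows t) x).

Lemma rv_bas k (c : {ffun 'I_n -> 'I_k}) x : rv (bas c) x = eps (fmap H (pull c) x).
Proof. by congr (eps _); apply: fmap_eq; exact: rows_bas. Qed.

Hypothesis eps_proj : forall i x, eps (fmap H (proj i) x) = 0.

Lemma rv_eq0 k (t : {ffun 'I_n -> Zn k}) i x : t i = 0 -> rv t x = 0.
Proof.
move=> ti; rewrite /rv -(eps_proj i (fmap H (rows t) x)); congr (eps _).
symmetry; apply: fmap_compE => v; apply/ffunP => l; rewrite projE rowsE.
by case: eqP => // ->; rewrite ti dot0l.
Qed.

(** Functionals that kill the images of the projections are thus determined on cross-effects, just
    as crossed elements are fixed by [cr]. *)
Lemma functional_cr k (D : {additive H (Zn k) -> int}) :
  (forall i x, D (fmap H (proj i) x) = 0) -> forall x, D (cr x) = D x.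
Proof.
move=> D0 x; rewrite /cr; elim: (enum 'I_k) => //= i s IH.
by rewrite raddfB D0 subr0 IH.
Qed.

Lemma rv_perm k (t : {ffun 'I_n -> Zn k}) (s : 'S_n) x :
  rv [ffun l => t (s l)] x = eps (fmap H (push (s^-1)%g) (fmap H (rows t) x)).
Proof.
congr (eps _); symmetry; apply: fmap_compE => v; apply/ffunP => l.
by rewrite push_pull pullE !rowsE invgK ffunE.
Qed.

Hypothesis Hhigh : forall D : {additive H (Zn n.+1) -> int},
  (forall i x, D (fmap H (proj i) x) = 0) -> forall x, D x = 0.

(** The dual of [ev_add]: the additivity defect comes from a functional on H(Z^(n+1)) that kills the
    image of every projection. *)
Lemma rvD k (t : {ffun 'I_n -> Zn k}) i x y z :
  rv (upd t i (x + y)) z = rv (upd t i x) z + rv (upd t i y) z.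
Proof.
pose d : {ffun 'I_n -> Zn n.+1} := [ffun l => delta (fintype.lift ord0 l)].
pose dx : Zn n.+1 := delta (fintype.lift ord0 i).
pose dy : Zn n.+1 := delta ord0.
pose Df z := rv (upd d i (dx + dy)) z - rv (upd d i dx) z - rv (upd d i dy) z.
have DfB : zmod_morphism Df.
  move=> u v; have rvB a : rv a (u - v) = rv a u - rv a v.
    by rewrite /rv (raddfB (fmap H _)) (raddfB eps).
  by rewrite /Df !rvB [RHS]subrACA; congr (_ - _); rewrite subrACA.
have rv_proj j (u : {ffun 'I_n -> Zn n.+1}) w :
    rv u (fmap H (proj j) w) = rv (tuple_map (proj j) u) w.
  congr (eps _); apply: fmap_compE => v; apply/ffunP => l.
  by rewrite !rowsE ffunE dot_proj.
have D0 w : Df w = 0.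
  rewrite -(mk_additiveE DfB); apply: Hhigh => j {}w.
  rewrite mk_additiveE /Df !rv_proj !tuple_map_upd.
  case: (unliftP ord0 j) => [l|] ->.
    case: (eqVneq l i) => [->|li].
      have -> : proj (fintype.lift ord0 i) (dx + dy) = dy.
        by rewrite raddfD /= !proj_delta eqxx (negbTE (neq_lift _ _)) add0r.
      have -> : proj (fintype.lift ord0 i) dx = 0 by rewrite proj_delta eqxx.
      rewrite proj_delta (negbTE (neq_lift _ _)).
      by rewrite [X in _ - X - _](@rv_eq0 _ _ i) ?ffunE ?eqxx // subr0 subrr.
    have e u : rv (upd (tuple_map (proj (fintype.lift ord0 l)) d) i u) w = 0.
      apply: (@rv_eq0 _ _ l); rewrite !ffunE (negbTE li) proj_delta.
      by rewrite (inj_eq lift_inj) eqxx.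
    by rewrite !e !subr0.
  have -> : proj ord0 (dx + dy) = dx.
    by rewrite raddfD /= !proj_delta eqxx eq_sym (negbTE (neq_lift _ _)) addr0.
  have -> : proj ord0 dx = dx.
    by rewrite proj_delta eq_sym (negbTE (neq_lift _ _)).
  have -> : proj ord0 dy = 0 by rewrite proj_delta eqxx.
  by rewrite [X in _ - _ - X](@rv_eq0 _ _ i) ?ffunE ?eqxx // subr0 subrr.
pose s : {ffun 'I_n.+1 -> Zn k} := [ffun j => if unlift ord0 j is Some l
  then (if l == i then x else t l) else y].
have sE (u : Zn n.+1) (u' : Zn k) : (forall v, dot u (rows s v) = dot u' v) ->
    rv (upd d i u) (fmap H (rows s) z) = rv (upd t i u') z.
  move=> uu'; congr (eps _); apply: fmap_compE => v; apply/ffunP => l.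
  rewrite !rowsE !ffunE; case: eqP => // li.
  by rewrite dot_deltal rowsE ffunE liftK (introF eqP li).
have sx v : dot dx (rows s v) = dot x v.
  by rewrite dot_deltal rowsE ffunE liftK eqxx.
have sy v : dot dy (rows s v) = dot y v.
  by rewrite dot_deltal rowsE ffunE unlift_none.
have := D0 (fmap H (rows s) z); rewrite /Df (sE _ (x + y)); last first.
  by move=> v; rewrite !dot_addl sx sy.
by rewrite (sE _ _ sx) (sE _ _ sy) -addrA -opprD => /eqP; rewrite subr_eq0 => /eqP.
Qed.

End Covalues.

Section Retraction.
Variables (bF bG : bool) (m n : nat) (F G : functor).
Variables (f0 : F (Zn m)) (g0 : G (Zn n)).
Hypotheses (pF : is_power bF f0) (pG : is_power bG g0) (mn : (m <= n)%N).
Variables (kap : {additive G (Zn n) -> int}) (C : forall k, pred {ffun 'I_n -> 'I_k}).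
Variable (mo : forall k, {ffun 'I_n -> 'I_k} -> G (Zn k)).
Hypothesis cG : is_copower bG g0 kap C mo.
Variable E : extension F G.

Lemma kap_cr (x : G (Zn n)) : cr x = g0 *~ kap x.
Proof.
have [c cE] := pw_top pG x; rewrite cE; congr (_ *~ _).
rewrite -(functional_cr (cp_proj cG)) cE raddfMz (cp_one cG).
by rewrite mulrzz mul1r.
Qed.

(** By [functional_cr] it suffices to test on cross-effects, that is, on the line of [g0]. *)
Lemma kap_push (s : 'S_n) x : kap (fmap G (push s) x) = kap x * chi bG s.
Proof.
pose D := kap \o fmap G (push s) : {additive _ -> _}.
have -> : kap (fmap G (push s) x) = D x by [].
rewrite -(functional_cr (D := D)) => [|i y /=].
  by rewrite kap_cr raddfMz /= (pw_perm pG) raddfMz (cp_one cG) !mulrzz mulrC mul1r.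
rewrite (fmap_compE (h := proj (s i) \o push s)); last first.
  by move=> v; rewrite /= proj_push permK.
by rewrite (fmap_comp (push s) (proj (s i))) /= (cp_proj cG).
Qed.

Lemma ext_functional_high k (D : {additive E (Zn k) -> int}) : (n < k)%N ->
  (forall i x, D (fmap E (proj i) x) = 0) -> forall x, D x = 0.
Proof.
move=> nk D0 x.
have DG g : D (ext_inj E _ g) = 0.
  by rewrite -(functional_cr D0) -nt_cr (pw_high pG nk) !raddf0.
rewrite -(functional_cr D0); have [|g ->] := @ext_inj_exists _ _ E _ (cr x).
  by rewrite nt_cr (pw_high pF (leq_ltn_trans mn nk)).
exact: DG.
Qed.

(** The dual basis of F(Z^n) splits the extension additively on this object, so [kap] extends;
    composing with [cr] makes the extension vanish on the images of the projections without changing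
    it on G. *)
Lemma functional_lift : exists eps : {additive E (Zn n) -> int},
  (forall g, eps (ext_inj E _ g) = kap g) /\
  (forall i x, eps (fmap E (proj i) x) = 0).
Proof.
have [I [b [lam bE]]] := pw_free pF n.
pose c i := sval (cid (ext_prjP E (b i))).
have cE i : ext_prj E _ (c i) = b i by rewrite /c; case: cid.
pose s (y : F (Zn n)) := \sum_i c i *~ lam i y.
have sP y : ext_prj E _ (s y) = y.
  by rewrite {2}(bE y) raddf_sum; apply: eq_bigr => i _; rewrite raddfMz cE.
have sB : zmod_morphism s.
  by move=> u v; rewrite -sumrB; apply: eq_bigr => i _; rewrite raddfB mulrzBr.
have ex x : exists g, x - s (ext_prj E _ x) = ext_inj E _ g.
  by apply: ext_inj_exists; rewrite raddfB sP subrr.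
pose r x := sval (cid (ex x)).
have rE x : ext_inj E _ (r x) = x - s (ext_prj E _ x) by rewrite /r; case: cid.
have rB : zmod_morphism r.
  move=> x y; apply: (@ext_injP _ _ E); rewrite [RHS]raddfB !rE raddfB.
  by rewrite sB subrACA.
have rG g : r (ext_inj E _ g) = g.
  apply: (@ext_injP _ _ E); rewrite rE ext_prj_inj.
  by rewrite -(mk_additiveE sB) raddf0 subr0.
exists (kap \o mk_additive rB \o @cr E n : {additive _ -> _}); split=> [g|i x] /=.
  by rewrite -nt_cr mk_additiveE rG (functional_cr (cp_proj cG)).
by rewrite cr_proj0 !raddf0.
Qed.

Variable eps : {additive E (Zn n) -> int}.
Hypotheses (eps_inj : forall g, eps (ext_inj E _ g) = kap g).
Hypotheses (eps_proj : forall i x, eps (fmap E (proj i) x) = 0).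
Hypothesis (eps_push : forall (s : 'S_n) x, eps (fmap E (push s) x) = eps x * chi bG s).

(** The retraction [rho] reads the coordinates of x by [eps], where those of G are read by [kap].
    Naturality requires these readings to match along every map to Z^n and not only along the basis
    indices; multiadditivity and the common character reduce the former to the latter. *)
Lemma functional_splits : splits E.
Proof.
pose rho k (x : E (Zn k)) : G (Zn k) :=
  \sum_(c | C c) mo c *~ eps (fmap E (pull c) x).
have rhoB k : zmod_morphism (@rho k).
  by move=> x y; rewrite -sumrB; apply: eq_bigr => c _; rewrite !raddfB.
have rhoG k (g : G (Zn k)) : rho k (ext_inj E _ g) = g.
  rewrite [RHS](cp_basis cG); apply: eq_bigr => c _.
  by rewrite -nt_nat eps_inj.
have rvDE k (t : {ffun 'I_n -> Zn k}) i x y z :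
    rv eps (upd t i (x + y)) z = rv eps (upd t i x) z + rv eps (upd t i y) z.
  apply: rvD => // D; exact: ext_functional_high.
have rvDG k (t : {ffun 'I_n -> Zn k}) i x y z :
    rv kap (upd t i (x + y)) z = rv kap (upd t i x) z + rv kap (upd t i y) z.
  apply: rvD; first exact: (cp_proj cG).
  by move=> D D0 w; rewrite -(functional_cr D0) (pw_high pG) ?raddf0.
have kap_rho k (c : {ffun 'I_n -> 'I_k}) x : C c ->
    kap (fmap G (pull c) (rho k x)) = eps (fmap E (pull c) x).
  move=> Cc; rewrite /rho !raddf_sum (bigD1 c) //= [X in _ + X]big1 ?addr0.
    by rewrite (raddfMz (fmap G _)) (raddfMz kap) (cp_orth cG) // eqxx mulrzz mul1r.
  move=> c' /andP[Cc' cc']; rewrite (raddfMz (fmap G _)) (raddfMz kap) (cp_orth cG) //.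
  by rewrite eq_sym (negbTE cc') mul0rz.
have rv_rho k t (x : E (Zn k)) : rv eps t x = rv kap t (rho k x).
  apply: (@multiadd_eq _ _ _ (fun t => rv eps t x) (fun t => rv kap t (rho k x))) t => //.
  (* A permuted basis index reduces to [kap_rho] by equivariance; an index map fixed by a
     permutation of character -1 makes both forms equal to their negatives. *)
  move=> j; case: (cp_rep cG j) => [[c [s [Cc jE]]]|[s [jE s1]]].
    have -> : bas j = [ffun l => bas c (s l)].
      by apply/ffunP => l; rewrite jE !ffunE.
    by rewrite !rv_perm eps_push kap_push !chiV -!/(rv _ _ _) !rv_bas kap_rho.
  have bj : bas j = [ffun l => bas j (s l)].
    by apply/ffunP => l; rewrite {1}jE !ffunE.
  have half (a : int) : a = a * -1 -> a = 0 by lia.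
  have -> : rv eps (bas j) x = 0.
    by apply: half; rewrite {1}bj rv_perm eps_push chiV s1.
  by symmetry; apply: half; rewrite {1}bj rv_perm kap_push chiV s1.
have rho_nat k k' (f : {additive Zn k -> Zn k'}) x :
    rho k' (fmap E f x) = fmap G f (rho k x).
  rewrite [LHS](cp_basis cG) [RHS](cp_basis cG); apply: eq_bigr => c Cc.
  rewrite kap_rho //; congr (_ *~ _).
  pose t := [ffun l => [ffun i => ((pull c \o f) (delta i) : {ffun _ -> _}) l]] : {ffun 'I_n -> Zn k}.
  have tE v : pull c (f v) = rows t v by exact: (additive_rows (pull c \o f)).
  rewrite !(fmap_compE tE); exact: rv_rho.
(* As [rho] is natural for all maps between the [Zn k], any choice of isomorphisms transports it to
   all objects. *)
pose kk A := sval (cid (fgfree_iso A)).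
have iso (A : fgfree) : exists uv : {additive Zn (kk A) -> A} * {additive A -> Zn (kk A)},
    cancel uv.1 uv.2 /\ cancel uv.2 uv.1.
  by rewrite /kk; case: cid => k [u [v h]]; exists (u, v).
pose u A := (sval (cid (iso A))).1; pose v A := (sval (cid (iso A))).2.
have uv A : cancel (u A) (v A) by rewrite /u /v; case: cid => ? [].
have vu A : cancel (v A) (u A) by rewrite /u /v; case: cid => ? [].
pose rA (A : fgfree) : {additive E A -> G A} :=
  fmap G (u A) \o mk_additive (@rhoB (kk A)) \o fmap E (v A).
have rN (A B : fgfree) (f : {additive A -> B}) : rA B \o fmap E f =1 fmap G f \o rA A.
  move=> x; rewrite /rA /= !mk_additiveE.
  have e1 : fmap E (v B) (fmap E f x) = fmap E (v B \o f \o u A) (fmap E (v A) x).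
    rewrite (fmap_compE (h := v B \o f)) // (fmap_compE (h := v B \o f)) // => y.
    by rewrite /= vu.
  rewrite e1 rho_nat (fmap_compE (h := f \o u A)) => [|y]; last by rewrite /= vu.
  by rewrite [RHS](fmap_compE (h := f \o u A)).
apply: (@retraction_splits _ _ E (NatTrans rN)) => A g.
rewrite /= mk_additiveE -nt_nat rhoG (fmap_compE (h := idfun)) ?fmap_id // => y.
exact: vu.
Qed.

End Retraction.

(** * Split extensions *)

Lemma chi_small b n (s : 'S_n) : (n <= 1)%N -> chi b s = 1.
Proof.
move=> n1; have -> : s = 1%g.
  apply/permP => i; rewrite perm1; apply: val_inj => /=.
  have := ltn_ord i; have := ltn_ord (s i); lia.
by rewrite /chi odd_perm1 andbF.
Qed.

Lemma chi_even b n (s : 'S_n) : ~~ odd_perm s -> chi b s = 1.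
Proof. by rewrite /chi => /negbTE ->; rewrite andbF. Qed.

Lemma chi_odd n (s : 'S_n) : odd_perm s -> chi true s = -1.
Proof. by rewrite /chi => ->. Qed.

Lemma chi_false n (s : 'S_n) : chi false s = 1.
Proof. by []. Qed.

Section Dual.
Variables (bF bG : bool) (m n : nat) (F G : functor).
Variables (f0 : F (Zn m)) (g0 : G (Zn n)).
Hypotheses (pF : is_power bF f0) (pG : is_power bG g0).
Variables (kap : {additive G (Zn n) -> int}) (C : forall k, pred {ffun 'I_n -> 'I_k}).
Variable (mo : forall k, {ffun 'I_n -> 'I_k} -> G (Zn k)).
Hypothesis cG : is_copower bG g0 kap C mo.
Variable E : extension F G.

Lemma push_proj_vanish (H : functor) (eps : {additive H (Zn n) -> int}) (s : 'S_n) :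
  (forall i x, eps (fmap H (proj i) x) = 0) ->
  forall i x, eps (fmap H (push s) (fmap H (proj i) x)) = 0.
Proof.
move=> e0 i x; rewrite (fmap_compE (h := proj (s i) \o push s)).
  by rewrite (fmap_comp (push s) (proj (s i))) /= e0.
by move=> v; rewrite /= proj_push permK.
Qed.

(** Equivariance of [eps] is automatic: its defect D vanishes on G and is determined on
    cross-effects, and these lie in G because F has none in degree n. *)
Lemma source_lt_splits : (m < n)%N -> splits E.
Proof.
move=> mn; have [eps [eG e0]] := functional_lift pF cG E.
apply: (functional_splits pF pG (ltnW mn) cG eG e0) => s x.
pose D x := eps (fmap E (push s) x) - eps x *~ chi bG s.
have DB : zmod_morphism D.
  move=> u v; rewrite /D (raddfB (fmap E _)) !(raddfB eps) mulrzBl.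
  by rewrite subrACA.
have D0 i y : mk_additive DB (fmap E (proj i) y) = 0.
  by rewrite mk_additiveE /D push_proj_vanish // e0 mul0rz subr0.
have DG g : D (ext_inj E _ g) = 0.
  by rewrite /D -nt_nat !eG (kap_push pG cG) mulrzz subrr.
apply/eqP; rewrite -mulrzz -subr_eq0 -/(D x) -(mk_additiveE DB).
rewrite -(functional_cr D0) mk_additiveE.
have [|g ->] := @ext_inj_exists _ _ E _ (cr x); last by rewrite DG.
by rewrite nt_cr (pw_high pF mn).
Qed.

End Dual.

Section DualSame.
Variables (bF bG : bool) (n : nat) (F G : functor).
Variables (f0 : F (Zn n)) (g0 : G (Zn n)).
Hypotheses (pF : is_power bF f0) (pG : is_power bG g0).
Variables (kap : {additive G (Zn n) -> int}) (C : forall k, pred {ffun 'I_n -> 'I_k}).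
Variable (mo : forall k, {ffun 'I_n -> 'I_k} -> G (Zn k)).
Hypothesis cG : is_copower bG g0 kap C mo.
Variable E : extension F G.
Variable kapF : {additive F (Zn n) -> int}.
Hypothesis kapF_one : kapF f0 = 1.
Hypothesis kapF_cr : forall y, cr y = f0 *~ kapF y.
Variable eps : {additive E (Zn n) -> int}.
Hypotheses (eps_inj : forall g, eps (ext_inj E _ g) = kap g).
Hypotheses (eps_proj : forall i x, eps (fmap E (proj i) x) = 0).

(** The defect vanishes on G and is determined on cross-effects, hence factors through the line of
    [f0]; d is its value at a preimage of [f0]. *)
Lemma functional_push_defect (s : 'S_n) : exists d : int, forall x,
  eps (fmap E (push s) x) = eps x * chi bG s + d * kapF (ext_prj E _ x).
Proof.
have [e eE] := ext_prjP E f0.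
pose D x := eps (fmap E (push s) x) - eps x *~ chi bG s.
have DB : zmod_morphism D.
  move=> u v; rewrite /D (raddfB (fmap E _)) !(raddfB eps) mulrzBl.
  by rewrite subrACA.
have D0 i y : mk_additive DB (fmap E (proj i) y) = 0.
  by rewrite mk_additiveE /D push_proj_vanish // eps_proj mul0rz subr0.
have DG g : mk_additive DB (ext_inj E _ g) = 0.
  by rewrite mk_additiveE /D -nt_nat !eps_inj (kap_push pG cG) mulrzz subrr.
exists (D e) => x; apply/eqP; rewrite addrC -subr_eq -mulrzz -/(D x); apply/eqP.
rewrite -!(mk_additiveE DB) -[LHS](functional_cr D0).
have [|g /eqP] := @ext_inj_exists _ _ E _ (cr x - e *~ kapF (ext_prj E _ x)).
  by rewrite raddfB raddfMz /= nt_cr eE kapF_cr subrr.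
by rewrite subr_eq => /eqP ->; rewrite raddfD raddfMz /= DG add0r mulrzz.
Qed.

(** The dual of [lift_push_eq]: with equal characters every iteration of s adds the same multiple of
    d, and the order of s is finite. *)
Lemma functional_push_eq (s : 'S_n) x : chi bF s = chi bG s ->
  eps (fmap E (push s) x) = eps x * chi bG s.
Proof.
move=> chiE; have [d dE] := functional_push_defect s.
suff d0 : d = 0 by rewrite dE d0 mul0r addr0.
have kp y : kapF (fmap F (push s) y) = kapF y * chi bF s.
  have kcr z : kapF (cr z) = kapF z by rewrite kapF_cr raddfMz kapF_one mulrzz mul1r.
  pose K := kapF \o @cr F n : {additive _ -> _}.
  have K0 i z : K (fmap F (proj i) z) = 0 by rewrite /= cr_proj0 raddf0.
  have e1 : kapF (fmap F (push s) (cr y)) = kapF (fmap F (push s) y).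
    pose D := K \o fmap F (push s) : {additive _ -> _}.
    have := functional_cr (D := D) (push_proj_vanish s K0) y.
    by rewrite /= !kcr.
  by rewrite -e1 kapF_cr raddfMz (pw_perm pF) !raddfMz kapF_one !mulrzz mul1r mulrC.
have [e eE] := ext_prjP E f0.
have it N : eps (fmap E (push (s ^+ N)%g) e) * chi bG s ^+ N = eps e + d * chi bG s * N%:R
    /\ kapF (fmap F (push (s ^+ N)%g) f0) * chi bG s ^+ N = 1.
  elim: N => [|N [IH IH']].
    by rewrite !fmap_idE ?mulr1 ?mulr0 ?addr0 ?kapF_one // => v; rewrite push1.
  have c2 := chi_sqr bG s.
  have hE (H : functor) (z : H (Zn n)) :
      fmap H (push (s ^+ N.+1)%g) z = fmap H (push s) (fmap H (push (s ^+ N)%g) z).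
    by symmetry; apply: fmap_compE => v; rewrite push_mul expgSr.
  rewrite !hE dE nt_nat eE kp chiE exprS; split; last first.
    by rewrite -mulrA [chi bG s * _]mulrA c2 mul1r.
  rewrite mulrDl -[X in X + _]mulrA [X in _ * X]mulrA c2 mul1r IH.
  have -> : d * kapF (fmap F (push (s ^+ N)%g) f0) * (chi bG s * chi bG s ^+ N) =
      d * chi bG s * (kapF (fmap F (push (s ^+ N)%g) f0) * chi bG s ^+ N) by ring.
  by rewrite IH' -natr1 mulr1; ring.
have [+ _] := it (#[s]%g * 2)%N.
rewrite expgM expg_order expg1n fmap_idE => [|v]; last by rewrite push1.
rewrite mulnC exprM expr2 chi_sqr expr1n mulr1 => /eqP.
rewrite -subr_eq0 opprD addrA subrr sub0r oppr_eq0 !mulf_eq0 pnatr_eq0.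
have -> : (chi bG s == 0) = false.
  by apply/negP => /eqP c0; have := chi_sqr bG s; rewrite c0 mul0r.
rewrite orbF muln_eq0 /= => /orP[/eqP //|/eqP os].
by have := order_gt0 s; rewrite os.
Qed.

End DualSame.

Lemma source_eq_splits b n (F G : functor) (f0 : F (Zn n)) (g0 : G (Zn n))
    (kapF : {additive F (Zn n) -> int}) (kap : {additive G (Zn n) -> int}) C mo
    (E : extension F G) bF :
  is_power bF f0 -> is_power b g0 -> is_copower b g0 kap C mo ->
  kapF f0 = 1 -> (forall y, cr y = f0 *~ kapF y) ->
  (forall s : 'S_n, chi bF s = chi b s) -> splits E.
Proof.
move=> pF pG cG k1 kcr chiE; have [eps [eG e0]] := functional_lift pF cG E.
apply: (functional_splits pF pG (leqnn n) cG eG e0) => s x.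
by apply: (functional_push_eq pF pG cG k1 kcr eG e0); rewrite chiE.
Qed.

Lemma DivPow_cr n y : cr y = div_top n *~ div_kap n y.
Proof. exact: (kap_cr (DivPow_is_power n) (DivPow_is_copower n)). Qed.

Lemma DivPow_DivPow_splits n (E : extension (DivPow n) (DivPow n)) : splits E.
Proof.
exact: (source_eq_splits E (DivPow_is_power n) (DivPow_is_power n)
  (DivPow_is_copower n) (div_kap_top n) (@DivPow_cr n)).
Qed.

Lemma DivPow_ExtPow_splits n (E : extension (DivPow n) (ExtPow n)) : splits E.
Proof.
have pF := DivPow_is_power n; have pG := ExtPow_is_power n.
have cG := ExtPow_is_copower n.
case: (leqP n 1) => n1.
  apply: (source_eq_splits E pF pG cG (div_kap_top n) (@DivPow_cr n)) => s.
  by rewrite !chi_small.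
have [eps [eG e0]] := functional_lift pF cG E.
pose i0 : 'I_n := Ordinal (ltnW n1); pose i1 : 'I_n := Ordinal n1.
pose tau : 'S_n := tperm i0 i1.
have todd : odd_perm tau by rewrite odd_tperm.
have [f fE] := functional_push_defect pG cG (@DivPow_cr n) eG e0 tau.
(* Evaluating on a lift of gamma_2(x_0) x_2 ... x_(n-1) shows that the defect is even. *)
pose c : {ffun 'I_n -> 'I_n} := [ffun l => if l == i1 then i0 else l].
have [x xE] := ext_prjP E (dcls n (bword (content c))).
have [h hE] : exists h : int, f = h *+ 2.
  (* Since c takes the same value at the two points swapped by [tau], [push tau] does nothing after
     [pull c]; the defect formula then reads e = - e + f. *)
  have := fE (fmap E (pull c) x).
  rewrite (fmap_compE (h := pull c)); last first.
    move=> v; apply/ffunP => l; rewrite push_pull !pullE tpermV !ffunE.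
    by case: tpermP => [->|->|/eqP l0 /eqP l1]; rewrite ?eqxx ?(negbTE l1) //; case: ifP.
  rewrite nt_nat xE div_kap_bword (introT forallP) ?mulr1 //.
  rewrite chi_odd // => e; exists (eps (fmap E (pull c) x)).
  by move: e; lia.
(* The coefficient functional of Gamma^n is invariant while [eps] should change sign, so subtracting
   h times it removes the defect 2h; on G nothing changes. *)
pose eps' x := eps x - h * div_kap n (ext_prj E _ x).
have epsB : zmod_morphism eps'.
  move=> u v; rewrite /eps' !(raddfB eps) (raddfB (ext_prj E _)) (raddfB (div_kap n)).
  by rewrite mulrBr subrACA.
pose ep := mk_additive epsB.
have epG g : ep (ext_inj E _ g) = ext_kap n g.
  by rewrite mk_additiveE /eps' eG ext_prj_inj raddf0 mulr0 subr0.
have ep0 i y : ep (fmap E (proj i) y) = 0.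
  by rewrite mk_additiveE /eps' e0 nt_nat div_kap_proj mulr0 subr0.
have kpush (s : 'S_n) y : div_kap n (fmap (DivPow n) (push s) y) = div_kap n y.
  by rewrite (kap_push pF (DivPow_is_copower n)) chi_false mulr1.
have ep_tau y : ep (fmap E (push tau) y) = - ep y.
  rewrite !mk_additiveE /eps' fE nt_nat kpush chi_odd // hE; ring.
have ep_even (s : 'S_n) y : ~~ odd_perm s -> ep (fmap E (push s) y) = ep y.
  move=> se; rewrite (functional_push_eq pF pG cG (div_kap_top n) (@DivPow_cr n) epG ep0).
    by rewrite chi_even // mulr1.
  by rewrite !chi_even.
apply: (functional_splits pF pG (leqnn n) cG epG ep0) => s y.
case so: (odd_perm s); last by rewrite ep_even ?chi_even ?so // mulr1.
(* An odd s acts as the even [s * tau] followed by [tau]. *)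
rewrite chi_odd // mulrN1 -(ep_even (s * tau)%g y); last by rewrite odd_permM so todd.
rewrite -ep_tau; congr (ep _); symmetry; apply: fmap_compE => v.
by rewrite push_mul -mulgA tperm2 mulg1.
Qed.

Section Primal.
Variables (m n : nat) (b : bool) (G : functor) (g0 : G (Zn n)).
Hypothesis pG : is_power b g0.

Lemma SymPow_lt_splits (E : extension (SymPow m) G) : (n < m)%N -> splits E.
Proof.
move=> nm; have pF := SymPow_is_power m.
have [e [ce eE]] := crossed_lift pF E.
apply: (sym_splits ce (lift_high pF pG (ltnW nm)) eE) => s.
by rewrite (lift_push_lt pF s pG nm ce eE) chi_false mulr1z.
Qed.

Lemma ExtPow_lt_splits (E : extension (ExtPow m) G) : (n < m)%N -> splits E.
Proof.
move=> nm; have pF := ExtPow_is_power m.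
have [e [ce eE]] := crossed_lift pF E.
apply: (alt_splits ce (lift_high pF pG (ltnW nm)) _ eE) => [A g|s].
  exact: (pw_torsion_free pG).
exact: (lift_push_lt pF s pG nm ce eE).
Qed.

End Primal.

Section PrimalSame.
Variables (n : nat) (b : bool) (G : functor) (g0 : G (Zn n)).
Hypothesis pG : is_power b g0.

Lemma SymPow_eq_splits (E : extension (SymPow n) G) :
  (forall s : 'S_n, chi b s = 1) -> splits E.
Proof.
move=> cb; have pF := SymPow_is_power n.
have [e [ce eE]] := crossed_lift pF E.
apply: (sym_splits ce (lift_high pF pG (leqnn n)) eE) => s.
by rewrite (lift_push_eq pF pG ce eE) ?chi_false ?cb // mulr1z.
Qed.

Lemma ExtPow_eq_splits (E : extension (ExtPow n) G) :
  (forall s : 'S_n, chi b s = chi true s) -> splits E.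
Proof.
move=> cb; have pF := ExtPow_is_power n.
have [e [ce eE]] := crossed_lift pF E.
apply: (alt_splits ce (lift_high pF pG (leqnn n)) _ eE) => [A g|s].
  exact: (pw_torsion_free pG).
by rewrite (lift_push_eq pF pG ce eE) ?cb.
Qed.

End PrimalSame.

(** * The parity of an extension *)

Lemma int_parity (f : int) : exists h : int, f = h * 2 \/ f = h * 2 + 1.
Proof.
exists (f %/ 2)%Z; rewrite {1 3}(divz_eq f 2).
have := modz_ge0 f (isT : (2 : int) != 0); have := ltz_pmod f (isT : 0 < 2 :> int).
lia.
Qed.

Lemma Z2_even (h : int) : (h * 2)%:~R = 0 :> 'Z_2.
Proof. by rewrite intrM (_ : 2%:~R = 0 :> 'Z_2) ?mulr0 //; apply: val_inj. Qed.

Lemma Z2_eq0 (f : int) : f%:~R = 0 :> 'Z_2 -> exists h, f = h * 2.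
Proof.
have [h [->|->]] := int_parity f; first by exists h.
by rewrite intrD Z2_even add0r => /eqP; rewrite oner_eq0.
Qed.

Lemma pairMz (U V : zmodType) (x : (U * V)%type) (c : int) :
  x *~ c = (x.1 *~ c, x.2 *~ c).
Proof.
have pairMn p : x *+ p = (x.1 *+ p, x.2 *+ p).
  by elim: p => [|p IH]; rewrite ?mulr0n // !mulrS IH.
by case: c => p; [exact: pairMn | rewrite !NegzE !mulrNz -!pmulrn pairMn].
Qed.

Lemma chi_pm b n (s : 'S_n) : chi b s = 1 \/ chi b s = -1.
Proof. by rewrite /chi; case: (b && s); [right | left]. Qed.

Section Parity.
Variables (b : bool) (n : nat) (F G : functor) (f0 : F (Zn n)) (g0 : G (Zn n)).
Hypotheses (pF : is_power b f0) (pG : is_power (~~ b) g0).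
Variable tau : 'S_n.
Hypothesis todd : odd_perm tau.

(** The value at [tau] of the cocycle of a crossed lift e. It is a relation because f depends on e;
    only its class modulo 2 is determined by E. *)
Definition defect (E : extension F G) (f : int) := exists e : E (Zn n),
  [/\ crossed e, ext_prj E _ e = f0 &
      fmap E (push tau) e = e *~ chi b tau + ext_inj E _ g0 *~ f].

Lemma chi_opp : chi (~~ b) tau = - chi b tau.
Proof. by rewrite /chi todd andbT; case: b; rewrite /= ?andbT ?opprK. Qed.

Lemma defect_ex E : exists f, defect E f.
Proof.
have [e [ce eE]] := crossed_lift pF E.
have [g cg /eqP] := lift_push_defect pF tau ce eE.
have [c ->] := pw_crossed_top pG cg; rewrite subr_eq => /eqP h.
exists (c * chi b tau), e; split=> //.
have := congr1 (fun x => x *~ chi b tau) h.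
rewrite -mulrzA chi_sqr mulr1z mulrzDl addrC => ->.
by rewrite raddfMz -mulrzA.
Qed.

(** As [tau] acts on [g0] by the opposite sign, replacing e by e plus c times [g0] changes f by - 2
    c chi; the chosen c makes this 2 k. *)
Lemma defect_shift E f k : defect E f -> defect E (f + k * 2).
Proof.
case=> e [ce eE te]; pose c := - k * chi b tau.
exists (e + ext_inj E _ g0 *~ c); split.
- move=> i; rewrite raddfD (raddfMz (fmap E _)) ce -nt_nat (pw_proj pG).
  by rewrite raddf0 mul0rz addr0.
- by rewrite raddfD (raddfMz (ext_prj E _)) ext_prj_inj mul0rz addr0.
rewrite raddfD (raddfMz (fmap E _)) te -nt_nat (pw_perm pG) (raddfMz (ext_inj E _)).
rewrite -mulrzA mulrzDl -mulrzA -!addrA -!mulrzDr; congr (_ + _ *~ _).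
rewrite /c chi_opp; have [->|->] := chi_pm b tau; lia.
Qed.

Lemma defect_uniq E f f' : defect E f -> defect E f' -> exists k, f' - f = k * 2.
Proof.
case=> e [ce eE te] [e' [ce' eE' te']].
have [||g cg gE] := @crossed_kernel _ _ E _ (e' - e).
- by move=> i; rewrite raddfB ce ce' subr0.
- by rewrite raddfB eE eE' subrr.
have [k kE] := pw_crossed_top pG cg.
have e'E : e' = e + ext_inj E _ g0 *~ k.
  by rewrite -raddfMz -kE -gE addrC subrK.
move: te'; rewrite {1 2}e'E raddfD te (raddfMz (fmap E _)) -nt_nat (pw_perm pG).
rewrite (raddfMz (ext_inj E _)) mulrzDl -!addrA => /addrI.
rewrite -!mulrzA -!mulrzDr -!(raddfMz (ext_inj E _)) => /ext_injP /eqP.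
rewrite -subr_eq0 -mulrzBr => /eqP /(pw_torsion0 pG).
rewrite chi_opp => h; exists (- k * chi b tau); move: h.
have [->|->] := chi_pm b tau; lia.
Qed.

(** On even permutations both characters are 1 and [lift_push_eq] applies; an odd permutation is an
    even one followed by [tau]. *)
Lemma defect_zero E : defect E 0 -> exists e : E (Zn n),
  [/\ crossed e, ext_prj E _ e = f0 &
      forall s : 'S_n, fmap E (push s) e = e *~ chi b s].
Proof.
case=> e [ce eE]; rewrite mulr0z addr0 => te; exists e; split=> // s.
have ev (u : 'S_n) : ~~ odd_perm u -> fmap E (push u) e = e.
  by move=> ue; rewrite (lift_push_eq pF pG ce eE) !chi_even ?mulr1z.
have [so|/negbTE so] := boolP (odd_perm s); last by rewrite ev ?chi_even ?so ?mulr1z.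
have -> : fmap E (push s) e = fmap E (push tau) (fmap E (push (s * tau^-1)%g) e).
  by symmetry; apply: fmap_compE => v; rewrite push_mul mulgKV.
by rewrite ev ?odd_permM ?odd_permV ?so ?todd // te /chi so todd.
Qed.

Lemma defect_equiv E E' f : ext_equiv E E' -> defect E f -> defect E' f.
Proof.
case=> h [hi hp] [e [ce eE te]]; exists (h _ e); split.
- by move=> i; rewrite -nt_nat ce raddf0.
- by rewrite hp.
- by rewrite -nt_nat te raddfD !raddfMz /= hi.
Qed.

Lemma defect_neg E f : defect E f -> defect (neg_ext E) (- f).
Proof.
case=> e [ce eE te]; exists e; split=> //.
rewrite te /= mk_additiveE; apply: (congr1 (+%R _)).
by rewrite mulrNz mulNrz opprK.
Qed.

Lemma defect_baer E E' f f' : defect E f -> defect E' f' ->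
  defect (baer_sum E E') (f + f').
Proof.
case=> e [ce eE te] [e' [ce' eE' te']].
have hp : (e, e') \in @pb_pred _ _ E E' (Zn n) by rewrite unfold_in /= eE eE'.
exists (quot_pi (@antidiag _ _ E E' (Zn n)) (Pullback hp)); split.
- move=> i; rewrite /= baer_mapE -(raddf0 (quot_pi (@antidiag _ _ E E' (Zn n)))).
  by congr (quot_pi _ _); apply: val_inj; rewrite /= ce ce'.
- by rewrite /= baer_prj_funE.
rewrite /= baer_mapE /baer_inj_fun -!raddfMz -raddfD; apply/quot_piE/span_gen.
(* The inclusion of the Baer sum lands in the first component; this antidiagonal element moves the
   second defect there. *)
exists (- (g0 *~ f')).
have vM (x : pullback E E' (Zn n)) c : pb_val (x *~ c) = pb_val x *~ c.
  exact: (raddfMz (val : {additive _ -> _})).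
have -> : forall u v w : pullback E E' (Zn n),
  pb_val (u - (v + w)) = pb_val u - (pb_val v + pb_val w) by [].
rewrite !vM /= te te' !pairMz /= mul0rz; congr (_, _) => /=.
  rewrite opprD addrACA subrr add0r -mulrzBr opprD addrA subrr sub0r.
  by rewrite mulrNz raddfN raddfMz.
by rewrite addr0 addrAC subrr add0r raddfN opprK raddfMz.
Qed.

Definition parity E : 'Z_2 := (sval (cid (defect_ex E)))%:~R.

Lemma parityE E f : defect E f -> parity E = f%:~R.
Proof.
rewrite /parity; case: cid => f' /= d' d; have [k kE] := defect_uniq d d'.
by apply/eqP; rewrite -subr_eq0 -intrB kE Z2_even.
Qed.

Hypothesis zero_splits : forall E, defect E 0 -> splits E.

(** For injectivity, equal parities give the Baer difference an even defect, which a change of lift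
    brings to 0. *)
Lemma parity_Ext1 (E1 : extension F G) : defect E1 1 -> Ext1_is F G 'Z_2.
Proof.
move=> d1; have pB E E' : parity (baer_sum E E') = parity E + parity E'.
  have [f d] := defect_ex E; have [f' d'] := defect_ex E'.
  by rewrite (parityE d) (parityE d') (parityE (defect_baer d d')) intrD.
exists parity; split=> // [E E'|a].
  split=> [pE|eq]; last first.
    have [f d] := defect_ex E.
    by rewrite (parityE d) (parityE (defect_equiv eq d)).
  apply: splits_equiv; apply: zero_splits.
  have [f d] := defect_ex E; have [f' d'] := defect_ex E'.
  have dD := defect_baer d (defect_neg d').
  have [h fh] : exists h, f - f' = h * 2.
    by apply: Z2_eq0; rewrite intrB -(parityE d) -(parityE d') pE subrr.
  have := defect_shift (- h) dD; rewrite fh mulNr subrr.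
  exact.
have [->|->] : a = 0 \/ a = 1.
  by case: a => -[|[|//]] i; [left | right]; apply: val_inj.
- exists (baer_sum E1 E1); rewrite pB (parityE d1).
  exact: val_inj.
- by exists E1; rewrite (parityE d1).
Qed.

End Parity.

Section Half.
Variables (V : zmodType).

Definition twice (x : V) : Prop := exists y, x = y *+ 2.

Lemma span_twice x : span twice x -> twice x.
Proof.
elim=> // [|y z _ [u ->] _ [v ->]]; first by exists 0; rewrite mul0rn.
by exists (u - v); rewrite mulrnBl.
Qed.

Definition half : zmodType := quot_by twice.
Definition half_pi : {additive V -> half} := quot_pi twice.

Lemma half_pi_eq0 x : half_pi x = 0 <-> twice x.
Proof.
rewrite -(raddf0 half_pi); split=> [/quot_piE|[y ->]].
  by rewrite subr0; exact: span_twice.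
by apply/quot_piE/span_gen; exists y; rewrite subr0.
Qed.

End Half.

(* Given F -> G/2, pull back the extension 0 -> G -2-> G -> G/2 -> 0 along it. *)
Section HalfExtension.
Variables (K : fgfree -> choiceType).
Variable h : forall A B : fgfree, {additive A -> B} -> K A -> K B.
Variable R : forall A, {freeg (K A)} -> Prop.
Hypothesis h_id : forall A : fgfree, h (idfun : {additive A -> A}) =1 id.
Hypothesis h_comp : forall (A B C : fgfree)
  (f : {additive A -> B}) (g : {additive B -> C}),
  h (g \o f : {additive A -> C}) =1 h g \o h f.
Hypothesis h_rel : forall (A B : fgfree) (f : {additive A -> B}) r,
  R r -> span (@R B) (freeg_map (h f) r).
Variable G : functor.
Variable sig : forall A : fgfree, K A -> G A.
Hypothesis sig_map : forall (A B : fgfree) (f : {additive A -> B}) k,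
  fmap G f (sig k) = sig (h f k).
Hypothesis sig_rel : forall A r, @R A r ->
  freeg_lift (fun k => half_pi (G A) (sig k)) r = 0.
Hypothesis two_inj : forall (A : fgfree) (g : G A), g *~ 2 = 0 -> g = 0.

Let F := presented h_id h_comp h_rel.

Definition theta (A : fgfree) : {additive F A -> half (G A)} := quot_lift (@sig_rel A).

Lemma thetaU (A : fgfree) k : theta A (quot_pi (@R A) << k >>) = half_pi _ (sig k).
Proof. exact: quot_liftU. Qed.

(** Naturality of [theta] is put in terms of representatives in G, which avoids making G/2 a
    functor. *)
Lemma theta_nat (A B : fgfree) (f : {additive A -> B}) (x : F A) (y : G A) :
  theta A x = half_pi _ y -> theta B (fmap F f x) = half_pi _ (fmap G f y).
Proof.
suff [z [-> ->]] : exists z, theta A x = half_pi _ z /\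
    theta B (fmap F f x) = half_pi _ (fmap G f z).
  move=> /eqP; rewrite -subr_eq0 -raddfB => /eqP /half_pi_eq0 [w zE].
  apply/eqP; rewrite -subr_eq0 -!raddfB zE; apply/eqP/half_pi_eq0.
  by exists (fmap G f w); rewrite raddfMn.
move: x; apply: quot_ind => [|x x' [z [e1 e2]] [z' [e1' e2']]|k].
- by exists 0; rewrite !raddf0.
- exists (z - z'); rewrite (raddfB (theta A)) e1 e1' (raddfB (fmap F f)).
  by rewrite (raddfB (theta B)) e2 e2' !raddfB.
exists (sig k); split; first exact: thetaU.
have -> : fmap F f (quot_pi (@R A) << k >>) = quot_pi (@R B) << h f k >>.
  exact: etrans (quot_mapE _ _) (congr1 _ (freeg_mapU _ _)).
by rewrite thetaU sig_map.
Qed.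

Section Objects.
Variable A : fgfree.

Definition half_pred : {pred F A * G A} :=
  fun x => theta A x.1 == half_pi _ x.2.

Lemma half_pred_closed : zmod_closed half_pred.
Proof.
split; first by rewrite unfold_in /half_pred !raddf0.
move=> x y; rewrite !unfold_in /half_pred => /eqP hx /eqP hy.
by rewrite (raddfB (theta A)) (raddfB (half_pi _)) hx hy.
Qed.

HB.instance Definition _ :=
  GRing.isZmodClosed.Build (F A * G A)%type half_pred half_pred_closed.

Record half_obj := HalfObj { half_val :> F A * G A; half_valP : half_val \in half_pred }.

HB.instance Definition _ := [isSub for half_val].
HB.instance Definition _ := [Choice of half_obj by <:].
HB.instance Definition _ := [SubChoice_isSubZmodule of half_obj by <:].

End Objects.

Lemma half_map_subproof (A B : fgfree) (f : {additive A -> B}) (x : half_obj A) :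
  (fmap F f (half_val x).1, fmap G f (half_val x).2) \in @half_pred B.
Proof.
by rewrite unfold_in /half_pred; apply/eqP/theta_nat/eqP; exact: (half_valP x).
Qed.

Definition half_map_fun (A B : fgfree) (f : {additive A -> B}) (x : half_obj A) : half_obj B :=
  HalfObj (half_map_subproof f x).

Lemma half_map_additive (A B : fgfree) (f : {additive A -> B}) :
  zmod_morphism (half_map_fun f).
Proof.
move=> x y; apply: val_inj; rewrite /=.
by rewrite (raddfB (fmap F f)) (raddfB (fmap G f)).
Qed.

Definition half_map (A B : fgfree) (f : {additive A -> B}) :
  {additive half_obj A -> half_obj B} := mk_additive (half_map_additive f).

Lemma half_map_val (A B : fgfree) (f : {additive A -> B}) (x : half_obj A) :
  half_val (half_map f x) = (fmap F f (half_val x).1, fmap G f (half_val x).2).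
Proof. by rewrite /half_map mk_additiveE. Qed.

Lemma half_map_id (A : fgfree) : half_map (idfun : {additive A -> A}) =1 id.
Proof.
by case=> -[x y] xP; apply: val_inj; rewrite /= half_map_val !fmap_id.
Qed.

Lemma half_map_comp (A B C : fgfree) (f : {additive A -> B}) (g : {additive B -> C}) :
  half_map (g \o f : {additive A -> C}) =1 half_map g \o half_map f.
Proof.
by move=> x; apply: val_inj; rewrite /= !half_map_val !fmap_comp.
Qed.

Definition half_functor : functor := Functor half_map_id half_map_comp.

Lemma half_inj_subproof (A : fgfree) (g : G A) : (0, g *+ 2) \in @half_pred A.
Proof.
rewrite unfold_in /half_pred /= raddf0 eq_sym; apply/eqP/half_pi_eq0.
by exists g.
Qed.

Lemma half_inj_additive (A : fgfree) :
  zmod_morphism (fun g : G A => HalfObj (half_inj_subproof g) : half_functor A).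
Proof.
move=> x y; apply: val_inj; rewrite /=; congr (_, _); rewrite /= ?subr0 //.
by rewrite mulrnBl.
Qed.

Lemma half_inj_val (A : fgfree) (g : G A) :
  half_val (mk_additive (@half_inj_additive A) g) = (0, g *+ 2).
Proof. by rewrite mk_additiveE. Qed.

Lemma half_inj_natural (A B : fgfree) (f : {additive A -> B}) :
  mk_additive (@half_inj_additive B) \o fmap G f =1
  fmap half_functor f \o mk_additive (@half_inj_additive A).
Proof.
move=> g; apply: val_inj; rewrite /= half_map_val !half_inj_val.
by rewrite (raddf0 (fmap F f)) (raddfMn (fmap G f)).
Qed.

Lemma half_prj_additive (A : fgfree) :
  zmod_morphism (fun x : half_functor A => (half_val x).1).
Proof. by []. Qed.

Lemma half_prj_natural (A B : fgfree) (f : {additive A -> B}) :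
  mk_additive (@half_prj_additive B) \o fmap half_functor f =1
  fmap F f \o mk_additive (@half_prj_additive A).
Proof. by move=> x; rewrite /= !mk_additiveE. Qed.

Definition half_ext : extension F G.
Proof.
apply: (@Extension F G half_functor (NatTrans half_inj_natural) (NatTrans half_prj_natural)).
- move=> A x y /(congr1 (fun z : half_functor A => (half_val z).2)).
  rewrite /= !half_inj_val /= => /eqP; rewrite -subr_eq0 -mulrnBl => /eqP.
  by rewrite pmulrn => /two_inj /eqP; rewrite subr_eq0 => /eqP.
- move=> A y.
  have [z zE] : exists z, theta A y = half_pi _ z.
    by have [z ->] := quot_pi_surj (theta A y); exists z.
  have hp : (y, z) \in @half_pred A by rewrite unfold_in /half_pred zE.
  by exists (HalfObj hp); rewrite /= mk_additiveE.
move=> A x; rewrite /= mk_additiveE; split=> [x0|[g ->]]; last by rewrite half_inj_val.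
have := half_valP x; rewrite unfold_in /half_pred x0 raddf0 eq_sym.
move=> /eqP /half_pi_eq0 [g gE]; exists g; apply: val_inj.
by rewrite /= half_inj_val -x0 -gE; case: (half_val x).
Defined.

(** Lift the generic element to the pair of generic elements. On the second component [tau] acts by
    - chi instead of chi, a difference of - 2 chi; as the inclusion of G doubles, the defect is -
    chi. *)
Lemma half_ext_defect b n (k0 : K (Zn n)) (tau : 'S_n) :
  is_power b (quot_pi (@R _) << k0 >> : F (Zn n)) -> is_power (~~ b) (sig k0) ->
  odd_perm tau -> exists f : int,
    defect b (quot_pi (@R _) << k0 >> : F (Zn n)) (sig k0) tau half_ext f /\
    (f = 1 \/ f = -1).
Proof.
move=> pF pG todd; exists (- chi b tau); split; last first.
  by have [->|->] := chi_pm b tau; [right | left; rewrite opprK].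
have hp : (quot_pi (@R _) << k0 >> : F (Zn n), sig k0) \in @half_pred (Zn n).
  by rewrite unfold_in /half_pred /= thetaU.
exists (HalfObj hp); split.
- move=> i; apply: val_inj; rewrite /= half_map_val /=.
  by rewrite (pw_proj pF) (pw_proj pG).
- by rewrite /= mk_additiveE.
have vM (x y : half_functor (Zn n)) c d :
    half_val (x *~ c + y *~ d) = half_val x *~ c + half_val y *~ d.
  have vM' (z : half_obj (Zn n)) a : half_val (z *~ a) = half_val z *~ a.
    exact: (raddfMz (val : {additive _ -> _})).
  by rewrite -!vM'.
apply: val_inj; apply: etrans (half_map_val (push tau) (HalfObj hp)) _.
apply: etrans (esym (vM (HalfObj hp) (mk_additive (@half_inj_additive _) (sig k0)) _ _)).
rewrite half_inj_val !pairMz mul0rz /=; congr (_, _) => /=.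
  by rewrite addr0; exact: (pw_perm pF).
rewrite (pw_perm pG) pmulrn -mulrzA -mulrzDr (chi_opp b todd); congr (_ *~ _); lia.
Qed.

End HalfExtension.

(** * Equal degrees with different characters *)

Section Mixed.
Variable n : nat.
Hypothesis n2 : (2 <= n)%N.

Let tau : 'S_n := tperm (Ordinal (ltnW n2)) (Ordinal n2).

Let todd : odd_perm tau.
Proof. by rewrite odd_tperm. Qed.

(** Signs disappear modulo 2, so the product of n elements is a map from S^n to Lambda^n/2; its
    pullback is the nonzero class. *)
Lemma SymPow_ExtPow_Ext1 : Ext1_is (SymPow n) (ExtPow n) 'Z_2.
Proof.
have pF := SymPow_is_power n; have pG := ExtPow_is_power n.
have rel (A : fgfree) r : @sym_rel n A r ->
    freeg_lift (fun t => half_pi (ExtPow n A) (ecls t)) r = 0.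
  case=> [_ [t i x y]|t s].
    by rewrite 2!raddfB !freeg_liftU eclsD raddfD -addrA -opprD subrr.
  rewrite raddfB !freeg_liftU ecls_perm -raddfB; apply/half_pi_eq0.
  have [->|->] := chi_pm true s; first by exists 0; rewrite mulr1z subrr mul0rn.
  by exists (- ecls t); rewrite mulrN1z mulr2n.
have [f [d f1]] := half_ext_defect (@ecls_map n) rel (fun A g => @pw_torsion_free _ _ _ _ pG A g 2 isT) (k0 := deltas n)
  pF pG todd.
apply: (parity_Ext1 pF pG todd) => [E /(defect_zero pF pG todd) [e [ce eE es]]|].
  apply: (sym_splits ce (lift_high pF pG (leqnn n)) eE) => s.
  by rewrite es chi_false mulr1z.
case: f1 d => -> d; first exact: d.
(* A defect -1 becomes 1 after a change of lift. *)
by have := defect_shift (b := false) pG todd 1 d; rewrite (_ : -1 + 1 * 2 = 1 :> int).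
Qed.

Definition dword (A : zmodType) (t : {ffun 'I_n -> A}) : seq (nat * A) :=
  [seq (1%N, t i) | i <- enum 'I_n].

Lemma dword_map (A B : fgfree) (f : {additive A -> B}) t :
  fmap (DivPow n) f (dcls n (dword t)) = dcls n (dword (tuple_map f t)).
Proof.
rewrite dcls_map /dword /word_map -map_comp; congr (dcls n _).
by apply: eq_map => i; rewrite /= ffunE.
Qed.

Lemma dword_rem (A : zmodType) (t : {ffun 'I_n -> A}) i :
  perm_eq (dword t) ((1%N, t i) :: [seq (1%N, t l) | l <- rem i (enum 'I_n)]).
Proof. by rewrite -map_cons; apply: perm_map; apply: perm_to_rem; rewrite mem_enum. Qed.

Lemma dwordD (A : fgfree) (t : {ffun 'I_n -> A}) i x y :
  dcls n (dword (upd t i (x + y))) =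
  dcls n (dword (upd t i x)) + dcls n (dword (upd t i y)).
Proof.
have E z : dcls n (dword (upd t i z)) =
    dcls n ((1%N, z) :: [seq (1%N, t l) | l <- rem i (enum 'I_n)]).
  rewrite (dcls_perm n (dword_rem _ i)) ffunE eqxx; congr (dcls n (_ :: _)).
  apply/eq_in_map => l; rewrite mem_rem_uniq ?enum_uniq // inE => /andP[li _].
  by rewrite ffunE (negbTE li).
rewrite !E dcls_add 2!big_ord_recl big_ord0 addr0 /= dcls_zero addrC; congr (_ + _).
rewrite (_ : dcls n _ = dcls n [:: (0%N, y), (1%N, x) & [seq (1%N, t l) | l <- rem i (enum 'I_n)]]).
  by rewrite dcls_zero.
by apply: dcls_perm; exact: (permEl (perm_catCA [:: (1%N, x)] [:: (0%N, y)] _)).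
Qed.

(** As gamma_1(x)^2 = 2 gamma_2(x), the product of n elements is alternating modulo 2 and gives a
    map from Lambda^n to Gamma^n/2. *)
Lemma dword_alt (A : fgfree) (t : {ffun 'I_n -> A}) i j : i != j -> t i = t j ->
  twice (dcls n (dword t)).
Proof.
move=> ij tij; pose w := [seq (1%N, t l) | l <- rem j (rem i (enum 'I_n))].
exists (dcls n ((2%N, t i) :: w)).
rewrite -[2%N in RHS]/('C(1 + 1, 1)) -dcls_mul; apply: dcls_perm.
apply: (perm_trans (dword_rem t i)); rewrite perm_cons tij -map_cons; apply: perm_map.
by apply: perm_to_rem; rewrite mem_rem_uniq ?enum_uniq // inE eq_sym ij mem_enum.
Qed.

Lemma ExtPow_DivPow_Ext1 : Ext1_is (ExtPow n) (DivPow n) 'Z_2.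
Proof.
have pF := ExtPow_is_power n; have pG := DivPow_is_power n.
have top : div_top n = dcls n (dword (deltas n)).
  congr (dcls n _); apply: eq_map => i; by rewrite ffunE.
have rel (A : fgfree) r : @alt_rel n A r ->
    freeg_lift (fun t => half_pi (DivPow n A) (dcls n (dword t))) r = 0.
  case=> [_ [t i x y]|t i j ij tij].
    by rewrite 2!raddfB !freeg_liftU dwordD raddfD -addrA -opprD subrr.
  by rewrite freeg_liftU; apply/half_pi_eq0/(dword_alt ij).
have pG' := pG; rewrite top in pG'.
have [f [d f1]] := half_ext_defect dword_map rel (fun A g => @pw_torsion_free _ _ _ _ pG A g 2 isT) (k0 := deltas n)
  pF pG' todd.
apply: (parity_Ext1 pF pG' todd) => [E /(defect_zero pF pG' todd) [e [ce eE es]]|].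
  apply: (alt_splits ce (lift_high pF pG (leqnn n)) _ eE) => // A g.
  exact: (pw_torsion_free pG).
case: f1 d => -> d; first exact: d.
by have := defect_shift (b := true) pG' todd 1 d; rewrite (_ : -1 + 1 * 2 = 1 :> int).
Qed.

(* The fold identifying x_0 and x_1 turns the defect f into 2 y = f x_0^2 x_2 ... x_(n-1). *)
Lemma ExtPow_SymPow_splits_ge2 (E : extension (ExtPow n) (SymPow n)) : splits E.
Proof.
have pF := ExtPow_is_power n; have pG := SymPow_is_power n.
have [f d] := defect_ex pF pG tau E.
have [k fk] : exists k : int, f = k * 2.
  case: d => e [ce eE te].
  pose c : {ffun 'I_n -> 'I_n} := [ffun l => if l == Ordinal n2 then Ordinal (ltnW n2) else l].
  have cE : fmap E (push c) (fmap E (push tau) e) = fmap E (push c) e.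
    apply: fmap_compE => v.
    apply: (eq_additive (f := push c \o push tau : {additive _ -> _})) => i.
    rewrite /= !push_delta /c !ffunE; congr delta.
    by case: (tpermP _ _ i) => [->|->|/eqP l0 /eqP l1]; rewrite ?eqxx ?(negbTE l1) //; case: ifP.
  have [y yE] : exists y, fmap E (push c) e = ext_inj E _ y.
    apply: ext_inj_exists; rewrite nt_nat eE ecls_map.
    apply: (@ecls_alt _ _ _ (Ordinal (ltnW n2)) (Ordinal n2)) => //.
    by rewrite !ffunE !push_delta !ffunE eqxx.
  have := congr1 (fmap E (push c)) te; rewrite cE raddfD !(raddfMz (fmap E _)).
  rewrite -nt_nat yE chi_odd // mulrN1z => /eqP; rewrite addrC -subr_eq opprK.
  rewrite -raddfD -(raddfMz (ext_inj E _)) => /eqP /ext_injP yy.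
  exists (sym_lam (orep c) y).
  have := congr1 (sym_lam (orep c)) yy; rewrite raddfD (raddfMz (sym_lam _)) scls_map.
  have -> : tuple_map (push c) (deltas n) = bas c.
    by apply/ffunP => l; rewrite !ffunE push_delta ?ffunE.
  by rewrite sym_lam_bas eqxx; lia.
have := defect_shift (b := true) pG todd (- k) d; rewrite fk mulNr subrr.
case/(defect_zero pF pG todd) => e [ce eE es].
apply: (alt_splits ce (lift_high pF pG (leqnn n)) _ eE) => // A g.
exact: (pw_torsion_free pG).
Qed.

End Mixed.

Lemma ExtPow_SymPow_splits n (E : extension (ExtPow n) (SymPow n)) : splits E.
Proof.
case: (leqP 2 n) => n2; first exact: ExtPow_SymPow_splits_ge2.
apply: (ExtPow_eq_splits (SymPow_is_power n)) => s.
by rewrite !chi_small.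
Qed.

Theorem theorem7 (m n : nat) :
  (* (a) *) Ext1_is (SymPow m) (DivPow n) 'I_1 /\
  (* (b) *) ((m = n /\ (2 <= n)%N -> Ext1_is (SymPow m) (ExtPow n) 'Z_2) /\
             (~ (m = n /\ (2 <= n)%N) -> Ext1_is (SymPow m) (ExtPow n) 'I_1)) /\
  (* (c) *) ((n <= m)%N -> Ext1_is (SymPow m) (SymPow n) 'I_1) /\
  (* (d) *) ((m = n /\ (2 <= n)%N -> Ext1_is (ExtPow m) (DivPow n) 'Z_2) /\
             (~ (m = n /\ (2 <= n)%N) -> Ext1_is (ExtPow m) (DivPow n) 'I_1)) /\
  (* (e) *) Ext1_is (ExtPow m) (ExtPow n) 'I_1 /\
  (* (f) *) ((n <= m)%N -> Ext1_is (ExtPow m) (SymPow n) 'I_1) /\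
  (* (g) *) (m = n -> Ext1_is (DivPow m) (DivPow n) 'I_1) /\
  (* (h) *) ((m <= n)%N -> Ext1_is (DivPow m) (ExtPow n) 'I_1).
Proof.
have S k := SymPow_is_power k; have L k := ExtPow_is_power k.
have D k := DivPow_is_power k.
have cL k := ExtPow_is_copower k; have cD k := DivPow_is_copower k.
split; [|split; [split|split; [|split; [split|split; [|split; [|split]]]]]].
(* The functional handles a source of smaller degree and the generic element one of larger degree;
   in equal degree both characters are trivial here. *)
- apply: split_Ext1_trivial => E; case: (ltngtP m n) => [mn|nm|mn].
  + exact: (source_lt_splits (S m) (D n) (cD n) E mn).
  + exact: (SymPow_lt_splits (D n) E nm).
  + by subst n; apply: (SymPow_eq_splits (D m)).
- by case=> -> n2; exact: SymPow_ExtPow_Ext1.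
- move=> mn2; apply: split_Ext1_trivial => E; case: (ltngtP m n) => [mn|nm|mn].
  + exact: (source_lt_splits (S m) (L n) (cL n) E mn).
  + exact: (SymPow_lt_splits (L n) E nm).
  + subst n; apply: (SymPow_eq_splits (L m)) => s; apply: chi_small.
    by rewrite leqNgt; apply/negP => m2; apply: mn2.
- rewrite leq_eqVlt => nm; apply: split_Ext1_trivial => E.
  case/orP: nm => [/eqP nm|nm]; last exact: (SymPow_lt_splits (S n) E nm).
  by subst n; apply: (SymPow_eq_splits (S m)).
- by case=> -> n2; exact: ExtPow_DivPow_Ext1.
- move=> mn2; apply: split_Ext1_trivial => E; case: (ltngtP m n) => [mn|nm|mn].
  + exact: (source_lt_splits (L m) (D n) (cD n) E mn).
  + exact: (ExtPow_lt_splits (D n) E nm).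
  + subst n; apply: (ExtPow_eq_splits (D m)) => s; rewrite !chi_small //;
    by rewrite leqNgt; apply/negP => m2; apply: mn2.
- apply: split_Ext1_trivial => E; case: (ltngtP m n) => [mn|nm|mn].
  + exact: (source_lt_splits (L m) (L n) (cL n) E mn).
  + exact: (ExtPow_lt_splits (L n) E nm).
  + by subst n; apply: (ExtPow_eq_splits (L m)).
- rewrite leq_eqVlt => nm; apply: split_Ext1_trivial => E.
  case/orP: nm => [/eqP nm|nm]; last exact: (ExtPow_lt_splits (S n) E nm).
  by subst n; exact: ExtPow_SymPow_splits.
- by move=> ->; apply: split_Ext1_trivial => E; exact: DivPow_DivPow_splits.
rewrite leq_eqVlt => mn; apply: split_Ext1_trivial => E.
case/orP: mn => [/eqP mn|mn]; last exact: (source_lt_splits (D m) (L n) (cL n) E mn).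
by subst n; exact: DivPow_ExtPow_splits.
Qed.
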